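(* Let $\Omega\subset\mathbb{C}$ be a domain and $V\subset\Omega$ a bounded open set such that for each $\alpha\in\overline{V}\cap\partial\Omega$ there exists $\beta\in\Omega^c$, $\beta\neq\alpha$, with $[\alpha,\beta]\subseteq\Omega^c$. Let $X$ be any of the spaces $OL^p(\Omega,V)$ $(0<p<\infty)$ or $X_q=\bigcap_{0<p<q}OL^p(\Omega,V)$ $(0<q\le\infty)$. Then the set of totally unbounded functions in $X$ is a $G_\delta$ and dense subset of $X$. Furthermore, the set of non-extendable functions in $X$ is also a $G_\delta$ and dense subset of $X$.
   Context: A domain is a nonempty connected open set; $\Omega^c=\mathbb{C}\smallsetminus\Omega$; $[\alpha,\beta]$ is the closed line segment; closures and boundaries are taken in $\mathbb{C}$. For $0<p<\infty$, $OL^p(\Omega,V)$ is the space of holomorphic functions $f$ on $\Omega$ such that $\iint_V|f|^p\,dx\,dy<\infty$. Let $K_m$, $m=2,3,\dots$, be an exhaustive sequence of compact subsets of $\Omega$. Put $d_{1,p,V}(f,g)=\big(\iint_V|f-g|^p\,dx\,dy\big)^{1/p}$ if $1\le p<\infty$, $d_{1,p,V}(f,g)=\iint_V|f-g|^p\,dx\,dy$ if $0<p<1$, and $d_{m,p,V}(f,g)=\sup_{z\in K_m}|f(z)-g(z)|$ for $m=2,3,\dots$. The space $OL^p(\Omega,V)$ is endowed with the metric $$d_{p,V}(f,g)=\sum_{m=1}^\infty\frac1{2^m}\frac{d_{m,p,V}(f,g)}{1+d_{m,p,V}(f,g)}.$$ For $0<q\le\infty$, convergence in $X_q=\bigcap_{0<p<q}OL^p(\Omega,V)$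 means convergence in $OL^p(\Omega,V)$ for all $0<p<q$; this is the topology induced by the metric $$d_{X_q,V}(f,g)=\sum_{n=1}^\infty\frac1{2^n}\frac{d_{p_n,V}(f,g)}{1+d_{p_n,V}(f,g)},$$ where $(p_n)_{n\ge 1}$ is any strictly increasing sequence of positive numbers converging to $q$. A function $g:\Omega\to\mathbb{C}$ is called totally unbounded (on $\Omega$) if for every open disc $B(\zeta,\varepsilon)$ with $\varepsilon>0$ and $\zeta\in\partial\Omega$ and every connected component $Y$ of $B(\zeta,\varepsilon)\cap\Omega$ the restriction $g|_Y$ is unbounded. A holomorphic function $f$ on $\Omega$ is called extendable if there exist a domain $U\subset\mathbb{C}$ with $\partial\Omega\cap U\neq\emptyset$ and a holomorphic function $F$ on $U$ such that $f|_Y=F|_Y$ for some connected component $Y$ of $U\cap\Omega$. Otherwise $f$ is called non-extendable. *)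

(* Defs.v *)
From HB Require Import structures.
From mathcomp Require Import all_boot all_order all_algebra.
From mathcomp Require Import complex.
From mathcomp Require Import all_classical all_reals all_analysis.
From mathcomp Require Import borel_hierarchy.

Set Implicit Arguments.
Unset Strict Implicit.
Unset Printing Implicit Defensive.

Import Order.TTheory GRing.Theory Num.Theory.
Import numFieldNormedType.Exports.

Local Open Scope classical_set_scope.
Local Open Scope ring_scope.

(* The regular-algebra tag ^o is what carries the topology and the norm of the
   numFieldType R[i]; derivability of f : Cplx R -> Cplx R is then complex
   differentiability. *)
Notation Cplx R := (R[i]^o).

Section metric_subspace.
Context {R : realType} {T : choiceType}.

(* The subset A of T with the topology induced by the metric d: the open sets
   are those containing, with each point, a d-ball of A around it. *)
Definition metric_subspace (A : set T) (d : T -> T -> R) : Type := set_type A.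

Variables (A : set T) (d : T -> T -> R).

HB.instance Definition _ := Choice.on (metric_subspace A d).

Definition metric_open (U : set (metric_subspace A d)) : Prop :=
  forall x, U x -> exists2 e : R, 0 < e &
    forall y : metric_subspace A d, d (sval x) (sval y) < e -> U y.

Let metric_openT : metric_open setT.
Proof. by move=> x _; exists 1. Qed.

Let metric_openI (U W : set (metric_subspace A d)) :
  metric_open U -> metric_open W -> metric_open (U `&` W).
Proof.
move=> oU oW x [/oU[e e0 eU] /oW[e' e'0 eW]].
exists (Num.min e e'); first by rewrite lt_min e0.
by move=> y; rewrite lt_min => /andP[/eU Uy /eW Wy].
Qed.

Let metric_open_bigU (I : Type) (f : I -> set (metric_subspace A d)) :
  (forall i, metric_open (f i)) -> metric_open (\bigcup_i f i).
Proof.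
move=> of_ x [i _ /of_[e e0 ef]]; exists e => // y /ef fy.
by exists i.
Qed.

HB.instance Definition _ := isOpenTopological.Build (metric_subspace A d)
  metric_openT metric_openI metric_open_bigU.

Definition Gdelta_dense_in (S : set T) : Prop :=
  let S' := [set x : metric_subspace A d | S (sval x)] in
  Gdelta S' /\ dense S'.

End metric_subspace.

Section plane_sets.
Context {R : realType}.
Implicit Types (D U A : set (Cplx R)) (K : nat -> set (Cplx R)).

Definition is_domain U : Prop := [/\ U !=set0, open U & connected U].

Definition boundary A : set (Cplx R) := closure A `\` interior A.

Definition segment (a b : Cplx R) : set (Cplx R) :=
  [set ((1 - t)%:C * a + t%:C * b)%C | t in `[0 : R, 1]].

Definition is_component A (Y : set (Cplx R)) : Prop :=
  exists2 z, A z & Y = connected_component A z.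

(* Indexed by m >= 2; K 0 and K 1 play no role. *)
Definition exhaustive D K : Prop :=
  [/\ forall m, (2 <= m)%N -> compact (K m),
      forall m, (2 <= m)%N -> K m `<=` interior (K m.+1) &
      \bigcup_(m in [set m | (2 <= m)%N]) K m = D].

End plane_sets.

Section function_spaces.
Context {R : realType}.
Implicit Types (D U V : set (Cplx R)) (f g F : Cplx R -> Cplx R).

Definition holomorphic U f : Prop := forall z, U z -> derivable f z 1.

Definition dxdy := (@lebesgue_measure R \x @lebesgue_measure R)%E.

Definition integral_pow V (p : R) f : \bar R :=
  (\int[dxdy]_(w in [set w | V (w.1 +i* w.2)%C])
     (Normc.normc (f (w.1 +i* w.2)%C) `^ p)%:E)%E.

(* A function on D is represented by its extension by 0 to the whole plane, so
   that equal functions on D are equal elements of the space. *)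
Definition OL D V (p : R) : set (Cplx R -> Cplx R) :=
  [set f | [/\ holomorphic D f, forall z, ~ D z -> f z = 0 &
              (integral_pow V p f < +oo)%E]].

Definition OL_cap D V (q : \bar R) : set (Cplx R -> Cplx R) :=
  \bigcap_(p in [set p : R | 0 < p /\ (p%:E < q)%E]) OL D V p.

Definition dist_Lp V (p : R) f g : R :=
  let I := fine (integral_pow V p (fun z => f z - g z)) in
  if 1 <= p then I `^ p^-1 else I.

(* The supremum over the empty set is 0. *)
Definition dist_sup (L : set (Cplx R)) f g : R :=
  sup [set Normc.normc (f z - g z) | z in L].

Definition weighted_sum (d : nat -> R) : R :=
  limn (fun N => \sum_(1 <= m < N) 2 ^- m * (d m / (1 + d m))).

Definition dist_OL (K : nat -> set (Cplx R)) V (p : R) f g : R :=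
  weighted_sum (fun m =>
    if m == 1%N then dist_Lp V p f g else dist_sup (K m) f g).

Definition dist_OL_cap (K : nat -> set (Cplx R)) V (p_ : nat -> R) f g : R :=
  weighted_sum (fun n => dist_OL K V (p_ n) f g).

Definition totally_unbounded D g : Prop :=
  forall (zeta : Cplx R) (e : R) Y, boundary D zeta -> 0 < e ->
    is_component (ball zeta (e%:C)%C `&` D) Y -> ~ bounded_set (g @` Y).

Definition extendable D f : Prop :=
  exists U F Y, [/\ is_domain U, boundary D `&` U !=set0, holomorphic U F,
    is_component (U `&` D) Y & {in Y, f =1 F}].

End function_spaces.

(* Main.v *)
(** Rational discs [B], with a rational point of a component [Y] of [B `&` Omega], give
    countably many pairs [(B, Y)] with [B] not inside [Omega], and it suffices to test
    total unboundedness and (bounded) extendability on these. That [f] is unbounded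
    on [Y] is a countable intersection of open conditions, evaluations being
    continuous. That [f] extends from [Y] to a function on [B] bounded by [M] is a
    closed condition, by Montel's theorem. Hence both sets are G_delta, and a totally
    unbounded function is not extendable, so only the density of the former is left.

    Each [Y] has a point [a] of the boundary of [Omega] in its closure. Either
    [1 / (z - a)] or, when [a] is in the closure of [V], a branch of
    [log ((z - b) / (z - a))], single-valued as [[a, b]] is outside [Omega], is
    unbounded on [Y] and in every [L^p] of [V]. A gliding hump adds small multiples of
    these functions to a given [f] and makes it unbounded on every [Y]. That the sum
    stays in the space follows from [|sum a_k|^p <= sum (2^(k+1) |a_k|)^p], which holds
    for all [p > 0].

    Holomorphy of limits is obtained from Cauchy's formula on squares, which rests on
    Goursat's theorem since holomorphic only means complex differentiable. *)

Require Import Defs.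
From mathcomp Require Import all_boot all_order all_algebra.
From mathcomp Require Import complex.
From mathcomp Require Import all_classical all_reals all_analysis.
From mathcomp Require Import measurable_realfun borel_hierarchy ring lra.

Import Order.TTheory GRing.Theory Num.Theory.
Import numFieldNormedType.Exports.

Local Open Scope classical_set_scope.
Local Open Scope ring_scope.

Set Implicit Arguments.
Unset Strict Implicit.
Unset Printing Implicit Defensive.

(** * The complex plane *)

(** Density comes from the explicit construction alone: neither completeness of the spaces nor
    Baire's theorem enters. The obstacle is that one series has to lie in [L^p] for infinitely many
    exponents at once, some of them below 1, where the triangle inequality of the norm fails. Hence
    every singular function is required to be in all [L^p] together; near [V] this excludes
    [1 / (z - a)], whose p-th power need not be integrable for p >= 2, and calls for a logarithm.
    The coefficients of the series are restricted diagonally: the k-th one answers to a single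
    compact set and to finitely many exponents. Limits are taken along ultrafilters finer than the
    cofinite filter. One such ultrafilter makes bounded values converge at all points
    simultaneously, so no subsequence is extracted. Cauchy's formula is kept in the form
    [f b * N b], where [N b] is the integral of [1 / (z - b)] over the boundary of the rectangle.
    Its value is never computed; that it does not vanish is enough to divide by it. *)

Section complex_plane.
Context {R : realType}.
Implicit Types (a b z w h : Cplx R) (f g : Cplx R -> Cplx R) (e : R).

Local Notation nc := (@Normc.normc R).

Lemma normCE z : `|z| = (nc z)%:C%C.
Proof. by rewrite normc_def; case: z. Qed.

Lemma nc_ge0 z : 0 <= nc z.
Proof. by rewrite -ler0c -normCE. Qed.

Lemma nc0 : nc (0 : Cplx R) = 0.
Proof. exact: Normc.normc0. Qed.

Lemma nc1 : nc (1 : Cplx R) = 1.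
Proof. exact: Normc.normc1. Qed.

Lemma ncM z w : nc (z * w) = nc z * nc w.
Proof. exact: Normc.normcM. Qed.

Lemma ncV z : nc z^-1 = (nc z)^-1.
Proof. exact: Normc.normcV. Qed.

Lemma ncN z : nc (- z) = nc z.
Proof. exact: normcN. Qed.

Lemma ncD z w : nc (z + w) <= nc z + nc w.
Proof. exact: le_normcD. Qed.

Lemma ncB z w : nc (z - w) = nc (w - z).
Proof. by rewrite -ncN opprB. Qed.

Lemma nc_eq0 z : (nc z == 0) = (z == 0).
Proof.
apply/eqP/eqP => [|->]; last exact: nc0.
exact: Normc.eq0_normc.
Qed.

Lemma nc_gt0 z : (0 < nc z) = (z != 0).
Proof. by rewrite lt_neqAle nc_ge0 andbT eq_sym nc_eq0. Qed.

Lemma nc_realE (x : R) : nc (x%:C%C) = `|x|.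
Proof. by rewrite /Normc.normc /= expr0n addr0 sqrtr_sqr. Qed.

Lemma ncB_ge z w : nc z - nc w <= nc (z - w).
Proof. by rewrite lerBlDr (le_trans _ (ncD _ _))// subrK. Qed.

Lemma nc_sum I (r : seq I) (P : pred I) (F : I -> Cplx R) :
  nc (\sum_(i <- r | P i) F i) <= \sum_(i <- r | P i) nc (F i).
Proof.
elim/big_rec2 : _ => [|i x y _ h]; first by rewrite nc0.
by rewrite (le_trans (ncD _ _))// lerD2l.
Qed.

Lemma Re_le_nc z : `|complex.Re z| <= nc z.
Proof.
case: z => x y /=; rewrite -sqrtr_sqr ler_sqrt ?addr_ge0 ?sqr_ge0//.
by rewrite lerDl sqr_ge0.
Qed.

Lemma Im_le_nc z : `|complex.Im z| <= nc z.
Proof.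
case: z => x y /=; rewrite -sqrtr_sqr ler_sqrt ?addr_ge0 ?sqr_ge0//.
by rewrite lerDr sqr_ge0.
Qed.

Lemma ReD z w : complex.Re (z + w) = complex.Re z + complex.Re w.
Proof. by case: z w => ? ? []. Qed.

Lemma ImD z w : complex.Im (z + w) = complex.Im z + complex.Im w.
Proof. by case: z w => ? ? []. Qed.

Lemma ReB z w : complex.Re (z - w) = complex.Re z - complex.Re w.
Proof. by case: z w => ? ? []. Qed.

Lemma ImB z w : complex.Im (z - w) = complex.Im z - complex.Im w.
Proof. by case: z w => ? ? []. Qed.

Lemma nc_le_ReIm z : nc z <= `|complex.Re z| + `|complex.Im z|.
Proof.
rewrite [z in nc z]complexE (le_trans (ncD _ _))// ncM nc_realE.
rewrite (_ : nc 'i%C = 1) ?mul1r ?nc_realE//.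
by rewrite /Normc.normc /= expr0n add0r expr1n sqrtr1.
Qed.

Lemma ballCE a e z : ball a (e%:C)%C z <-> nc (a - z) < e.
Proof. by rewrite -ball_normE /ball_ /= normCE ltcR. Qed.

Lemma pos_realC (e : R[i]) : 0 < e -> exists2 r : R, 0 < r & e = r%:C%C.
Proof.
case: e => x y; rewrite ltcE /= => /andP[/eqP -> x0].
by exists x.
Qed.

Lemma nbhsC a (P : set (Cplx R)) :
  nbhs a P <-> exists2 e : R, 0 < e & forall z, nc (z - a) < e -> P z.
Proof.
split=> [/nbhs_ballP[e /= /pos_realC[r r0 ->] h]|[e e0 h]].
  by exists r => // z za; apply: h; apply/ballCE; rewrite ncB.
apply/nbhs_ballP; exists (e%:C)%C; first by rewrite /= ltcR.
by move=> z /ballCE; rewrite ncB; apply: h.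
Qed.

Lemma openCP (U : set (Cplx R)) : open U <->
  forall a, U a -> exists2 e : R, 0 < e & forall z, nc (z - a) < e -> U z.
Proof.
rewrite openE; split=> h a /h; rewrite /interior /= => /nbhsC //.
Qed.

Lemma closureCP (A : set (Cplx R)) a : closure A a <->
  forall e : R, 0 < e -> exists2 z, A z & nc (z - a) < e.
Proof.
split=> [cl e e0|h B /nbhsC[e /h[z Az za] eB]].
  have /cl[z [Az /=]] : nbhs a [set z | nc (z - a) < e].
    by apply/nbhsC; exists e.
  by exists z.
by exists z; split=> //; exact: eB.
Qed.

Lemma cvgCP T (F : set_system T) (FF : Filter F) (f : T -> Cplx R) a :
  f @ F --> a <-> forall e : R, 0 < e -> \forall x \near F, nc (f x - a) < e.
Proof.
split=> [fa e e0|h P /nbhsC[e /h he eP]].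
  have /fa : nbhs a [set z | nc (z - a) < e] by apply/nbhsC; exists e.
  by [].
by apply: filterS he => x /eP.
Qed.

Lemma cvgBC T (F : set_system T) (FF : Filter F) (f g : T -> Cplx R) a b :
  f @ F --> a -> g @ F --> b -> (fun x => f x - g x) @ F --> a - b.
Proof.
move=> /(cvgCP FF) fa /(cvgCP FF) gb; apply/(cvgCP FF) => e e0.
have e2 : 0 < e / 2 by rewrite divr_gt0.
apply: filterS2 (fa _ e2) (gb _ e2) => x fx gx.
have -> : f x - g x - (a - b) = (f x - a) - (g x - b) by rewrite !opprD !opprK addrACA.
by rewrite (le_lt_trans (ncD _ _))// ncN (splitr e) ltrD.
Qed.

Lemma continuousCP f a : {for a, continuous f} <->
  forall e : R, 0 < e -> exists2 d : R, 0 < d &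
    forall z, nc (z - a) < d -> nc (f z - f a) < e.
Proof.
rewrite /continuous_at; split=> [/cvgCP h e /h/nbhsC//|h].
by apply/(cvgCP (nbhs_filter a)) => e /h/nbhsC.
Qed.

(** The first-order expansion, free of quotients: [h = 0] needs no exclusion, and the remainder is
    in the form that the estimates of contour integrals consume. *)
Definition has_deriv f a D := forall e, 0 < e -> exists2 d, 0 < d &
  forall h, nc h < d -> nc (f (a + h) - f a - h * D) <= e * nc h.

Lemma derivableCP f a : derivable f a 1 <-> exists D, has_deriv f a D.
Proof.
split=> [df|[D hD]].
  exists ('D_1 f a) => e e0.
  move: df => /cvgCP /(_ e e0).
  move=> /nbhs_ballP[r /= /pos_realC[d d0 ->] h].
  exists d => // k kd.
  have [->|k0] := eqVneq k 0; first by rewrite addr0 subrr mul0r subrr nc0 mulr0.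
  have := h k; rewrite ballCE sub0r ncN => /(_ kd k0) /ltW.
  rewrite /= => {}h.
  have -> : f (a + k) - f a - k * 'D_1 f a =
     (k^-1 *: (f (k *: 1 + a) - f a) - 'D_1 f a) * k.
    rewrite /GRing.scale /= mulr1 (addrC k) mulrBl mulrAC mulVf// mul1r.
    by rewrite (mulrC k).
  by rewrite ncM ler_wpM2r// nc_ge0.
apply/cvg_ex; exists D; apply/cvgCP => e e0.
have e20 : 0 < e / 2 by rewrite divr_gt0.
have [d d0 h] := hD _ e20.
apply/nbhs_ballP; exists d%:C%C; first by rewrite /= ltcR.
move=> k /ballCE; rewrite sub0r ncN => kd /= k0.
have -> : k^-1 *: (f (k *: 1 + a) - f a) - D = (f (a + k) - f a - k * D) * k^-1.
  rewrite /GRing.scale /= mulr1 (addrC k) [RHS]mulrBl (mulrC k D) mulfK//.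
  by rewrite mulrC.
rewrite ncM ncV ltr_pdivrMr ?nc_gt0// (le_lt_trans (h _ kd))//.
by rewrite ltr_pM2r ?nc_gt0// ltr_pdivrMr// ltr_pMr// ltr1n.
Qed.

Lemma derivable_continuousC f a : derivable f a 1 -> {for a, continuous f}.
Proof.
move=> /derivableCP[D hD]; apply/continuousCP => e e0.
have [d d0 h] := hD 1 ltr01.
pose r := Num.min d (e / (2 + nc D)).
have D0 : 0 < 2 + nc D by rewrite ltr_wpDr ?nc_ge0.
exists r; first by rewrite lt_min d0 divr_gt0.
move=> z; rewrite lt_min => /andP[zd ze].
have := h _ zd; rewrite mul1r (addrC a) subrK => {}h.
rewrite -[f z - f a](subrK ((z - a) * D)) (le_lt_trans (ncD _ _))//.
rewrite (le_lt_trans (lerD h (lexx _)))// ncM -[X in X + _]mulr1 -mulrDr.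
rewrite (le_lt_trans (_ : _ <= nc (z - a) * (2 + nc D)))//.
  by rewrite ler_wpM2l ?nc_ge0// lerD2r ler1n.
by rewrite -ltr_pdivlMr.
Qed.

Lemma has_deriv_local f g a D r : 0 < r -> (forall z, nc (z - a) < r -> f z = g z) ->
  has_deriv f a D -> has_deriv g a D.
Proof.
move=> r0 fg hf e e0; have [d d0 h] := hf e e0.
exists (Num.min d r); first by rewrite lt_min d0.
move=> k; rewrite lt_min => /andP[kd kr].
rewrite -!fg ?subrr ?nc0//; first exact: h.
by rewrite addrAC subrr add0r.
Qed.

Lemma holomorphic_eq (U : set (Cplx R)) f g : open U -> {in U, f =1 g} ->
  holomorphic U f -> holomorphic U g.
Proof.
move=> oU fg hf z Uz; apply/derivableCP.
have /derivableCP[D hD] := hf z Uz; exists D.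
have [e e0 eU] := (openCP U).1 oU z Uz.
by apply: (has_deriv_local e0 _ hD) => w /eU Uw; apply: fg; rewrite inE.
Qed.

Lemma continuousCRP (f : Cplx R -> R) a : {for a, continuous f} <->
  forall e : R, 0 < e -> exists2 d : R, 0 < d &
    forall z, nc (z - a) < d -> `|f z - f a| < e.
Proof.
split=> [fa e e0|h P /nbhs_ballP[e /= /h[d d0 hd] eP]]; last first.
  apply/nbhsC; exists d => // z /hd fz; apply: eP.
  by rewrite -ball_normE /ball_ /= distrC.
have /fa/nbhsC[d d0 hd] : nbhs (f a) (ball (f a) e) by exact: nbhsx_ballx.
by exists d => // z /hd; rewrite -ball_normE /ball_ /= distrC.
Qed.

Lemma nc_continuous : continuous (nc : Cplx R -> R).
Proof.
move=> a; apply/continuousCRP => e e0; exists e => // z za.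
apply: le_lt_trans za; rewrite ler_norml ncB_ge andbT.
by rewrite lerNl opprB ncB ncB_ge.
Qed.

Lemma Re_continuous : continuous (@complex.Re R : Cplx R -> R).
Proof.
move=> a; apply/continuousCRP => e e0; exists e => // z za.
apply: le_lt_trans za; rewrite (le_trans _ (Re_le_nc _))//.
by case: z a => ? ? [].
Qed.

Lemma Im_continuous : continuous (@complex.Im R : Cplx R -> R).
Proof.
move=> a; apply/continuousCRP => e e0; exists e => // z za.
apply: le_lt_trans za; rewrite (le_trans _ (Im_le_nc _))//.
by case: z a => ? ? [].
Qed.

Lemma compact_nc_bounded (A : set (Cplx R)) f : compact A ->
  (forall z, A z -> {for z, continuous f}) -> exists M, forall z, A z -> nc (f z) <= M.
Proof.
move=> cA cf.
have : compact ((nc \o f) @` A).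
  apply: continuous_compact => //; apply: continuous_in_subspaceT => z.
  rewrite inE => /cf fz; apply: continuous_comp => //; exact: nc_continuous.
move=> /compact_bounded[M [_ hM]]; exists (M + 1) => z Az.
have := hM (M + 1); rewrite ltrDl ltr01 => /(_ isT) /(_ (nc (f z))) /=.
rewrite ger0_norm ?nc_ge0//; apply; by exists z.
Qed.

Lemma ball_connected a (r : R) : connected (ball a (r%:C)%C).
Proof.
have [r0|r0] := ltP 0 r; last first.
  rewrite (_ : ball _ _ = set0); first exact: connected0.
  apply/seteqP; split => // z /ballCE zr.
  by have := le_lt_trans (nc_ge0 _) zr; rewrite ltNge r0.
(* The disc is the union of the segments from its centre, which all share that centre. *)
have -> : ball a (r%:C)%C = \bigcup_(z in ball a (r%:C)%C)
   ((fun t : R => (a + t%:C * (z - a))%C : Cplx R) @` `[0, 1]%classic).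
  apply/seteqP; split => [z bz|w [z /ballCE bz [t]]].
    exists z => //; exists 1; rewrite ?set_itvE /= ?ler01 ?lexx//.
    by rewrite mul1r addrC subrK.
  rewrite /= in_itv /= => /andP[t0 t1] <-; apply/ballCE.
  rewrite opprD addrA subrr add0r ncN ncM nc_realE ger0_norm// ncB.
  by rewrite (le_lt_trans _ bz)// ler_piMl// nc_ge0.
apply: bigcup_connected.
  exists a => z _; exists 0; rewrite ?set_itvE /= ?lexx ?ler01//.
  by rewrite mul0r addr0.
move=> z _; apply: connected_continuous_connected.
  exact/segment_connected.
apply: continuous_subspaceT => t; apply/cvgCP => e e0.
pose d := e / (1 + nc (z - a)).
have z0 : 0 < 1 + nc (z - a) by rewrite ltr_wpDr ?nc_ge0.
have d0 : 0 < d by rewrite divr_gt0.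
near=> s.
have -> : (a + s%:C * (z - a) - (a + t%:C * (z - a)) = (s - t)%:C * (z - a))%C.
  by rewrite rmorphB /= mulrBl; ring.
rewrite ncM nc_realE (le_lt_trans (_ : _ <= `|s - t| * (1 + nc (z - a))))//.
  by rewrite ler_wpM2l// lerDr ler01.
rewrite -ltr_pdivlMr// distrC; near: s.
Unshelve. all: by end_near. Qed.

Lemma open_ballC a (r : R) : open (ball a (r%:C)%C).
Proof.
apply/openCP => z /ballCE zr; exists (r - nc (a - z)); first by rewrite subr_gt0.
move=> w wz; apply/ballCE; rewrite -(subrK z a) -addrA (le_lt_trans (ncD _ _))//.
by rewrite (ncB z) -ltrBrDl.
Qed.

End complex_plane.
Local Notation nc := (@Normc.normc _).

(** * Contour integrals *)

Section cint.
Context {R : realType}.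
Implicit Types (a b : R) (f g : R -> Cplx R) (c : Cplx R).
Local Notation mu := (@lebesgue_measure R).
Local Notation Re := (@complex.Re R).
Local Notation Im := (@complex.Im R).

Definition cint a b f : Cplx R :=
  Complex (\int[mu]_(t in `[a, b]) Re (f t)) (\int[mu]_(t in `[a, b]) Im (f t)).

Definition cont_itv a b f := forall t : R, a <= t <= b -> {for t, continuous f}.

Lemma itvccP a b t : `[a, b]%classic t -> a <= t <= b.
Proof. by rewrite /= in_itv. Qed.

Lemma integrable_real a b (f : R -> R) :
  (forall t : R, a <= t <= b -> {for t, continuous f}) ->
  mu.-integrable `[a, b] (EFin \o f).
Proof.
move=> cf; apply: continuous_compact_integrable; first exact: segment_compact.
apply: continuous_in_subspaceT => t; rewrite inE => /itvccP; exact: cf.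
Qed.

Lemma integrable_Re a b f : cont_itv a b f ->
  mu.-integrable `[a, b] (EFin \o (Re \o f)).
Proof.
move=> cf; apply: integrable_real => t /cf ft.
apply: continuous_comp => //; exact: Re_continuous.
Qed.

Lemma integrable_Im a b f : cont_itv a b f ->
  mu.-integrable `[a, b] (EFin \o (Im \o f)).
Proof.
move=> cf; apply: integrable_real => t /cf ft.
apply: continuous_comp => //; exact: Im_continuous.
Qed.

Lemma fine_itv a b : a <= b -> fine (mu `[a, b]) = b - a.
Proof.
rewrite lebesgue_measure_itv/= lte_fin le_eqVlt => /predU1P[->|->//].
by rewrite ltxx subrr.
Qed.

Lemma eq_cint a b f g : (forall t, a <= t <= b -> f t = g t) ->
  cint a b f = cint a b g.
Proof.
move=> fg; rewrite /cint; congr Complex; apply: eq_Rintegral => t;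
  by rewrite inE => /itvccP/fg ->.
Qed.

Lemma cintD a b f g : cont_itv a b f -> cont_itv a b g ->
  cint a b (fun t => f t + g t) = cint a b f + cint a b g.
Proof.
move=> cf cg; rewrite /cint.
transitivity (Complex
   (\int[mu]_(t in `[a, b]) (Re (f t) + Re (g t)))
   (\int[mu]_(t in `[a, b]) (Im (f t) + Im (g t)))).
  by congr Complex; apply: eq_Rintegral => t _; case: (f t) (g t) => ? ? [].
by rewrite !RintegralD//; [exact: integrable_Im|exact: integrable_Im|
  exact: integrable_Re|exact: integrable_Re].
Qed.

Lemma cintZ a b f c : cont_itv a b f ->
  cint a b (fun t => c * f t) = c * cint a b f.
Proof.
move=> cf; rewrite /cint; case: c => x y.
have iR := integrable_Re cf; have iI := integrable_Im cf.
have iZ (r : R) (h : R -> R) : mu.-integrable `[a, b] (EFin \o h) ->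
    mu.-integrable `[a, b] (EFin \o (fun t => r * h t)).
  move=> ih; rewrite (_ : _ \o _ = (fun t => r%:E * (EFin \o h) t)%E)//.
    exact: integrableZl.
transitivity (Complex
   (\int[mu]_(t in `[a, b]) (x * Re (f t) - y * Im (f t)))
   (\int[mu]_(t in `[a, b]) (x * Im (f t) + y * Re (f t)))).
  by congr Complex; apply: eq_Rintegral => t _; case: (f t).
rewrite RintegralB//; [|exact: iZ|exact: iZ].
rewrite RintegralD//; [|exact: iZ|exact: iZ].
by rewrite !RintegralZl.
Qed.

Lemma cintN a b f : cont_itv a b f ->
  cint a b (fun t => - f t) = - cint a b f.
Proof.
move=> cf; rewrite -[RHS]mulN1r -(cintZ (-1) cf).
by apply: eq_cint => t _; rewrite mulN1r.
Qed.

Lemma cont_itvN a b f : cont_itv a b f -> cont_itv a b (fun t => - f t).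
Proof.
move=> cf t /cf gt; apply/(cvgCP (nbhs_filter t)) => e e0.
have /(cvgCP (nbhs_filter t))/(_ _ e0) := gt.
by apply: filterS => s; rewrite -opprD ncN.
Qed.

Lemma cintB a b f g : cont_itv a b f -> cont_itv a b g ->
  cint a b (fun t => f t - g t) = cint a b f - cint a b g.
Proof. by move=> cf cg; rewrite (cintD cf (cont_itvN cg)) cintN. Qed.

Lemma cint_split a m b f : a <= m <= b -> cont_itv a b f ->
  cint a b f = cint a m f + cint m b f.
Proof.
move=> /andP[am mb] cf.
have S (h : R -> R) : mu.-integrable `[a, b] (EFin \o h) ->
   \int[mu]_(t in `[a, b]) h t =
   \int[mu]_(t in `[a, m]) h t + \int[mu]_(t in `[m, b]) h t.
  move=> ih; apply/esym/eqP; rewrite eq_sym addrC -subr_eq; apply/eqP.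
  rewrite Rintegral_itvB//; first by rewrite Rintegral_itv_obnd_cbnd//;
    apply: integrableS ih => //; apply: subset_itv; rewrite ?bnd_simp.
rewrite /cint (S _ (integrable_Re cf)) (S _ (integrable_Im cf)).
by [].
Qed.

(** The factor 2 comes from bounding the real and the imaginary part separately; no sharp constant
    is needed later. *)
Lemma cint_nc_le a b f (M : R) : a <= b -> cont_itv a b f ->
  (forall t, a <= t <= b -> nc (f t) <= M) -> nc (cint a b f) <= 2 * M * (b - a).
Proof.
move=> ab cf fM; apply: (le_trans (nc_le_ReIm _)) => /=.
have L (h : R -> R) : mu.-integrable `[a, b] (EFin \o h) ->
   (forall t, a <= t <= b -> `|h t| <= M) ->
   `|\int[mu]_(t in `[a, b]) h t| <= M * (b - a).
  move=> ih hM; apply: (le_trans (le_normr_Rintegral _ ih)) => //.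
  have -> : M * (b - a) = \int[mu]_(t in `[a, b]) M.
    by rewrite Rintegral_cst//= fine_itv.
  apply: le_Rintegral => //.
  - by apply: integrable_norm ih.
  - by apply: integrable_real => t _; exact: cvg_cst.
have -> : 2 * M * (b - a) = M * (b - a) + M * (b - a) by ring.
apply: lerD; apply: L.
- exact: integrable_Re.
- by move=> t /fM; apply: le_trans; exact: Re_le_nc.
- exact: integrable_Im.
- by move=> t /fM; apply: le_trans; exact: Im_le_nc.
Qed.

Lemma rint_FTC a b (f F : R -> R) : a < b ->
  (forall t : R, a <= t <= b -> {for t, continuous f}) ->
  (forall t : R, a <= t <= b -> is_derive t (1 : R) F (f t)) ->
  \int[mu]_(t in `[a, b]) f t = F b - F a.
Proof.
move=> ab cf dF; rewrite /Rintegral (@continuous_FTC2 _ _ F)//.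
- apply: continuous_in_subspaceT => t; rewrite inE => /itvccP; exact: cf.
- split.
  + move=> t /andP[/= at_ tb]; apply: ex_derive.
    by apply: dF; rewrite !ltW.
  + apply: cvg_at_right_filter; apply: differentiable_continuous.
    apply/derivable1_diffP; apply: ex_derive.
    by apply: dF; rewrite lexx ltW.
  + apply: cvg_at_left_filter; apply: differentiable_continuous.
    apply/derivable1_diffP; apply: ex_derive.
    by apply: dF; rewrite lexx ltW.
- move=> t; rewrite in_itv/= => /andP[at_ tb]; rewrite derive1E.
  by apply: derive_val; apply: dF; rewrite !ltW.
Qed.

Lemma cint_cst a b c : a <= b -> cint a b (fun=> c) = c * (b - a)%:C%C.
Proof.
move=> ab; rewrite /cint; case: c => x y /=.
rewrite !Rintegral_cst//= fine_itv//.
by rewrite /GRing.mul /=; congr Complex; rewrite mulr0 ?subr0 ?add0r.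
Qed.

Lemma cint_id a b : a <= b -> cint a b (fun t => t%:C%C) = ((b ^+ 2 - a ^+ 2) / 2)%:C%C.
Proof.
rewrite le_eqVlt => /predU1P[->|ab].
  by rewrite /cint !set_itv1 /= !Rintegral_set1 subrr mul0r.
rewrite /cint /=; congr Complex; last by rewrite Rintegral_cst// mul0r.
have ci t : a <= t <= b -> {for t, continuous (fun t : R => t)}.
  by move=> _; exact: cvg_id.
have di (t : R) : a <= t <= b -> is_derive t (1 : R) (fun t => t ^+ 2 / 2) t.
  move=> _; have E : (fun t : R => t ^+ 2 / 2) = 2^-1 \*: (@GRing.exp R ^~ 2%N).
    by apply/funext => s /=; rewrite mulrC.
  rewrite E; apply: is_derive_eq.
  rewrite /GRing.scale/=. lra.
by rewrite (rint_FTC ab ci di) -mulrBl.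
Qed.

End cint.

(** * Integrals over the boundary of a rectangle *)

Section goursat.
Context {R : realType}.
Implicit Types (x y w h t : R) (f g : Cplx R -> Cplx R) (z c D : Cplx R).
Local Notation Re := (@complex.Re R).
Local Notation Im := (@complex.Im R).

Definition rect x1 x2 y1 y2 : set (Cplx R) :=
  [set z | (x1 <= Re z <= x2) /\ (y1 <= Im z <= y2)].

Definition cont_on (S : set (Cplx R)) f := forall z, S z -> {for z, continuous f}.

(** The contour integral taken counterclockwise: [dz] is [dt] on the horizontal sides and [i dt] on
    the vertical ones, and the top and left sides are run backwards. *)
Definition rect_int f x1 x2 y1 y2 : Cplx R :=
  cint x1 x2 (fun t => f (Complex t y1)) - cint x1 x2 (fun t => f (Complex t y2)) +
  Complex 0 1 * (cint y1 y2 (fun t => f (Complex x2 t)) -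
                 cint y1 y2 (fun t => f (Complex x1 t))).

Lemma horiz_continuous y : continuous (fun t => Complex t y : Cplx R).
Proof.
move=> t; apply/(cvgCP (nbhs_filter t)) => e e0.
have : nbhs t [set s : R | `|t - s| < e].
  by apply/nbhs_ballP; exists e => // s; rewrite -ball_normE.
apply: filterS => s /=; rewrite distrC => st; apply: le_lt_trans st.
by rewrite subrr expr0n /= addr0 sqrtr_sqr.
Qed.

Lemma vert_continuous x : continuous (fun t => Complex x t : Cplx R).
Proof.
move=> t; apply/(cvgCP (nbhs_filter t)) => e e0.
have : nbhs t [set s : R | `|t - s| < e].
  by apply/nbhs_ballP; exists e => // s; rewrite -ball_normE.
apply: filterS => s /=; rewrite distrC => st; apply: le_lt_trans st.
by rewrite subrr expr0n /= add0r sqrtr_sqr.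
Qed.

Lemma cont_comp (p : R -> Cplx R) f (t : R) : {for t, continuous p} ->
  {for p t, continuous f} -> {for t, continuous (fun s => f (p s))}.
Proof. exact: continuous_comp. Qed.

Lemma cont_horiz f x1 x2 y1 y2 y : cont_on (rect x1 x2 y1 y2) f ->
  y1 <= y <= y2 -> cont_itv x1 x2 (fun t => f (Complex t y)).
Proof.
move=> cf hy t ht; apply: (@cont_comp (fun t => Complex t y)); first exact: horiz_continuous.
exact: cf.
Qed.

Lemma cont_vert f x1 x2 y1 y2 x : cont_on (rect x1 x2 y1 y2) f ->
  x1 <= x <= x2 -> cont_itv y1 y2 (fun t => f (Complex x t)).
Proof.
move=> cf hx t ht; apply: (@cont_comp (fun t => Complex x t)); first exact: vert_continuous.
exact: cf.
Qed.

(** Linearity and bounds of the contour integral ask for continuity here only, so that they apply to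
    the kernel [1 / (z - b)] with [b] inside the rectangle. *)
Definition rect_bd x1 x2 y1 y2 : set (Cplx R) := rect x1 x2 y1 y2 `&`
  [set z | [\/ Re z = x1, Re z = x2, Im z = y1 | Im z = y2]].

Lemma rect_bd_sub x1 x2 y1 y2 : rect_bd x1 x2 y1 y2 `<=` rect x1 x2 y1 y2.
Proof. exact: subIsetl. Qed.

Lemma cont_on_sub (A B : set (Cplx R)) f : A `<=` B -> cont_on B f -> cont_on A f.
Proof. by move=> AB h z /AB; exact: h. Qed.

Section boundary_paths.
Variables (f : Cplx R -> Cplx R) (x1 x2 y1 y2 : R).
Hypotheses (hx : x1 <= x2) (hy : y1 <= y2).

Lemma bd_bottom t : x1 <= t <= x2 -> rect_bd x1 x2 y1 y2 (Complex t y1).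
Proof. by move=> ht; split; [split=> //=; rewrite lexx|constructor 3]. Qed.

Lemma bd_top t : x1 <= t <= x2 -> rect_bd x1 x2 y1 y2 (Complex t y2).
Proof. by move=> ht; split; [split=> //=; rewrite lexx hy|constructor 4]. Qed.

Lemma bd_left t : y1 <= t <= y2 -> rect_bd x1 x2 y1 y2 (Complex x1 t).
Proof. by move=> ht; split; [split=> //=; rewrite lexx|constructor 1]. Qed.

Lemma bd_right t : y1 <= t <= y2 -> rect_bd x1 x2 y1 y2 (Complex x2 t).
Proof. by move=> ht; split; [split=> //=; rewrite lexx hx|constructor 2]. Qed.

Hypothesis cf : cont_on (rect_bd x1 x2 y1 y2) f.

Lemma cont_bottom : cont_itv x1 x2 (fun t => f (Complex t y1)).
Proof.
move=> t ht; apply: (@cont_comp (fun t => Complex t y1)); last exact/cf/bd_bottom.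
exact: horiz_continuous.
Qed.

Lemma cont_top : cont_itv x1 x2 (fun t => f (Complex t y2)).
Proof.
move=> t ht; apply: (@cont_comp (fun t => Complex t y2)); last exact/cf/bd_top.
exact: horiz_continuous.
Qed.

Lemma cont_left : cont_itv y1 y2 (fun t => f (Complex x1 t)).
Proof.
move=> t ht; apply: (@cont_comp (fun t => Complex x1 t)); last exact/cf/bd_left.
exact: vert_continuous.
Qed.

Lemma cont_right : cont_itv y1 y2 (fun t => f (Complex x2 t)).
Proof.
move=> t ht; apply: (@cont_comp (fun t => Complex x2 t)); last exact/cf/bd_right.
exact: vert_continuous.
Qed.

End boundary_paths.

Lemma eq_rect_int f g x1 x2 y1 y2 : x1 <= x2 -> y1 <= y2 ->
  (forall z, rect_bd x1 x2 y1 y2 z -> f z = g z) ->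
  rect_int f x1 x2 y1 y2 = rect_int g x1 x2 y1 y2.
Proof.
move=> hx hy fg; congr (_ - _ + _ * (_ - _)); apply: eq_cint => t ht; apply: fg.
- exact: bd_bottom.
- exact: bd_top.
- exact: bd_right.
- exact: bd_left.
Qed.

Lemma rect_intB f g x1 x2 y1 y2 : x1 <= x2 -> y1 <= y2 ->
  cont_on (rect_bd x1 x2 y1 y2) f -> cont_on (rect_bd x1 x2 y1 y2) g ->
  rect_int (fun z => f z - g z) x1 x2 y1 y2 =
  rect_int f x1 x2 y1 y2 - rect_int g x1 x2 y1 y2.
Proof.
move=> hx hy cf cg; rewrite /rect_int.
rewrite (cintB (cont_bottom hy cf) (cont_bottom hy cg)).
rewrite (cintB (cont_top hy cf) (cont_top hy cg)).
rewrite (cintB (cont_left hx cf) (cont_left hx cg)).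
rewrite (cintB (cont_right hx cf) (cont_right hx cg)).
ring.
Qed.

Lemma rect_intZ c f x1 x2 y1 y2 : x1 <= x2 -> y1 <= y2 ->
  cont_on (rect_bd x1 x2 y1 y2) f ->
  rect_int (fun z => c * f z) x1 x2 y1 y2 = c * rect_int f x1 x2 y1 y2.
Proof.
move=> hx hy cf; rewrite /rect_int.
rewrite (cintZ c (cont_bottom hy cf)) (cintZ c (cont_top hy cf)).
rewrite (cintZ c (cont_left hx cf)) (cintZ c (cont_right hx cf)).
ring.
Qed.

Lemma rect_int_vsplit f x1 x x2 y1 y2 : x1 <= x <= x2 -> y1 <= y2 ->
  cont_on (rect x1 x2 y1 y2) f ->
  rect_int f x1 x2 y1 y2 = rect_int f x1 x y1 y2 + rect_int f x x2 y1 y2.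
Proof.
move=> hx hy cf; rewrite /rect_int.
rewrite !(cint_split hx); try by (apply: (cont_horiz cf); rewrite ?lexx ?hy).
ring.
Qed.

Lemma rect_int_hsplit f x1 x2 y1 y y2 : x1 <= x2 -> y1 <= y <= y2 ->
  cont_on (rect x1 x2 y1 y2) f ->
  rect_int f x1 x2 y1 y2 = rect_int f x1 x2 y1 y + rect_int f x1 x2 y y2.
Proof.
move=> hx hy cf; rewrite /rect_int.
rewrite !(cint_split hy); try by (apply: (cont_vert cf); rewrite ?lexx ?hx).
ring.
Qed.

Lemma nc_i : nc (Complex 0 1 : Cplx R) = 1.
Proof. by rewrite /Normc.normc /= expr0n add0r expr1n sqrtr1. Qed.

Lemma rect_int_nc_le f x1 x2 y1 y2 (M : R) : x1 <= x2 -> y1 <= y2 ->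
  cont_on (rect_bd x1 x2 y1 y2) f ->
  (forall z, rect_bd x1 x2 y1 y2 z -> nc (f z) <= M) ->
  nc (rect_int f x1 x2 y1 y2) <= 4 * M * (x2 - x1 + (y2 - y1)).
Proof.
move=> hx hy cf fM; rewrite /rect_int.
have h1 := cint_nc_le hx (cont_bottom hy cf) (fun t ht => fM _ (bd_bottom hy ht)).
have h2 := cint_nc_le hx (cont_top hy cf) (fun t ht => fM _ (bd_top hy ht)).
have v1 := cint_nc_le hy (cont_left hx cf) (fun t ht => fM _ (bd_left hx ht)).
have v2 := cint_nc_le hy (cont_right hx cf) (fun t ht => fM _ (bd_right hx ht)).
rewrite (le_trans (ncD _ _))// ncM nc_i mul1r.
rewrite (le_trans (lerD (ncD _ _) (ncD _ _)))// !ncN.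
lra.
Qed.

Lemma affine_continuous c D : continuous (fun z => c + z * D : Cplx R).
Proof.
move=> a; apply: derivable_continuousC; apply/derivableCP; exists D => e e0.
exists 1 => // k _; rewrite (_ : _ - _ - _ = 0) ?nc0 ?mulr_ge0 ?nc_ge0 ?ltW//.
by ring.
Qed.

Lemma scale_continuous D : continuous (fun z => D * z : Cplx R).
Proof.
move=> a; apply: derivable_continuousC; apply/derivableCP; exists D => e e0.
exists 1 => // k _; rewrite (_ : _ - _ - _ = 0) ?nc0 ?mulr_ge0 ?nc_ge0 ?ltW//.
by ring.
Qed.

(** Direct computation on the four sides. It removes the first-order part of a function in Goursat's
    argument. *)
Lemma rect_int_affine c D x1 x2 y1 y2 : x1 <= x2 -> y1 <= y2 ->
  rect_int (fun z => c + z * D) x1 x2 y1 y2 = 0.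
Proof.
move=> hx hy.
have rc : continuous (fun t : R => t%:C%C : Cplx R) by exact: horiz_continuous.
have cc d : cint x1 x2 (fun t => d + D * t%:C%C) =
    d * (x2 - x1)%:C%C + D * ((x2 ^+ 2 - x1 ^+ 2) / 2)%:C%C.
  rewrite cintD ?cintZ ?cint_cst ?cint_id//.
  - by move=> t _; exact: rc.
  - by move=> t _; exact: cvg_cst.
  - move=> t _; apply: (@cont_comp (fun t => t%:C%C) (fun z => D * z)) ;
      [exact: rc|exact: scale_continuous].
have dd d : cint y1 y2 (fun t => d + D * Complex 0 1 * t%:C%C) =
    d * (y2 - y1)%:C%C + D * Complex 0 1 * ((y2 ^+ 2 - y1 ^+ 2) / 2)%:C%C.
  rewrite cintD ?cintZ ?cint_cst ?cint_id//.
  - by move=> t _; exact: rc.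
  - by move=> t _; exact: cvg_cst.
  - move=> t _.
    apply: (@cont_comp (fun t => t%:C%C) (fun z => D * Complex 0 1 * z)) ;
      [exact: rc|exact: scale_continuous].
have E (a b : R) : Complex a b = a%:C%C + Complex 0 1 * b%:C%C :> Cplx R.
  by rewrite [LHS]complexE.
have H y : cint x1 x2 (fun t => c + Complex t y * D) =
    cint x1 x2 (fun t => (c + Complex 0 1 * y%:C%C * D) + D * t%:C%C).
  by apply: eq_cint => t _; rewrite E; ring.
have V x : cint y1 y2 (fun t => c + Complex x t * D) =
    cint y1 y2 (fun t => (c + x%:C%C * D) + D * Complex 0 1 * t%:C%C).
  by apply: eq_cint => t _; rewrite E; ring.
rewrite /rect_int !H !V !cc !dd.
have ii : Complex 0 1 * Complex 0 1 = -1 :> Cplx R.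
  by rewrite -expr2; exact: sqr_i.
rewrite !rmorphB /=; ring: ii.
Qed.

End goursat.

(** * Goursat's theorem and Cauchy's formula *)

Section cauchy.
Context {R : realType}.
Implicit Types (x y w h t : R) (f g : Cplx R -> Cplx R) (z b c D : Cplx R).
Local Notation Re := (@complex.Re R).
Local Notation Im := (@complex.Im R).

Lemma nested_point (u v : nat -> R) : (forall n, u n <= u n.+1) ->
  (forall n, v n.+1 <= v n) -> (forall n, u n <= v n) ->
  exists X, forall n, u n <= X <= v n.
Proof.
move=> hu hv huv.
have uh m n : (m <= n)%N -> u m <= u n.
  by move=> /subnK <-; elim: (n - m)%N => // k ih; rewrite addSn (le_trans ih).
have vh m n : (m <= n)%N -> v n <= v m.
  by move=> /subnK <-; elim: (n - m)%N => // k ih; rewrite addSn (le_trans _ ih).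
have uv m n : u m <= v n.
  rewrite (le_trans (uh m (maxn m n) _)) ?leq_maxl//.
  by rewrite (le_trans (huv _))// vh// leq_maxr.
have ub n : ubound (range u) (v n) by move=> _ [m _ <-].
exists (sup (range u)) => n; apply/andP; split.
  by apply: ub_le_sup; [exists (v 0%N)|exists n].
by apply: ge_sup => //; exists (u 0%N); exists 0%N.
Qed.

Lemma rect_subset x1 x2 y1 y2 x1' x2' y1' y2' :
  x1 <= x1' -> x2' <= x2 -> y1 <= y1' -> y2' <= y2 ->
  rect x1' x2' y1' y2' `<=` rect x1 x2 y1 y2.
Proof.
move=> a b c d z [/andP[e f] /andP[g h]]; split; apply/andP; split; lra.
Qed.

(** The pigeonhole principle, isolated so that [lra] meets variables instead of contour
    integrals. *)
Lemma quarter_absurd (q a b c d : R) : q <= (a + b) + (c + d) ->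
  4 * d < q -> 4 * c < q -> 4 * b < q -> 4 * a < q -> False.
Proof. lra. Qed.

(** The integrals over the four quarters add up to the whole, so one of them carries at least a
    quarter of the modulus. *)
Lemma quarter_step f x y w h : 0 <= w -> 0 <= h ->
  cont_on (rect x (x + w) y (y + h)) f ->
  exists x' y', [/\ x <= x' <= x + w / 2, y <= y' <= y + h / 2 &
    nc (rect_int f x (x + w) y (y + h)) <=
    4 * nc (rect_int f x' (x' + w / 2) y' (y' + h / 2))].
Proof.
move=> w0 h0 cf.
have hs1 : x <= x + w / 2 <= x + w by apply/andP; split; lra.
have hs2 : y <= y + h / 2 <= y + h by apply/andP; split; lra.
have E : rect_int f x (x + w) y (y + h) =
  (rect_int f x (x + w / 2) y (y + h / 2) +
   rect_int f x (x + w / 2) (y + h / 2) (y + h / 2 + h / 2)) +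
  (rect_int f (x + w / 2) (x + w / 2 + w / 2) y (y + h / 2) +
   rect_int f (x + w / 2) (x + w / 2 + w / 2) (y + h / 2) (y + h / 2 + h / 2)).
  have -> : x + w / 2 + w / 2 = x + w by field.
  have -> : y + h / 2 + h / 2 = y + h by field.
  rewrite (rect_int_vsplit hs1 _ cf); last by rewrite lerDl.
  rewrite (@rect_int_hsplit _ f x _ y (y + h / 2))//; last 2 first.
  - by case/andP: hs1.
  - by apply: cont_on_sub cf; apply: rect_subset; lra.
  rewrite (@rect_int_hsplit _ f (x + w / 2) _ y (y + h / 2))//.
  - by case/andP: hs1.
  - by apply: cont_on_sub cf; apply: rect_subset; lra.
apply: contrapT => H.
have {}H x' y' : x <= x' <= x + w / 2 -> y <= y' <= y + h / 2 ->
    4 * nc (rect_int f x' (x' + w / 2) y' (y' + h / 2)) <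
    nc (rect_int f x (x + w) y (y + h)).
  by move=> hx' hy'; rewrite ltNge; apply/negP => L; apply: H; exists x', y'.
have xa : x <= x <= x + w / 2 by apply/andP; split; lra.
have xb : x <= x + w / 2 <= x + w / 2 by apply/andP; split; lra.
have ya : y <= y <= y + h / 2 by apply/andP; split; lra.
have yb : y <= y + h / 2 <= y + h / 2 by apply/andP; split; lra.
have := H _ _ xa ya; have := H _ _ xa yb.
have := H _ _ xb ya; have := H _ _ xb yb.
have : nc (rect_int f x (x + w) y (y + h)) <=
  (nc (rect_int f x (x + w / 2) y (y + h / 2)) +
   nc (rect_int f x (x + w / 2) (y + h / 2) (y + h / 2 + h / 2))) +
  (nc (rect_int f (x + w / 2) (x + w / 2 + w / 2) y (y + h / 2)) +
   nc (rect_int f (x + w / 2) (x + w / 2 + w / 2) (y + h / 2) (y + h / 2 + h / 2))).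
  by rewrite E (le_trans (ncD _ _))// lerD// ncD.
exact: quarter_absurd.
Qed.

Lemma nc_rectB x1 x2 y1 y2 z c : rect x1 x2 y1 y2 z -> rect x1 x2 y1 y2 c ->
  nc (z - c) <= (x2 - x1) + (y2 - y1).
Proof.
move=> hz hc; apply: (le_trans (nc_le_ReIm _)).
case: z c hz hc => a b [c d] [/= /andP[? ?] /andP[? ?]] [/= /andP[? ?] /andP[? ?]].
by apply: lerD; rewrite ler_norml; apply/andP; split; lra.
Qed.

Lemma derivable_cont_on (S : set (Cplx R)) f :
  (forall z, S z -> derivable f z 1) -> cont_on S f.
Proof. by move=> df z /df; exact: derivable_continuousC. Qed.

Lemma contB_affine S f c D : cont_on S f -> cont_on S (fun z => f z - (c + z * D)).
Proof.
move=> cf z /cf fz.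
exact: (@cvgBC _ _ (nbhs z) (nbhs_filter z) f (fun u : Cplx R => c + u * D) (f z)
  (c + z * D) fz (@affine_continuous _ c D z)).
Qed.

(** Repeated quartering closes in on a point [P]. Near [P] the function is affine up to
    [e * |z - P|], and both the diameter and the perimeter of the n-th rectangle shrink like
    [2 ^- n], which compensates the factor [4 ^ n] lost. *)
Lemma goursat f x1 x2 y1 y2 : x1 <= x2 -> y1 <= y2 ->
  (forall z, rect x1 x2 y1 y2 z -> derivable f z 1) ->
  rect_int f x1 x2 y1 y2 = 0.
Proof.
move=> hx hy df; have cf := derivable_cont_on df.
pose w := x2 - x1; pose h := y2 - y1.
have w0 : 0 <= w by rewrite subr_ge0.
have h0 : 0 <= h by rewrite subr_ge0.
pose W n := w / 2 ^+ n; pose H n := h / 2 ^+ n.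
have W0 n : 0 <= W n by rewrite divr_ge0// exprn_ge0.
have H0 n : 0 <= H n by rewrite divr_ge0// exprn_ge0.
have WS n : W n / 2 = W n.+1 by rewrite /W exprS invfM mulrA mulrAC.
have HS n : H n / 2 = H n.+1 by rewrite /H exprS invfM mulrA mulrAC.
pose good n (p : R * R) := [/\ x1 <= p.1, p.1 + W n <= x2, y1 <= p.2 & p.2 + H n <= y2].
pose Q n (p : R * R) := nc (rect_int f p.1 (p.1 + W n) p.2 (p.2 + H n)).
(* The guard [good] sits under the existential so that [choice] yields a total function. *)
have step (np : nat * (R * R)) : exists p' : R * R, good np.1 np.2 ->
  [/\ np.2.1 <= p'.1 <= np.2.1 + W np.1.+1,
      np.2.2 <= p'.2 <= np.2.2 + H np.1.+1 & Q np.1 np.2 <= 4 * Q np.1.+1 p'].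
  case: np => n p /=; have [[g1 g2 g3 g4]|nG] := pselect (good n p); last first.
    by exists p.
  have [] := @quarter_step f p.1 p.2 (W n) (H n) (W0 n) (H0 n).
    by apply: cont_on_sub cf; exact: rect_subset.
  by rewrite WS HS => x' [y' ?]; exists (x', y').
have [F hF] := choice step.
pose c := fix c n := if n is m.+1 then F (m, c m) else (x1, y1).
have cS n : c n.+1 = F (n, c n) by [].
have gc n : good n (c n).
  elim: n => [|n ih].
    by rewrite /good /W /H /= expr0 !divr1 /w /h; split; lra.
  have [/= /andP[a1 a2] /andP[b1 b2] _] := hF (n, c n) ih.
  have [d1 d2 d3 d4] := ih; have := WS n; have := HS n.
  rewrite -cS in a1 a2 b1 b2 *; split; lra.
have cstep n := hF (n, c n) (gc n).
have Qc n : Q 0%N (c 0%N) <= 4 ^+ n * Q n (c n).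
  elim: n => [|n ih]; first by rewrite mul1r.
  rewrite (le_trans ih)// exprSr -mulrA ler_wpM2l ?exprn_ge0//.
  by have [] := cstep n.
have [X hX] : exists X, forall n, (c n).1 <= X <= (c n).1 + W n.
  apply: nested_point => n; last by rewrite lerDl.
    by have [/= /andP[]] := cstep n.
  have [/= /andP[_ a] _ _] := cstep n; have := WS n; lra.
have [Y hY] : exists Y, forall n, (c n).2 <= Y <= (c n).2 + H n.
  apply: nested_point => n; last by rewrite lerDl.
    by have [/= _ /andP[]] := cstep n.
  have [/= _ /andP[_ a] _] := cstep n; have := HS n; lra.
pose P : Cplx R := Complex X Y.
have PR n : rect (c n).1 ((c n).1 + W n) (c n).2 ((c n).2 + H n) P.
  by split => /=.
have subR n : rect (c n).1 ((c n).1 + W n) (c n).2 ((c n).2 + H n)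
    `<=` rect x1 x2 y1 y2 by have [? ? ? ?] := gc n; exact: rect_subset.
have /derivableCP[D hD] := df P (subR 0%N _ (PR 0%N)).
(* The n-th integral is at most [4 * (e * (W n + H n)) * (W n + H n)], that is [4 ^- n] times the
   right-hand side, so the bound no longer depends on [n]. *)
have key e : 0 < e -> Q 0%N (c 0%N) <= 4 * e * (w + h) ^+ 2.
  move=> e0; have [d d0 hd] := hD _ e0.
  have [n nd] : exists n, W n + H n < d.
    have [m hm] : exists m : nat, (w + h) / d < m%:R.
      exists (Num.bound ((w + h) / d)); apply: archi_boundP.
      by apply: divr_ge0; [exact: addr_ge0|exact: ltW].
    exists m; rewrite -mulrDl ltr_pdivrMr ?exprn_gt0// mulrC -ltr_pdivrMr//.
    by rewrite (lt_trans hm)// -natrX ltr_nat ltn_expl.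
  rewrite (le_trans (Qc n))//.
  have -> : 4 * e * (w + h) ^+ 2 = 4 ^+ n * (4 * (e * (W n + H n)) * (W n + H n)).
    have -> : (4 : R) ^+ n = 2 ^+ n * 2 ^+ n by rewrite -exprMn -natrM.
    rewrite /W /H; field; exact: expf_neq0.
  rewrite ler_wpM2l ?exprn_ge0//.
  have hcx : (c n).1 <= (c n).1 + W n by rewrite lerDl.
  have hcy : (c n).2 <= (c n).2 + H n by rewrite lerDl.
  have cfn : cont_on (rect_bd (c n).1 ((c n).1 + W n) (c n).2 ((c n).2 + H n)) f.
    by apply: cont_on_sub cf => z /rect_bd_sub; exact: subR.
  have cA c' D' : cont_on (rect_bd (c n).1 ((c n).1 + W n) (c n).2 ((c n).2 + H n))
     (fun z => c' + z * D') by move=> z _; exact: affine_continuous.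
  (* Subtracting the affine approximation of [f] at [P] does not change the integral. *)
  have := @rect_int_nc_le _ (fun z => f z - ((f P - P * D) + z * D)) _ _ _ _
     (e * (W n + H n)) hcx hcy (contB_affine cfn).
  rewrite (rect_intB hcx hcy cfn (cA _ _)) (rect_int_affine _ _ hcx hcy) subr0.
  rewrite !(addrAC _ _ (- (c n).1)) !(addrAC _ _ (- (c n).2)) !subrr !add0r.
  apply => z /rect_bd_sub rz.
  have zP : nc (z - P) <= W n + H n.
    have := nc_rectB rz (PR n); move: (nc _) => q; lra.
  have := hd _ (le_lt_trans zP nd).
  rewrite (addrC P) subrK => hz.
  have -> : f z - (f P - P * D + z * D) = f z - f P - (z - P) * D by ring.
  by rewrite (le_trans hz)// ler_pM2l.
have : Q 0%N (c 0%N) <= 0.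
  apply/ler_addgt0Pl => e e0; rewrite addr0.
  (* The added 1 keeps the divisor positive when the rectangle is a point. *)
  have s0 : 0 < 4 * (w + h) ^+ 2 + 1 by rewrite ltr_wpDl// mulr_ge0// sqr_ge0.
  rewrite (le_trans (key _ (divr_gt0 e0 s0)))//.
  have -> : 4 * (e / (4 * (w + h) ^+ 2 + 1)) * (w + h) ^+ 2 =
    e * (4 * (w + h) ^+ 2) / (4 * (w + h) ^+ 2 + 1) by ring.
  by rewrite ler_pdivrMr// ler_pM2l// lerDl.
rewrite /Q /= /W /H expr0 !divr1 /w /h (addrC x1) (addrC y1) !subrK => Q0.
by apply/eqP; rewrite -nc_eq0 eq_le Q0 nc_ge0.
Qed.

End cauchy.

(** * Punctured rectangles and Cauchy's formula *)

Section cauchy_formula.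
Context {R : realType}.
Implicit Types (x y s t : R) (f g : Cplx R -> Cplx R) (z b c u h D : Cplx R).
Local Notation Re := (@complex.Re R).
Local Notation Im := (@complex.Im R).
Local Notation mu := (@lebesgue_measure R).

(** The part between the two rectangles is cut into four strips, on each of which Goursat's theorem
    applies. Continuity on the whole rectangle justifies the cuts. *)
Lemma rect_int_shrink f (x1 a1 a2 x2 y1 b1 b2 y2 : R) :
  x1 <= a1 -> a1 <= a2 -> a2 <= x2 -> y1 <= b1 -> b1 <= b2 -> b2 <= y2 ->
  cont_on (rect x1 x2 y1 y2) f ->
  (forall z, rect x1 x2 y1 y2 z ->
    derivable f z 1 \/ (a1 < Re z < a2 /\ b1 < Im z < b2)) ->
  rect_int f x1 x2 y1 y2 = rect_int f a1 a2 b1 b2.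
Proof.
move=> h1 h2 h3 h4 h5 h6 cf df.
have a1x := le_trans h2 h3; have b1y := le_trans h5 h6.
have xa2 := le_trans h1 h2; have yy := le_trans h4 b1y.
have strip (u1 u2 v1 v2 : R) : u1 <= u2 -> v1 <= v2 ->
    rect u1 u2 v1 v2 `<=` rect x1 x2 y1 y2 ->
    (forall z, rect u1 u2 v1 v2 z -> ~ (a1 < Re z < a2 /\ b1 < Im z < b2)) ->
    rect_int f u1 u2 v1 v2 = 0.
  move=> hu hv sub out; apply: goursat => // z rz.
  by case: (df z (sub z rz)) => // /(out z rz).
have E1 : rect_int f x1 a1 y1 y2 = 0.
  apply: strip => //; first exact: rect_subset.
  by move=> z [/andP[_ z1] _] [/andP[/lt_geF]]; rewrite z1.
have E2 : rect_int f a2 x2 y1 y2 = 0.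
  apply: strip => //; first exact: rect_subset.
  by move=> z [/andP[z1 _] _] [/andP[_ /lt_geF]]; rewrite z1.
have E3 : rect_int f a1 a2 y1 b1 = 0.
  apply: strip => //; first exact: rect_subset.
  by move=> z [_ /andP[_ z1]] [_ /andP[/lt_geF]]; rewrite z1.
have E4 : rect_int f a1 a2 b2 y2 = 0.
  apply: strip => //; first by apply: rect_subset => //; exact: le_trans h5.
  by move=> z [_ /andP[z1 _]] [_ /andP[_ /lt_geF]]; rewrite z1.
rewrite (@rect_int_vsplit _ f x1 a1 x2) ?h1//= E1 add0r.
rewrite (@rect_int_vsplit _ f a1 a2 x2) ?h2//=; last first.
  by apply: cont_on_sub cf; exact: rect_subset.
rewrite E2 addr0 (@rect_int_hsplit _ f a1 a2 y1 b1) ?h4//=; last first.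
  by apply: cont_on_sub cf; exact: rect_subset.
rewrite E3 add0r (@rect_int_hsplit _ f a1 a2 b1 b2) ?h5//=; last first.
  by apply: cont_on_sub cf; exact: rect_subset.
by rewrite E4 addr0.
Qed.

(** The contour shrinks to a square around [b], where continuity bounds [f] while the perimeter
    tends to 0. *)
Lemma goursat_punctured f b x1 x2 y1 y2 : x1 < Re b < x2 -> y1 < Im b < y2 ->
  cont_on (rect x1 x2 y1 y2) f ->
  (forall z, rect x1 x2 y1 y2 z -> z != b -> derivable f z 1) ->
  rect_int f x1 x2 y1 y2 = 0.
Proof.
move=> /andP[b1 b2] /andP[b3 b4] cf df.
have rb : rect x1 x2 y1 y2 b by split; apply/andP; split; exact: ltW.
have [d d0 hd] := (continuousCP f b).1 (cf b rb) 1 ltr01.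
pose M := nc (f b) + 1.
have fM z : nc (z - b) < d -> nc (f z) <= M.
  move=> /hd/ltW h1; rewrite -lerBlDl (le_trans _ h1)//; exact: ncB_ge.
have M0 : 0 < 16 * M by rewrite mulr_gt0// ltr_wpDl ?nc_ge0.
have shrink s : 0 < s -> x1 <= Re b - s -> Re b + s <= x2 -> y1 <= Im b - s ->
    Im b + s <= y2 -> 4 * s < d -> nc (rect_int f x1 x2 y1 y2) <= 16 * M * s.
  move=> s0 s1 s2 s3 s4 sd.
  have sl (c : R) : c - s <= c + s by rewrite lerD2l ge0_cp// ltW.
  have ins (c : R) : c - s < c < c + s by rewrite gtrBl ltrDl s0.
  have [bx by_] := (ins (Re b), ins (Im b)).
  rewrite (rect_int_shrink s1 (sl _) s2 s3 (sl _) s4 cf); last first.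
    move=> z rz; have [->|zb] := eqVneq z b; first by right.
    by left; exact: df.
  have sub := rect_subset s1 s2 s3 s4.
  have -> : 16 * M * s =
      4 * M * ((Re b + s) - (Re b - s) + ((Im b + s) - (Im b - s))) by ring.
  apply: rect_int_nc_le => //.
    by apply: cont_on_sub cf => z /rect_bd_sub/sub.
  move=> z /rect_bd_sub rz; apply: fM; apply: le_lt_trans sd.
  have bs : rect (Re b - s) (Re b + s) (Im b - s) (Im b + s) b.
    by case/andP: bx => ? ?; case/andP: by_ => ? ?; split; apply/andP; split; exact: ltW.
  apply: le_trans (nc_rectB rz bs) _.
  by rewrite le_eqVlt; apply/orP; left; apply/eqP; ring.
apply/eqP; rewrite -nc_eq0 eq_le nc_ge0 andbT.
apply/ler_addgt0Pl => e e0; rewrite addr0.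
(* Half the side of the square: the first four entries keep it inside the rectangle, [d / 5] keeps
   it where [f] is bounded by [M], and the last makes the integral at most [e]. *)
pose s := Num.min (Num.min (Num.min (Re b - x1) (x2 - Re b))
  (Num.min (Im b - y1) (y2 - Im b))) (Num.min (d / 5) (e / (16 * M))).
have s0 : 0 < s.
  by rewrite !lt_min !subr_gt0 b1 b2 b3 b4 (divr_gt0 d0 (ltr0n _ 5)) (divr_gt0 e0 M0).
have [[s1 s2] [s3 s4] [s5 s6]] : [/\ s <= Re b - x1 /\ s <= x2 - Re b,
    s <= Im b - y1 /\ s <= y2 - Im b & s <= d / 5 /\ s <= e / (16 * M)].
  by rewrite /s !ge_min !lexx !orbT.
apply: le_trans (shrink s s0 _ _ _ _ _) _.
- by rewrite lerBrDr addrC -lerBrDr.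
- by rewrite addrC -lerBrDr.
- by rewrite lerBrDr addrC -lerBrDr.
- by rewrite addrC -lerBrDr.
- by move: d0 s5; clear; lra.
- by rewrite mulrC -ler_pdivlMr.
Qed.

Lemma derivable_subC b z : derivable (fun v : Cplx R => v - b) z 1.
Proof.
apply/derivableCP; exists 1 => e e0; exists 1 => // k _.
rewrite (_ : _ - _ - _ = 0) ?nc0 ?mulr_ge0 ?nc_ge0 ?ltW//.
by ring.
Qed.

Lemma derivable_inv_sub b z : z != b -> derivable (fun v : Cplx R => (v - b)^-1) z 1.
Proof.
move=> zb; apply: (@derivableV _ _ (fun v : Cplx R => v - b) z 1).
  by rewrite subr_eq0.
exact: derivable_subC.
Qed.

Lemma derivable_mulC f g z : derivable f z 1 -> derivable g z 1 ->
  derivable (fun v => f v * g v) z 1.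
Proof. exact: derivableM. Qed.

Lemma derivable_addC f g z : derivable f z 1 -> derivable g z 1 ->
  derivable (fun v => f v + g v) z 1.
Proof. exact: derivableD. Qed.

Lemma derivable_cstC c z : derivable (fun=> c : Cplx R) z 1.
Proof. exact: derivable_cst. Qed.

Definition rect_index b x1 x2 y1 y2 := rect_int (fun z => (z - b)^-1) x1 x2 y1 y2.

Lemma bd_neq b x1 x2 y1 y2 z : x1 < Re b < x2 -> y1 < Im b < y2 ->
  rect_bd x1 x2 y1 y2 z -> z != b.
Proof.
move=> /andP[b1 b2] /andP[b3 b4] [_ bd]; apply/eqP => zb.
by case: bd => h; move: b1 b2 b3 b4; rewrite -zb h ltxx.
Qed.

(** The difference quotient of [f] at [b], completed by the derivative, is continuous on the
    rectangle and differentiable off [b], hence has integral 0. *)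
Lemma cauchy_formula f b x1 x2 y1 y2 : x1 < Re b < x2 -> y1 < Im b < y2 ->
  (forall z, rect x1 x2 y1 y2 z -> derivable f z 1) ->
  rect_int (fun z => f z * (z - b)^-1) x1 x2 y1 y2 = f b * rect_index b x1 x2 y1 y2.
Proof.
move=> hb1 hb2 df.
have hx : x1 <= x2 by case/andP: hb1 => ? ?; lra.
have hy : y1 <= y2 by case/andP: hb2 => ? ?; lra.
have rb : rect x1 x2 y1 y2 b.
  by case/andP: hb1 => ? ?; case/andP: hb2 => ? ?; split; apply/andP; split; lra.
have /derivableCP[D hD] := df b rb.
pose p z := if z == b then D else (f z - f b) * (z - b)^-1.
have pE z : z != b -> p z = f z * (z - b)^-1 - f b * (z - b)^-1.
  by move=> zb; rewrite /p (negbTE zb) mulrBl.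
have dbd z : z != b -> derivable (fun v : Cplx R => (v - b)^-1) z 1 by exact: derivable_inv_sub.
have dp z : rect x1 x2 y1 y2 z -> z != b -> derivable p z 1.
  move=> rz zb.
  have dq : derivable (fun v => (f v + - f b) * (v - b)^-1) z 1.
    apply: derivable_mulC; last exact: dbd.
    by apply: derivable_addC; [exact: df|exact: derivable_cstC].
  have [E hE] := (derivableCP _ _).1 dq; apply/derivableCP; exists E.
  apply: (@has_deriv_local _ _ _ z E (nc (z - b)) _ _ hE) => [|v vz].
    by rewrite nc_gt0 subr_eq0; exact: zb.
  rewrite /p ifF//; apply/eqP => vb; move: vz; rewrite vb ncB ltxx.
  by [].
have cp : cont_on (rect x1 x2 y1 y2) p.
  move=> z rz; have [->|zb] := eqVneq z b; last first.
    by apply: derivable_continuousC; exact: dp.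
  apply/continuousCP => e e0.
  have e2 : 0 < e / 2 by rewrite divr_gt0.
  have [d d0 hd] := hD _ e2; exists d => // v vb.
  rewrite {2}/p eqxx /p; case: eqVneq => [_|nvb]; first by rewrite subrr nc0.
  have := hd _ vb; rewrite (addrC b) subrK => hv.
  have vb0 : v - b != 0 by rewrite subr_eq0.
  have -> : (f v - f b) * (v - b)^-1 - D = (f v - f b - (v - b) * D) * (v - b)^-1.
    by rewrite [RHS]mulrBl (mulrC (v - b)) mulfK.
  rewrite ncM ncV ltr_pdivrMr ?nc_gt0// (le_lt_trans hv)// ltr_pM2r ?nc_gt0//.
  by rewrite ltr_pdivrMr// ltr_pMr// ltr1n.
have := goursat_punctured hb1 hb2 cp dp.
have cinv : cont_on (rect_bd x1 x2 y1 y2) (fun z => (z - b)^-1).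
  by move=> z /(bd_neq hb1 hb2)/dbd; exact: derivable_continuousC.
have cfi : cont_on (rect_bd x1 x2 y1 y2) (fun z => f z * (z - b)^-1).
  move=> z rz; apply: derivable_continuousC; apply: derivable_mulC.
    by apply: df; exact: rect_bd_sub rz.
  exact: dbd (bd_neq hb1 hb2 rz).
have cci : cont_on (rect_bd x1 x2 y1 y2) (fun z => f b * (z - b)^-1).
  move=> z rz; apply: derivable_continuousC; apply: derivable_mulC.
    exact: derivable_cstC.
  exact: dbd (bd_neq hb1 hb2 rz).
rewrite (@eq_rect_int _ p (fun z => f z * (z - b)^-1 - f b * (z - b)^-1)) //; last first.
  by move=> z rz; apply: pE; exact: (bd_neq hb1 hb2 rz).
rewrite (rect_intB hx hy cfi cci) (rect_intZ (f b) hx hy cinv).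
by move=> /eqP; rewrite subr_eq0 => /eqP.
Qed.

Lemma inv_subE x y b : (Complex x y - b : Cplx R)^-1 =
  Complex ((x - Re b) / ((x - Re b) ^+ 2 + (y - Im b) ^+ 2))
          ((Im b - y) / ((x - Re b) ^+ 2 + (y - Im b) ^+ 2)).
Proof. by case: b => p q; rewrite /GRing.inv /= -mulNr opprB. Qed.

Lemma four_sides (p q r s k : R) : k <= p -> 0 <= - q -> 0 <= r -> 0 <= - s ->
  0 < k -> 0 = (p - q) + (r - s) -> False.
Proof. lra. Qed.

(* The imaginary part is positive: every side of the rectangle contributes a
   nonnegative amount. *)
Lemma rect_index_neq0 b x1 x2 y1 y2 : x1 < Re b < x2 -> y1 < Im b < y2 ->
  rect_index b x1 x2 y1 y2 != 0.
Proof.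
move=> hb1 hb2; have /andP[b1 b2] := hb1; have /andP[b3 b4] := hb2.
have hx : x1 <= x2 by lra.
have hy : y1 <= y2 by lra.
have cinv : cont_on (rect_bd x1 x2 y1 y2) (fun z => (z - b)^-1).
  move=> z /(bd_neq hb1 hb2) zb; apply: derivable_continuousC.
  exact: derivable_inv_sub.
have ImE : Im (rect_index b x1 x2 y1 y2) =
   (\int[mu]_(t in `[x1, x2]) Im ((Complex t y1 - b : Cplx R)^-1) -
    \int[mu]_(t in `[x1, x2]) Im ((Complex t y2 - b : Cplx R)^-1)) +
   (\int[mu]_(t in `[y1, y2]) Re ((Complex x2 t - b : Cplx R)^-1) -
    \int[mu]_(t in `[y1, y2]) Re ((Complex x1 t - b : Cplx R)^-1)).
  by rewrite /rect_index /rect_int /cint /GRing.add /GRing.mul /= mul0r add0r mul1r.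
apply/eqP => i0; move: ImE; rewrite i0 /=.
(* A positive lower bound of the integrand on the bottom side, which makes the total strictly
   positive. *)
pose m := (Im b - y1) / ((x2 - x1) ^+ 2 + (Im b - y1) ^+ 2).
have m0 : 0 < m.
  rewrite divr_gt0 ?subr_gt0// ltr_wpDl ?sqr_ge0// exprn_gt0 ?subr_gt0//.
have bot : m * (x2 - x1) <= \int[mu]_(t in `[x1, x2]) Im ((Complex t y1 - b : Cplx R)^-1).
  rewrite -(fine_itv hx) -Rintegral_cst//; apply: le_Rintegral => //.
  - by apply: integrable_real => t _; exact: cvg_cst.
  - exact: integrable_Im (cont_bottom hy cinv).
  - move=> t /itvccP /andP[t1 t2]; rewrite inv_subE /= /m ler_pM2l ?subr_gt0//.
    have q0 : 0 < (y1 - Im b) ^+ 2 by rewrite -sqrrN opprB exprn_gt0// subr_gt0.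
    rewrite lef_pV2 ?posrE; last 2 first.
    + by rewrite ltr_wpDl ?sqr_ge0// exprn_gt0// subr_gt0.
    + by rewrite ltr_wpDl ?sqr_ge0.
    rewrite -[(y1 - Im b) ^+ 2]sqrrN opprB lerD2r.
    by rewrite -subr_ge0 subr_sqr mulr_ge0//; lra.
have top : 0 <= - \int[mu]_(t in `[x1, x2]) Im ((Complex t y2 - b : Cplx R)^-1).
  rewrite -mulN1r -RintegralZl//; last exact: integrable_Im (cont_top hy cinv).
  apply: Rintegral_ge0 => t _; rewrite inv_subE /= mulN1r -mulNr opprB.
  by apply: divr_ge0; [rewrite subr_ge0 ltW|rewrite addr_ge0 ?sqr_ge0].
have right : 0 <= \int[mu]_(t in `[y1, y2]) Re ((Complex x2 t - b : Cplx R)^-1).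
  apply: Rintegral_ge0 => t _; rewrite inv_subE /=.
  by apply: divr_ge0; [rewrite subr_ge0 ltW|rewrite addr_ge0 ?sqr_ge0].
have left : 0 <= - \int[mu]_(t in `[y1, y2]) Re ((Complex x1 t - b : Cplx R)^-1).
  rewrite -mulN1r -RintegralZl//; last exact: integrable_Re (cont_left hx cinv).
  apply: Rintegral_ge0 => t _; rewrite inv_subE /= mulN1r -mulNr opprB.
  by apply: divr_ge0; [rewrite subr_ge0 ltW|rewrite addr_ge0 ?sqr_ge0].
have mx : 0 < m * (x2 - x1) by rewrite mulr_gt0// subr_gt0 (lt_trans b1).
exact: (four_sides bot top right left mx).
Qed.

End cauchy_formula.

(** * Limits of holomorphic functions *)

Section limits_of_holomorphic.
Context {R : realType}.
Implicit Types (f g : Cplx R -> Cplx R) (z b c u h D : Cplx R) (S : set (Cplx R)).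
Local Notation Re := (@complex.Re R).
Local Notation Im := (@complex.Im R).

(* Contour integrals, seen as functionals on the functions continuous on the
   contour [S]: this covers both the boundary of a rectangle (for Cauchy's formula)
   and the segment [[0, 1]] (for the logarithm). *)
Record bounded_functional (L : (Cplx R -> Cplx R) -> Cplx R) S (Lam : R) : Prop :=
  BoundedFunctional {
    functionalB : forall f g, cont_on S f -> cont_on S g ->
      L (fun z => f z - g z) = L f - L g;
    functionalZ : forall c f, cont_on S f -> L (fun z => c * f z) = c * L f;
    functional_le : forall f (M : R), cont_on S f -> (forall z, S z -> nc (f z) <= M) ->
      nc (L f) <= Lam * M }.

Lemma rect_functional (x1 x2 y1 y2 : R) : x1 <= x2 -> y1 <= y2 ->
  bounded_functional (fun f => rect_int f x1 x2 y1 y2) (rect_bd x1 x2 y1 y2)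
    (4 * (x2 - x1 + (y2 - y1))).
Proof.
move=> hx hy; split=> [f g cf cg|c f cf|f M cf fM].
- exact: rect_intB.
- exact: rect_intZ.
- by rewrite mulrAC; exact: rect_int_nc_le.
Qed.

Definition unit_segment : set (Cplx R) := [set t%:C%C | t in `[0, 1]%classic].

Lemma unit_segment_functional :
  bounded_functional (fun f => cint 0 1 (fun t => f t%:C%C)) unit_segment 2.
Proof.
have co f : cont_on unit_segment f ->
    cont_itv 0 1 (fun t => f t%:C%C).
  move=> cf t ht; apply: (@cont_comp _ (fun t => t%:C%C)).
    exact: horiz_continuous.
  by apply: cf; exists t => //=; rewrite in_itv.
split=> [f g /co cf /co cg|c f /co cf|f M /co cf fM].
- exact: cintB.
- exact: cintZ.
- have := @cint_nc_le _ 0 1 (fun t => f t%:C%C) M ler01 cf.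
  rewrite subr0 mulr1; apply => t ht; apply: fM; exists t => //=.
Qed.

Lemma cauchy_kernel_expansion z u h : z - u != 0 -> z - (u + h) != 0 ->
  (z - (u + h))^-1 - (z - u)^-1 - h * ((z - u)^-1 * (z - u)^-1) =
  h * h * ((z - u)^-1 * (z - u)^-1 * (z - (u + h))^-1).
Proof. by move=> zu zuh; field; rewrite zu zuh. Qed.

(** The kernel is expanded to second order in [h]; its remainder is controlled by [|z - u| >= 2 * d]
    and [|z - (u + h)| >= d]. The constants depend on [Lam], [M] and [d] only, hence are common to
    all functions bounded by [M] on the contour. *)
Lemma cauchy_transform_quadratic L S Lam f (M d : R) u :
  bounded_functional L S Lam -> cont_on S f -> (forall z, S z -> nc (f z) <= M) ->
  0 < d -> (forall z, S z -> 2 * d <= nc (z - u)) ->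
  exists2 D, nc D <= Lam * (M / (4 * d ^+ 2)) & forall h, nc h <= d ->
    nc (L (fun z => f z * (z - (u + h))^-1) - L (fun z => f z * (z - u)^-1) - h * D)
      <= Lam * (M / (4 * d ^+ 3)) * nc h ^+ 2.
Proof.
move=> bL cf fM d0 hu.
have d20 : 0 < 2 * d by rewrite mulr_gt0.
have uh h z : nc h <= d -> S z -> d <= nc (z - (u + h)).
  move=> hd /hu zu; have := ncB_ge (z - u) h; rewrite opprD addrA; lra.
have neq h z : nc h <= d -> S z -> z != u + h.
  by move=> hd Sz; rewrite -subr_eq0 -nc_gt0 (lt_le_trans d0)//; exact: uh.
have ck h : nc h <= d -> cont_on S (fun z => f z * (z - (u + h))^-1).
  move=> hd z Sz.
  have c1 : {for z, continuous (fun v : Cplx R => (v - (u + h))^-1)}.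
    by apply: derivable_continuousC; apply: derivable_inv_sub; exact: neq.
  exact: (@continuousM _ _ f (fun v : Cplx R => (v - (u + h))^-1) z (cf z Sz) c1).
have nc00 : nc (0 : Cplx R) <= d by rewrite nc0 ltW.
have ck0 : cont_on S (fun z => f z * (z - u)^-1).
  by have := ck 0 nc00; rewrite addr0.
have ck2 : cont_on S (fun z => f z * (z - u)^-1 * (z - u)^-1).
  move=> z Sz.
  have c1 : {for z, continuous (fun v : Cplx R => (v - u)^-1)}.
    apply: derivable_continuousC; apply: derivable_inv_sub.
    by have := neq 0 z nc00 Sz; rewrite addr0.
  exact: (@continuousM _ _ (fun v => f v * (v - u)^-1) (fun v : Cplx R => (v - u)^-1)
    z (ck0 z Sz) c1).
have inv2d z : S z -> nc ((z - u)^-1) <= (2 * d)^-1.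
  move=> Sz; rewrite ncV lef_pV2 ?posrE ?hu// (lt_le_trans d20)//; exact: hu.
exists (L (fun z => f z * (z - u)^-1 * (z - u)^-1)).
  apply: (functional_le bL) => // z Sz; rewrite !ncM -mulrA.
  have -> : 4 * d ^+ 2 = (2 * d) * (2 * d) by ring.
  rewrite invfM; apply: ler_pM => //; rewrite ?mulr_ge0 ?nc_ge0//; first exact: fM.
  by apply: ler_pM; rewrite ?nc_ge0//; exact: inv2d.
move=> h hd.
have ckh : cont_on S (fun z => h * (f z * (z - u)^-1 * (z - u)^-1)).
  move=> z Sz.
  have c1 : {for z, continuous (fun v : Cplx R => h : Cplx R)}.
    by apply: derivable_continuousC; exact: derivable_cstC.
  exact: (@continuousM _ _ (fun v : Cplx R => h : Cplx R)
    (fun v : Cplx R => f v * (v - u)^-1 * (v - u)^-1) z c1 (ck2 z Sz)).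
have cd : cont_on S (fun z => f z * (z - (u + h))^-1 - f z * (z - u)^-1).
  move=> z Sz; exact: (@cvgBC _ _ (nbhs z) (nbhs_filter z) _ _ _ _ (ck h hd z Sz) (ck0 z Sz)).
have cdd : cont_on S (fun z => f z * (z - (u + h))^-1 - f z * (z - u)^-1 -
     h * (f z * (z - u)^-1 * (z - u)^-1)).
  move=> z Sz; exact: (@cvgBC _ _ (nbhs z) (nbhs_filter z) _ _ _ _ (cd z Sz) (ckh z Sz)).
rewrite -(functionalB bL (ck h hd) ck0) -(functionalZ bL h ck2) -(functionalB bL cd ckh).
rewrite -mulrA; apply: (functional_le bL cdd) => z Sz.
have zu0 : z - u != 0.
  by rewrite subr_eq0; have := neq 0 z nc00 Sz; rewrite addr0.
have zuh0 : z - (u + h) != 0 by rewrite subr_eq0; exact: neq.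
have -> : f z * (z - (u + h))^-1 - f z * (z - u)^-1 - h * (f z * (z - u)^-1 * (z - u)^-1)
  = f z * ((z - (u + h))^-1 - (z - u)^-1 - h * ((z - u)^-1 * (z - u)^-1)) by ring.
rewrite (cauchy_kernel_expansion zu0 zuh0) !ncM.
have -> : M / (4 * d ^+ 3) * nc h ^+ 2 =
  M * (nc h * nc h * ((2 * d)^-1 * (2 * d)^-1 * d^-1)).
  by field; exact: lt0r_neq0.
apply: ler_pM; rewrite ?mulr_ge0 ?nc_ge0//; first exact: fM.
apply: ler_wpM2l; first by rewrite mulr_ge0 ?nc_ge0.
apply: ler_pM; rewrite ?mulr_ge0 ?nc_ge0//.
  by apply: ler_pM; rewrite ?nc_ge0//; exact: inv2d.
by rewrite ncV lef_pV2 ?posrE// ?(lt_le_trans d0)//; exact: uh.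
Qed.

Lemma quadratic_deriv f u D (C d : R) : 0 < d -> 
  (forall h, nc h <= d -> nc (f (u + h) - f u - h * D) <= C * nc h ^+ 2) ->
  derivable f u 1.
Proof.
move=> d0 hf; apply/derivableCP; exists D => e e0.
(* No sign is assumed of [C]. *)
pose C1 := Num.max C 0 + 1.
have C10 : 0 < C1 by rewrite ltr_wpDl// le_max lexx orbT.
exists (Num.min d (e / C1)); first by rewrite lt_min d0 divr_gt0.
move=> h; rewrite lt_min => /andP[/ltW hd he].
rewrite (le_trans (hf h hd))// expr2 mulrA ler_wpM2r ?nc_ge0//.
rewrite (le_trans (_ : _ <= C1 * nc h))//.
  by rewrite ler_wpM2r ?nc_ge0// /C1 ler_wpDr// le_max lexx.
by rewrite mulrC -ler_pdivlMr// ltW.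
Qed.

Lemma ultra_fmap (I T : Type) (G : set_system I) (a : I -> T) :
  UltraFilter G -> UltraFilter (fmap a G).
Proof.
move=> UG; split; first exact: fmap_proper_filter.
move=> H PH sGH; apply/seteqP; split; last exact: sGH.
move=> A HA; have [//|GnA] := in_ultra_setVsetC (a @^-1` A) UG.
have /filter_ex[x []//] : H (A `&` ~` A) by apply: filterI => //; exact: sGH.
Qed.

Lemma ultra_real_cvg (I : Type) (G : set_system I) (UG : UltraFilter G)
  (a : I -> R) (C : R) : (forall k, `|a k| <= C) -> exists l : R, a @ G --> l.
Proof.
move=> aC.
have := @segment_compact R (- C) C; rewrite compact_ultra => /(_ (fmap a G)).
have UaG : UltraFilter (fmap a G) by exact: ultra_fmap.
move=> /(_ UaG)[]; last by move=> l [_ al]; exists l.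
rewrite /= /nbhs /=; apply: filterE => k /=.
by rewrite in_itv /= -ler_norml.
Qed.

(** Compactness of closed intervals, applied to both components. The ultrafilter is given
    beforehand, so the same one serves for all sequences, values and derivatives alike. *)
Lemma ultra_bounded_cvg (I : Type) (G : set_system I) (UG : UltraFilter G)
  (a : I -> Cplx R) (C : R) : (forall k, nc (a k) <= C) -> exists l : Cplx R, a @ G --> l.
Proof.
move=> aC.
have [x hx] := @ultra_real_cvg _ G UG (Re \o a) C (fun k => le_trans (Re_le_nc _) (aC k)).
have [y hy] := @ultra_real_cvg _ G UG (Im \o a) C (fun k => le_trans (Im_le_nc _) (aC k)).
exists (Complex x y); apply/cvgCP => e e0.
have e2 : 0 < e / 2 by rewrite divr_gt0.
move: hx hy => /cvgrPdist_lt /(_ _ e2) hx /cvgrPdist_lt /(_ _ e2) hy.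
apply: filterS2 hx hy => k; rewrite /= => hx hy.
rewrite (le_lt_trans (nc_le_ReIm _))// (splitr e).
by case: (a k) hx hy => p q /= hx hy; rewrite ltrD// distrC.
Qed.

Lemma three_thirds (p q r s e : R) : s <= p + q -> p <= e / 3 -> q <= e / 3 ->
  r <= e / 3 -> s + r <= e.
Proof. lra. Qed.

(** The bounded derivatives [Dk] converge along [G], and the quadratic estimate passes to the limit
    because [C] and [d] do not depend on [k]. *)
Lemma cvg_quadratic_deriv (I : Type) (G : set_system I) (UG : UltraFilter G)
  (F : I -> Cplx R -> Cplx R) (Dk : I -> Cplx R) f u (C d : R) : 0 < d ->
  (forall k, nc (Dk k) <= C) ->
  (forall k h, nc h <= d -> nc (F k (u + h) - F k u - h * Dk k) <= C * nc h ^+ 2) ->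
  (forall h, nc h <= d -> F k (u + h) @[k --> G] --> f (u + h)) ->
  derivable f u 1.
Proof.
move=> d0 DC hF Ff; have [D hD] := ultra_bounded_cvg UG DC.
apply: (@quadratic_deriv f u D C d d0) => h hd.
apply/ler_addgt0Pr => e e0.
have e3 : 0 < e / 3 by rewrite divr_gt0.
have Fu : F k u @[k --> G] --> f u.
  by have := Ff 0; rewrite nc0 addr0; apply; exact: ltW.
have eh : 0 < e / 3 / (nc h + 1) by rewrite divr_gt0// ltr_wpDl ?nc_ge0.
have /(cvgCP _)/(_ _ e3) n1 := Ff h hd.
have /(cvgCP _)/(_ _ e3) n2 := Fu.
have /(cvgCP _)/(_ _ eh) n3 := hD.
have [k [[k1 k2] k3]] := filter_ex (filterI (filterI n1 n2) n3).
have -> : f (u + h) - f u - h * D = (F k (u + h) - F k u - h * Dk k) -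
   ((F k (u + h) - f (u + h)) - (F k u - f u) - h * (Dk k - D)) by ring.
rewrite (le_trans (ncD _ _))// ncN lerD//; first exact: hF.
rewrite (le_trans (ncD _ _))// ncN ncM.
have hd3 : nc h * nc (Dk k - D) <= e / 3.
  rewrite (le_trans (_ : _ <= (nc h + 1) * (e / 3 / (nc h + 1))))//.
    by rewrite ler_pM ?nc_ge0 ?lerDl// ltW.
  by rewrite mulrC divfK// gt_eqF// ltr_wpDl ?nc_ge0.
have := ncD (F k (u + h) - f (u + h)) (- (F k u - f u)); rewrite ncN => hs.
exact: three_thirds hs (ltW k1) (ltW k2) hd3.
Qed.

(* With [N u] the integral of [1 / (z - u)] over a square, Cauchy's formula says that
   [F k * N] is the Cauchy transform of [F k]; its second-order expansion is uniform
   in [k], so that the limit [f * N] is differentiable, and so is [f]. *)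
Lemma cvg_holomorphic_square (I : Type) (G : set_system I) (UG : UltraFilter G)
  (F : I -> Cplx R -> Cplx R) f u (M d : R) : 0 < d ->
  (forall k z, nc (z - u) <= 4 * d -> derivable (F k) z 1 /\ nc (F k z) <= M) ->
  (forall z, nc (z - u) <= 4 * d -> F k z @[k --> G] --> f z) ->
  derivable f u 1.
Proof.
move=> d0 hF Ff; have d2 : 0 < 2 * d by rewrite mulr_gt0.
(* With half-side [2 * d] the contour is at distance at least [2 * d] from [u], encloses every
   [u + h] with [|h| <= d], and stays within [4 * d] of [u]. *)
pose x1 := Re u - 2 * d; pose x2 := Re u + 2 * d.
pose y1 := Im u - 2 * d; pose y2 := Im u + 2 * d.
have hx : x1 <= x2 by rewrite /x1 /x2; lra.
have hy : y1 <= y2 by rewrite /y1 /y2; lra.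
have rz z : rect x1 x2 y1 y2 z -> nc (z - u) <= 4 * d.
  move=> [/andP[z1 z2] /andP[z3 z4]]; apply: (le_trans (nc_le_ReIm _)).
  rewrite /x1 /x2 /y1 /y2 in z1 z2 z3 z4.
  have : `|Re (z - u)| <= 2 * d.
    by rewrite ReB ler_norml; apply/andP; split; lra.
  have : `|Im (z - u)| <= 2 * d.
    by rewrite ImB ler_norml; apply/andP; split; lra.
  lra.
have bdz z : rect_bd x1 x2 y1 y2 z -> 2 * d <= nc (z - u).
  case=> _ bd; have L (a b c : R) : a = b - c \/ a = b + c -> c <= `|a - b|.
    case=> ->; first by rewrite addrAC subrr add0r normrN ler_norm.
    by rewrite addrAC subrr add0r ler_norm.
  case: bd => bd.
  - by apply: le_trans (Re_le_nc _); rewrite ReB; apply: L; left.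
  - by apply: le_trans (Re_le_nc _); rewrite ReB; apply: L; right.
  - by apply: le_trans (Im_le_nc _); rewrite ImB; apply: L; left.
  - by apply: le_trans (Im_le_nc _); rewrite ImB; apply: L; right.
have uh h : nc h <= d -> x1 < Re (u + h) < x2 /\ y1 < Im (u + h) < y2.
  move=> hd; have := le_trans (Re_le_nc h) hd; have := le_trans (Im_le_nc h) hd.
  rewrite !ler_norml /x1 /x2 /y1 /y2 => /andP[? ?] /andP[? ?].
  by rewrite ReD ImD; split; apply/andP; split; lra.
pose N v := rect_index v x1 x2 y1 y2.
have bL := rect_functional hx hy.
set Lam := 4 * (x2 - x1 + (y2 - y1)) in bL.
have Lam0 : 0 <= Lam by rewrite mulr_ge0// addr_ge0// subr_ge0.
have E0 v : nc v <= d -> u + v = u + v -> N (u + v) != 0.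
  by move=> /uh[? ?] _; exact: rect_index_neq0.
have dN : derivable N u 1.
  have c1 : cont_on (rect_bd x1 x2 y1 y2) (fun z => 1 : Cplx R).
    by move=> z _; apply: derivable_continuousC; exact: derivable_cstC.
  have [|D _ hD] := cauchy_transform_quadratic (M := 1) bL c1 _ d0 bdz.
    by move=> z _; rewrite nc1.
  apply: (quadratic_deriv d0 (D := D) (C := Lam * (1 / (4 * d ^+ 3)))) => h /hD.
  have E v : rect_int (fun z => 1 * (z - v)^-1) x1 x2 y1 y2 = N v.
    by apply: eq_rect_int => // z _; rewrite mul1r.
  by rewrite !E.
have cF k : cont_on (rect_bd x1 x2 y1 y2) (F k).
  by move=> z /rect_bd_sub/rz zu; have [dF _] := hF k z zu; exact: derivable_continuousC.
have FM k z : rect_bd x1 x2 y1 y2 z -> nc (F k z) <= M.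
  by move=> /rect_bd_sub/rz zu; have [] := hF k z zu.
have T k := cauchy_transform_quadratic bL (cF k) (FM k) d0 bdz.
pose Dk k := projT1 (cid2 (T k)).
have FN k h : nc h <= d ->
    rect_int (fun z => F k z * (z - (u + h))^-1) x1 x2 y1 y2 = F k (u + h) * N (u + h).
  move=> /uh[h1 h2].
  have dF z : rect x1 x2 y1 y2 z -> derivable (F k) z 1.
    by move=> /rz zu; have [] := hF k z zu.
  exact: (@cauchy_formula _ (F k) (u + h) x1 x2 y1 y2 h1 h2 dF).
have nc00 : nc (0 : Cplx R) <= d by rewrite nc0 ltW.
have dfN : derivable (fun v => f v * N v) u 1.
  pose C := Num.max (Lam * (M / (4 * d ^+ 2))) (Lam * (M / (4 * d ^+ 3))).
  apply: (@cvg_quadratic_deriv _ G UG (fun k v => F k v * N v) Dk _ _ C d d0).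
  - move=> k; rewrite /Dk; case: cid2 => D /= h1 _; rewrite (le_trans h1)//.
    by rewrite /C le_max lexx.
  - move=> k h hd; rewrite /Dk; case: cid2 => D /= _ /(_ h hd).
    rewrite FN//; have := FN k 0 nc00; rewrite addr0 => -> h1.
    rewrite (le_trans h1)// ler_wpM2r ?exprn_ge0 ?nc_ge0//.
    by rewrite /C le_max lexx orbT.
  - move=> h hd.
    have uhz : nc (u + h - u) <= 4 * d by rewrite addrAC subrr add0r; lra.
    have := Ff _ uhz => /(cvgCP _) lim; apply/cvgCP => e e0.
    have n0 : 0 < nc (N (u + h)) by rewrite nc_gt0; exact: E0.
    apply: filterS (lim _ (divr_gt0 e0 n0)) => k hk.
    by rewrite -mulrBl ncM -ltr_pdivlMr.
have dfNN : derivable (fun v => f v * N v * (N v)^-1) u 1.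
  have Nu0 : N u != 0 by have := E0 0 nc00 erefl; rewrite addr0.
  have dNV : derivable (fun v => (N v)^-1) u 1 by exact: (@derivableV _ _ N u 1 Nu0 dN).
  exact: (@derivable_mulC _ (fun v => f v * N v) (fun v => (N v)^-1) u dfN dNV).
have [D hD] := (derivableCP _ _).1 dfNN; apply/derivableCP; exists D.
apply: (has_deriv_local d0 _ hD) => z zd /=; rewrite mulfK//.
by have := E0 (z - u) (ltW zd) erefl; rewrite addrC subrK.
Qed.

(** Convergence is only pointwise: the local bounds, uniform in [k], do the work of locally uniform
    convergence. *)
Lemma cvg_holomorphic (I : Type) (G : set_system I) (UG : UltraFilter G)
  (F : I -> Cplx R -> Cplx R) f (U : set (Cplx R)) : open U ->
  (forall z, U z -> exists (M r : R), 0 < r /\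
    forall k w, nc (w - z) < r -> derivable (F k) w 1 /\ nc (F k w) <= M) ->
  (forall z, U z -> F k z @[k --> G] --> f z) ->
  holomorphic U f.
Proof.
move=> oU hF Ff z Uz; have [M [r [r0 hr]]] := hF z Uz.
have [e e0 eU] := (openCP U).1 oU z Uz.
pose d := Num.min r e / 5.
have d0 : 0 < d by rewrite divr_gt0// lt_min r0.
have hd w : nc (w - z) <= 4 * d -> nc (w - z) < r /\ nc (w - z) < e.
  move=> wz; suff : nc (w - z) < Num.min r e by rewrite lt_min => /andP[].
  by move: d0 wz; rewrite /d; lra.
apply: (@cvg_holomorphic_square _ G UG F f z M d d0).
  by move=> k w /hd[wr _]; exact: hr.
by move=> w /hd[_ we]; apply: Ff; exact: eU.
Qed.

End limits_of_holomorphic.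

(** * Components and rational discs *)

Section rational_discs.
Context {R : realType}.
Implicit Types (A U Y O : set (Cplx R)) (f g : Cplx R -> Cplx R) (z w a : Cplx R).

Lemma nc_ball_connected a (r : R) : connected [set z | nc (z - a) < r].
Proof.
rewrite (_ : [set _ | _] = ball a (r%:C)%C); first exact: ball_connected.
by apply/seteqP; split=> z; [move=> h; apply/ballCE; rewrite ncB|move/ballCE; rewrite ncB].
Qed.

Lemma connected_component_max_in A z w (B : set (Cplx R)) :
  connected_component A z w -> B w -> B `<=` A -> connected B ->
  B `<=` connected_component A z.
Proof.
move=> zw Bw BA cB; rewrite (same_connected_component zw).
exact: connected_component_max.
Qed.

Lemma open_component A z : open A -> open (connected_component A z).
Proof.
move=> oA; apply/openCP => w zw; have Aw := connected_component_sub zw.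
have [e e0 eA] := (openCP A).1 oA w Aw; exists e => //.
apply: (connected_component_max_in zw) => //=; first by rewrite subrr nc0.
exact: nc_ball_connected.
Qed.

(* Otherwise the component would be both open and closed in [U]. *)
Lemma component_adherent U O z : connected U -> open U -> open O ->
  ~ (U `<=` O) -> (U `&` O) z ->
  exists a, [/\ closure (connected_component (U `&` O) z) a, U a & ~ O a].
Proof.
move=> cU oU oO nUO UOz; apply: contrapT => H; apply: nUO.
set Y := connected_component (U `&` O) z.
have YUO : Y `<=` U `&` O by exact: connected_component_sub.
suff YU : Y = U by rewrite -YU => w /YUO[].
apply: cU.
- by exists z; exact: connected_component_refl.
- exists Y; first by apply: open_component; exact: openI.
  by apply/seteqP; split=> w; [move=> Yw; split=> //; exact: (YUO w Yw).1|case].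
- exists (closure Y); first exact: closed_closure.
  apply/seteqP; split=> w.
    by move=> Yw; split; [exact: (YUO w Yw).1|exact: subset_closure].
  move=> [Uw cYw]; have Ow : O w by apply: contrapT => nOw; apply: H; exists w.
  have [e e0 eUO] := (openCP _).1 (openI oU oO) w (conj Uw Ow).
  have [y Yy yw] := (closureCP _ _).1 cYw e e0.
  apply: (connected_component_max_in Yy _ eUO) => //=; last by rewrite subrr nc0.
  exact: nc_ball_connected.
Qed.

Definition qpoint (q : rat * rat) : Cplx R := Complex (ratr q.1) (ratr q.2).

Lemma rat_between (x e : R) : 0 < e -> exists q : rat, `|ratr q - x| < e.
Proof.
move=> e0; have : x - e < x + e by lra.
move=> /rat_in_itvoo[q]; rewrite in_itv/= => /andP[q1 q2]; exists q.
by rewrite ltr_norml; apply/andP; split; lra.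
Qed.

Lemma qpoint_dense a (e : R) : 0 < e -> exists q, nc (qpoint q - a) < e.
Proof.
move=> e0; have e2 : 0 < e / 2 by rewrite divr_gt0.
have [q hq] := rat_between (complex.Re a) e2.
have [p hp] := rat_between (complex.Im a) e2.
exists (q, p); apply: (le_lt_trans (nc_le_ReIm _)).
by rewrite ReB ImB /= (splitr e) ltrD.
Qed.

(** Centre and radius of a disc, and a point that selects a component. Codes with a radius that is
    not positive give an empty disc and are never admissible. *)
Definition index_type := ((rat * rat) * rat * (rat * rat))%type.
Implicit Type i : index_type.

Definition qdisc i : set (Cplx R) := ball (qpoint i.1.1) (ratr i.1.2)%:C%C.

Definition qcomp O i : set (Cplx R) :=
  connected_component (qdisc i `&` O) (qpoint i.2).

(** The second condition makes the component reach a boundary point of [O] inside the disc, by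
    [component_adherent]. *)
Definition admissible O i := (qdisc i `&` O) (qpoint i.2) /\ ~ (qdisc i `<=` O).

Lemma qdisc_open i : open (qdisc i).
Proof. exact: open_ballC. Qed.

Lemma qdisc_connected i : connected (qdisc i).
Proof. exact: ball_connected. Qed.

Lemma qdisc_small a (e : R) : 0 < e ->
  exists c r, forall q, qdisc (c, r, q) a /\
    forall z, qdisc (c, r, q) z -> nc (z - a) < e.
Proof.
move=> e0; have e4 : 0 < e / 4 by rewrite divr_gt0.
have [c hc] := qpoint_dense a e4.
have : e / 4 < e / 2 by lra.
move=> /rat_in_itvoo[r]; rewrite in_itv/= => /andP[r1 r2].
exists c, r => q; split; first by apply/ballCE => /=; exact: lt_trans r1.
move=> z /ballCE /=; rewrite ncB => zc.
rewrite -(subrK (qpoint c) z) -addrA (le_lt_trans (ncD _ _))//; lra.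
Qed.

(** Around a boundary point [a] adherent to the component, a small rational disc meets the component
    in an open set, hence in a rational point, whose own component stays inside. This replaces
    arbitrary discs and domains by countably many tests. *)
Lemma component_refine U O z : connected U -> open U -> open O ->
  ~ (U `<=` O) -> (U `&` O) z ->
  exists a, [/\ closure (connected_component (U `&` O) z) a, U a, ~ O a &
    forall e : R, 0 < e -> exists i, [/\ admissible O i,
      (forall w, qdisc i w -> nc (w - a) < e) &
      qcomp O i `<=` connected_component (U `&` O) z]].
Proof.
move=> cU oU oO nUO UOz.
have [a [cla Ua nOa]] := component_adherent cU oU oO nUO UOz.
exists a; split=> // e e0; have [d d0 dU] := (openCP U).1 oU a Ua.
have [c [r hcr]] : exists c r, forall q, qdisc (c, r, q) a /\
    forall z, qdisc (c, r, q) z -> nc (z - a) < Num.min d e.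
  by apply: qdisc_small; rewrite lt_min d0.
have [Ba Bde] := hcr (0, 0).
set Y := connected_component _ _ in cla *.
have [y [Yy By]] : Y `&` qdisc (c, r, (0, 0)) !=set0.
  by apply: cla; apply: open_nbhs_nbhs; split=> //; exact: qdisc_open.
have oYB : open (Y `&` qdisc (c, r, (0, 0))).
  by apply: openI; [apply: open_component; exact: openI|exact: qdisc_open].
have [s s0 sYB] := (openCP _).1 oYB y (conj Yy By).
have [q /sYB[Yq Bq]] := qpoint_dense y s0.
have Oq : O (qpoint q) by case: (connected_component_sub Yq).
exists (c, r, q); split.
- split; first by split.
  by move=> /(_ a Ba).
- by move=> w /Bde; rewrite lt_min => /andP[].
- apply: (connected_component_max_in Yq).
  + by apply: connected_component_refl; split.
  + move=> w /connected_component_sub[Bw Ow]; split=> //; apply: dU.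
    by have := Bde w Bw; rewrite lt_min => /andP[].
  + exact: component_connected.
Qed.

Definition unbounded_on f (S : set (Cplx R)) :=
  forall M : R, exists2 z, S z & M < nc (f z).

(** The bounds in [bounded_set] live in [R[i]] with its partial order; they are traded here for real
    ones. *)
Lemma bounded_set_ncP f (S : set (Cplx R)) :
  bounded_set (f @` S) <-> exists M : R, forall z, S z -> nc (f z) <= M.
Proof.
split=> [[M [Mr hM]]|[M hM]].
  exists (complex.Re M + 1) => z Sz.
  have : M < (complex.Re M + 1)%:C%C.
    by rewrite rmorphD /= RRe_real// ltrDl ltr01.
  move=> /hM h; have := h (f z) (ex_intro2 _ _ z Sz erefl).
  by rewrite /= normCE lecR.
exists M%:C%C; split; first by apply/complex_realP; exists M.
by move=> x Mx _ [z Sz <-]; rewrite /= normCE (le_trans _ (ltW Mx))// lecR; exact: hM.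
Qed.

Lemma unbounded_onP f (S : set (Cplx R)) :
  unbounded_on f S <-> ~ bounded_set (f @` S).
Proof.
split=> [uf /bounded_set_ncP[M hM]|nb M].
  by have [z Sz] := uf M; rewrite ltNge hM.
apply: contrapT => H; apply: nb; apply/bounded_set_ncP; exists M => z Sz.
by rewrite leNgt; apply/negP => Mz; apply: H; exists z.
Qed.

Lemma boundary_open O a : open O -> boundary O a <-> closure O a /\ ~ O a.
Proof.
move=> oO; rewrite /boundary; have -> : interior O = O by exact/interior_id.
by [].
Qed.

Lemma totally_unboundedP O f : open O -> totally_unbounded O f <->
  forall i, admissible O i -> unbounded_on f (qcomp O i).
Proof.
move=> oO; split=> [tu i [Bi nBi]|H zeta e Y bz e0 [z Bz ->]].
  have [a [cla Ba nOa]] :=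
    component_adherent (@qdisc_connected i) (@qdisc_open i) oO nBi Bi.
  have [e e0 eB] := (openCP _).1 (@qdisc_open i) a Ba.
  have [y Yy ya] := (closureCP _ _).1 cla e e0.
  have [By Oy] := connected_component_sub Yy.
  have ba : boundary O a.
    apply/boundary_open => //; split=> //; apply/closureCP => r r0.
    have [x Yx xa] := (closureCP _ _).1 cla r r0.
    by exists x => //; case: (connected_component_sub Yx).
  have eay : (ball a e%:C%C `&` O) y by split=> //; apply/ballCE; rewrite ncB.
  have := tu a e _ ba e0 (ex_intro2 _ _ y eay erefl).
  move=> /unbounded_onP uf M; have [x cx Mx] := uf M; exists x => //.
  (* The small disc around the boundary point lies in the rational one, so its component through [y]
     lies in the given component. *)
  apply: (connected_component_max_in Yy _ _ _ cx).
  - exact: connected_component_refl.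
  - move=> v /connected_component_sub[/ballCE va Ov]; split=> //.
    by apply: eB; rewrite ncB.
  - exact: component_connected.
move/(boundary_open _ oO) : bz => [_ nOz].
have nB : ~ (ball zeta e%:C%C `<=` O).
  by move=> /(_ zeta) h; apply: nOz; apply: h; apply/ballCE; rewrite subrr nc0.
have [a [_ _ _ /(_ 1 ltr01)[i [vi _ iY]]]] :=
  component_refine (@ball_connected _ zeta e) (@open_ballC _ zeta e) oO nB Bz.
apply/unbounded_onP => M; have [x Yx Mx] := H i vi M.
by exists x => //; exact: iY.
Qed.

Definition extends_on O i (M : R) f := exists F, [/\ holomorphic (qdisc i) F,
  (forall z, qdisc i z -> nc (F z) <= M) & forall z, qcomp O i z -> f z = F z].

Lemma extendableP O f : open O -> extendable O f <->
  exists i (M : nat), admissible O i /\ extends_on O i M%:R f.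
Proof.
move=> oO; split=> [[U [F [Y [[U0 oU cU] [b [/(boundary_open _ oO)[_ nOb] Ub]] hF]]]]|].
  move=> [z Uz YE] fF.
  have nUO : ~ (U `<=` O) by move=> /(_ b Ub).
  have [a [_ Ua _ ha]] := component_refine cU oU oO nUO Uz.
  (* Continuity at the boundary point bounds [F] near it; this is what allows extensions to be
     counted by natural bounds. *)
  have [d d0 hd] := (continuousCP F a).1 (derivable_continuousC (hF a Ua)) 1 ltr01.
  have [e e0 eU] := (openCP U).1 oU a Ua.
  have de0 : 0 < Num.min d e by rewrite lt_min d0.
  have [i [vi iB iY]] := ha _ de0.
  have {}iB w : qdisc i w -> nc (w - a) < d /\ nc (w - a) < e.
    by move=> /iB; rewrite lt_min => /andP[].
  exists i, (Num.bound (nc (F a) + 1)); split=> //; exists F; split.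
  - by move=> w /iB[_ /eU]; exact: hF.
  - move=> w /iB[/hd/ltW h1 _]; rewrite (le_trans _ (ltW (archi_boundP _)))//.
      by rewrite -lerBlDl (le_trans _ h1)//; exact: ncB_ge.
    by rewrite addr_ge0 ?nc_ge0.
  - by move=> w /iY Yw; apply: fF; rewrite inE YE.
move=> [i [M [[Bi nBi] [F [hF _ fF]]]]].
have [a [cla Ba nOa]] :=
  component_adherent (@qdisc_connected i) (@qdisc_open i) oO nBi Bi.
exists (qdisc i), F, (qcomp O i); split=> //.
- split; [by exists a|exact: qdisc_open|exact: qdisc_connected].
- exists a; split=> //; apply/boundary_open => //; split=> //.
  apply/closureCP => r r0; have [x Yx xa] := (closureCP _ _).1 cla r r0.
  by exists x => //; case: (connected_component_sub Yx).
- by exists (qpoint i.2).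
- by move=> z; rewrite inE; exact: fF.
Qed.

Lemma extends_on_bounded O i (M : R) f : extends_on O i M f ->
  admissible O i -> ~ unbounded_on f (qcomp O i).
Proof.
move=> [F [_ FM fF]] [Bi _] /(_ M)[z Yz]; rewrite ltNge fF// FM//.
by case: (connected_component_sub Yz).
Qed.

End rational_discs.

(** * Integrals over plane sets *)

Section plane_measure.
Context {R : realType}.
Implicit Types (V A : set (Cplx R)) (f g : Cplx R -> Cplx R) (z a : Cplx R) (p : R).
Local Notation Re := (@complex.Re R).
Local Notation Im := (@complex.Im R).
Local Notation mu := (@lebesgue_measure R).
Local Notation T2 := (measurableTypeR R * measurableTypeR R)%type.

Definition pt (w : T2) : Cplx R := Complex (w.1 : R) (w.2 : R).

Definition plane A : set T2 := [set w | A (pt w)].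

Definition rbox (p q r : rat) : set T2 :=
  `]ratr p - ratr r, ratr p + ratr r[%classic `*`
  `]ratr q - ratr r, ratr q + ratr r[%classic.

(** An open set is the countable union of the rational squares that it contains, which are
    measurable in the product. *)
Lemma measurable_plane A : open A -> measurable (plane A).
Proof.
move=> oA.
have -> : plane A = \bigcup_(p : rat) \bigcup_(q : rat) \bigcup_(r : rat)
   (if pselect (rbox p q r `<=` plane A) then rbox p q r else set0).
  apply/seteqP; split=> [[x y] Aw|w [p _ [q _ [r _]]]]; last first.
    by case: pselect => // s /s.
  have [e e0 eA] := (openCP A).1 oA _ Aw.
  (* Centre within [e / 8] and half-side between [e / 8] and [e / 4]: the square contains the point,
     and each coordinate varies by less than [e / 2]. *)
  have e8 : 0 < e / 8 by rewrite divr_gt0.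
  have [p hp] := rat_between x e8; have [q hq] := rat_between y e8.
  have : e / 8 < e / 4 by lra.
  move=> /rat_in_itvoo[r]; rewrite in_itv/= => /andP[r1 r2].
  exists p => //; exists q => //; exists r => //.
  move: hp hq; rewrite !ltr_norml => /andP[p1 p2] /andP[q1 q2].
  case: pselect => [sub|]; last case.
    by split; rewrite /= in_itv /=; apply/andP; split; lra.
  move=> [x' y'] [/=]; rewrite !in_itv /= => /andP[a1 a2] /andP[b1 b2].
  apply: eA; apply: (le_lt_trans (nc_le_ReIm _)); rewrite ReB ImB /pt /=.
  have : `|x' - x| < e / 2 by rewrite ltr_norml; apply/andP; split; lra.
  have : `|y' - y| < e / 2 by rewrite ltr_norml; apply/andP; split; lra.
  lra.
apply: bigcupT_measurable_rat => p; apply: bigcupT_measurable_rat => q.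
apply: bigcupT_measurable_rat => r; case: pselect => [?|?] /=; last exact: measurable0.
by apply: measurableX; exact: measurable_itv.
Qed.

Lemma measurable_fun_plane V (h : Cplx R -> R) : open V ->
  (forall z, V z -> {for z, continuous h}) ->
  measurable_fun (plane V) (fun w => h (pt w)).
Proof.
move=> oV ch mV; apply: (measurability _ (RGenOInfty.measurableE R)) => //.
move=> /= _ [_ [x ->] <-]; rewrite preimage_itvoy.
rewrite [X in measurable X](_ : _ = plane (V `&` [set z | x < h z])); last first.
  by apply/seteqP; split=> w [].
apply: measurable_plane; apply/openCP => z [Vz hz].
have [e e0 eV] := (openCP V).1 oV z Vz.
have hxz : 0 < h z - x by rewrite subr_gt0.
have [d d0 hd] := (continuousCRP h z).1 (ch z Vz) _ hxz.
exists (Num.min e d); first by rewrite lt_min e0.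
move=> w; rewrite lt_min => /andP[/eV Vw /hd hw]; split=> //=.
by move: hw; rewrite ltr_norml => /andP[]; lra.
Qed.

Lemma plane_bounded V : bounded_set V -> exists2 L : R, 0 < L &
  plane V `<=` `[- L, L]%classic `*` `[- L, L]%classic.
Proof.
move=> [M [Mr hM]].
have M1 : M < (`|Re M| + 1)%:C%C.
  rewrite -(RRe_real Mr) ltcR /= (le_lt_trans (ler_norm _))// ltrDl.
  by [].
exists (`|Re M| + 1); first by rewrite ltr_wpDl.
move=> [x y] /(hM _ M1) /=; rewrite normCE lecR => h; split; rewrite /= in_itv /= -ler_norml.
- exact: le_trans (Re_le_nc (Complex x y)) h.
- exact: le_trans (Im_le_nc (Complex x y)) h.
Qed.

Lemma dxdyX (A B : set (measurableTypeR R)) : measurable A -> measurable B ->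
  dxdy (A `*` B) = (mu A * mu B)%E.
Proof. by move=> mA mB; rewrite /dxdy product_measure1E. Qed.

Lemma mu_itv (a b : R) : a <= b -> mu `[a, b]%classic = (b - a)%:E.
Proof.
rewrite lebesgue_measure_itv /= lte_fin le_eqVlt => /predU1P[->|->]//.
by rewrite ltxx subrr.
Qed.

Lemma dxdy_plane_fin V : open V -> bounded_set V -> (dxdy (plane V) < +oo)%E.
Proof.
move=> oV /plane_bounded[L L0 VL].
pose S : set T2 := `[- L, L]%classic `*` `[- L, L]%classic.
have mL : measurable S.
  by apply: measurableX; exact: measurable_itv.
apply: (@le_lt_trans _ _ (dxdy S)).
  by apply: le_measure; rewrite ?inE//; exact: measurable_plane.
rewrite dxdyX; [|exact: measurable_itv|exact: measurable_itv].
have LL : - L <= L by rewrite ge0_cp// ltW.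
by rewrite (mu_itv LL) -EFinM ltry.
Qed.

Definition strip (x r : R) : set T2 := `[x - r, x + r]%classic `*` setT.

Lemma dxdy_strip V (L x r : R) : 0 < L -> 0 <= r -> open V ->
  plane V `<=` `[- L, L]%classic `*` `[- L, L]%classic ->
  (dxdy (strip x r `&` plane V) <= (4 * L * r)%:E)%E.
Proof.
move=> L0 r0 oV VL.
have mX (A B : set (measurableTypeR R)) : measurable A -> measurable B ->
  measurable (A `*` B : set T2) by move=> ? ?; exact: measurableX.
pose S : set T2 := `[x - r, x + r]%classic `*` `[- L, L]%classic.
apply: (@le_trans _ _ (dxdy S)).
  apply: le_measure; rewrite ?inE.
  - apply: measurableI; last exact: measurable_plane.
    by apply: mX => //; exact: measurable_itv.
  - by apply: mX; exact: measurable_itv.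
  - by move=> w [[w1 _] /VL[_ w2]]; split.
rewrite dxdyX; [|exact: measurable_itv|exact: measurable_itv].
have LL : - L <= L by rewrite ge0_cp// ltW.
rewrite (mu_itv LL) mu_itv; last lra.
by rewrite -EFinM lee_fin; lra.
Qed.

(* Since [|z - a| >= |x - Re a|], the sum of the [2 ^ n] over the strips
   [|x - Re a| <= 4 ^ - n] dominates [|z - a| ^ (- 1 / 2)]; the strips being of area
   [O(4 ^ - n)] in a bounded set, its integral is finite. *)
Definition strip_term (x : R) (n : nat) (w : T2) : \bar R :=
  ((2 ^+ n : R)%R%:E * (\1_(strip x (4 ^- n)%R) w)%:E)%E.

Definition strip_sum (x : R) (w : T2) : \bar R := (\sum_(n <oo) strip_term x n w)%E.

Lemma measurable_strip (x r : R) :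
  measurable (strip x r).
Proof. by apply: measurableX => //; exact: measurable_itv. Qed.

Lemma strip_term_ge0 x n w : (0 <= strip_term x n w)%E.
Proof. by rewrite mule_ge0// lee_fin ?exprn_ge0. Qed.

Lemma measurable_strip_term V x n : measurable_fun (plane V) (strip_term x n).
Proof.
apply: measurable_funeM; apply/measurable_EFinP.
by apply: measurable_funTS; apply: measurable_indic; exact: measurable_strip.
Qed.

Lemma integral_strip_sum V (x : R) : open V -> bounded_set V ->
  (\int[dxdy]_(w in plane V) strip_sum x w < +oo)%E.
Proof.
move=> oV /plane_bounded[L L0 VL]; have mV := measurable_plane oV.
rewrite integral_nneseries//; last 2 first.
- by move=> n; exact: measurable_strip_term.
- by move=> n w _; exact: strip_term_ge0.
(* The n-th term integrates to at most [2 ^ n * 4 * L * 4 ^- n], which is [8 * L / 2 ^ (n + 1)]. *)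
apply: (@le_lt_trans _ _ (8 * L)%:E); last exact: ltry.
have L8 : 0 <= 8 * L by rewrite mulr_ge0// ltW.
apply: le_trans (epsilon_trick0 xpredT L8); apply: lee_nneseries => n _.
  by move=> _; apply: integral_ge0 => w _; exact: strip_term_ge0.
have mi : measurable_fun (plane V) (fun w => (\1_(strip x (4 ^- n)) w)%:E : \bar R).
  apply/measurable_EFinP; apply: measurable_funTS; apply: measurable_indic.
  exact: measurable_strip.
have i0 (w : T2) : plane V w -> (0 <= (\1_(strip x (4 ^- n)) w)%:E :> \bar R)%E by rewrite lee_fin.
have n0 : 0 <= (2 : R) ^+ n by rewrite exprn_ge0.
rewrite (ge0_integralZl_EFin dxdy mV i0 mi n0).
rewrite integral_indic//; last exact: measurable_strip.
apply: (@le_trans _ _ ((2 ^+ n : R)%R%:E * (4 * L * 4 ^- n)%R%:E)%E).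
  rewrite lee_pmul2l ?lte_fin ?exprn_gt0//.
  by apply: dxdy_strip => //; rewrite invr_ge0 exprn_ge0.
rewrite -EFinM lee_fin natrX exprS.
have -> : (4 : R) ^+ n = 2 ^+ n * 2 ^+ n by rewrite -exprMn -natrM.
rewrite le_eqVlt; apply/orP; left; apply/eqP; field.
exact: expf_neq0.
Qed.

Lemma powR_half_scale n (r : R) : 4 ^- n.+1 < r -> r `^ (- 2^-1) <= 2 ^+ n.+1.
Proof.
move=> hr; have r0 : 0 < r by rewrite (le_lt_trans _ hr)// invr_ge0 exprn_ge0.
rewrite powRN powR12_sqrt ?(ltW r0)// invf_ple ?posrE ?exprn_gt0 ?sqrtr_gt0//.
rewrite -[leLHS]ger0_norm ?invr_ge0 ?exprn_ge0//.
rewrite -sqrtr_sqr ler_wsqrtr// exprVn -exprM mulnC exprM (le_trans _ (ltW hr))//.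
by have -> : (2 : R) ^+ 2 = 4 by rewrite -natrX.
Qed.

(** Write [r] for the distance and take the least [n] with [4 ^- (n + 1) < r]. Then [r <= 4 ^- n]
    puts the point in the n-th strip, which contributes [2 ^ n], while
    [r ^ (- 1 / 2) <= 2 ^ (n + 1)]. The constant 2 covers [r > 1]. *)
Lemma strip_sum_lower a z : z != a ->
  ((nc (z - a) `^ (- 2^-1))%:E <= 2%:E + 2%:E * strip_sum (Re a) (Re z, Im z))%E.
Proof.
move=> za; have r0 : 0 < nc (z - a) by rewrite nc_gt0 subr_eq0.
have s0 : (0 <= strip_sum (Re a) (Re z, Im z))%E.
  by apply: nneseries_ge0 => n _ _; exact: strip_term_ge0.
have [r1|r1] := ltP 1 (nc (z - a)).
  apply: (@le_trans _ _ 2%:E); last by rewrite leeDl// mule_ge0.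
  have h41 : 4 ^- 1 < nc (z - a).
    by rewrite (le_lt_trans _ r1)// expr1 invf_le1// ler1n.
  rewrite lee_fin.
  exact: (powR_half_scale h41).
have ex : exists n, 4 ^- n.+1 < nc (z - a).
  exists (Num.bound (nc (z - a))^-1); rewrite invf_plt ?posrE ?exprn_gt0//.
  have i0 : 0 <= (nc (z - a))^-1 by rewrite invr_ge0 ltW.
  have h := archi_boundP i0.
  rewrite (lt_trans h)// -natrX ltr_nat (ltn_trans (ltn_expl _ (isT : 1 < 4)%N))//.
  by rewrite ltn_exp2l.
have [n hn nmin] := ex_minnP ex.
have le4 : nc (z - a) <= 4 ^- n.
  case: n hn nmin => [|m] hn nmin; first by rewrite expr0 invr1.
  by rewrite leNgt; apply/negP => /nmin; rewrite ltnn.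
apply: (@le_trans _ _ (2%:E * (2 ^+ n : R)%R%:E)%E).
  rewrite -EFinM lee_fin -exprS; exact: powR_half_scale.
apply: (@le_trans _ _ (2%:E * strip_sum (Re a) (Re z, Im z))%E); last by rewrite leeDr.
rewrite lee_pmul2l//.
have := @nneseries_lim_ge R (fun n => strip_term (Re a) n (Re z, Im z)) xpredT
  0%N n.+1 (fun n _ _ => strip_term_ge0 _ _ _).
apply: le_trans; rewrite big_nat_recr //= {2}/strip_term.
rewrite indicE mem_set ?mule1; last first.
  split=> //=; rewrite in_itv /=; have := le_trans (Re_le_nc _) le4.
  by rewrite ReB ler_norml => /andP[? ?]; apply/andP; split; lra.
by rewrite leeDr// sume_ge0// => i _; exact: strip_term_ge0.
Qed.

(** The two centres will be the ends of the segment outside the domain, where the logarithm is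
    singular. *)
Lemma finite_integral_weak_singularities V (h : Cplx R -> R) a b (A B : R) :
  open V -> bounded_set V -> ~ V a -> ~ V b -> 0 <= A -> 0 <= B ->
  measurable_fun (plane V) (fun w => h (pt w)) -> (forall z, V z -> 0 <= h z) ->
  (forall z, V z -> h z <= A + B * nc (z - a) `^ (- 2^-1) + B * nc (z - b) `^ (- 2^-1)) ->
  (\int[dxdy]_(w in plane V) (h (pt w))%:E < +oo)%E.
Proof.
move=> oV bV na nb A0 B0 mh h0 hle; have mV := measurable_plane oV.
have S0 x w : (0 <= strip_sum x w)%E.
  by apply: nneseries_ge0 => n _ _; exact: strip_term_ge0.
have mS x : measurable_fun (plane V) (strip_sum x).
  have := @ge0_emeasurable_sum _ T2 R (plane V) (strip_term x) xpredT.
  apply=> [k w _ _|k _]; first exact: strip_term_ge0.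
  exact: measurable_strip_term.
have m2 x : measurable_fun (plane V) (fun w => (2 * B)%:E * strip_sum x w)%E.
  exact: measurable_funeM.
have B2 : 0 <= 2 * B by rewrite mulr_ge0.
have n2 x w : plane V w -> (0 <= (2 * B)%:E * strip_sum x w)%E by move=> _; rewrite mule_ge0.
have mc : measurable_fun (plane V) (fun=> (A + 4 * B)%:E) by exact: measurable_cst.
have c0 : 0 <= A + 4 * B by rewrite addr_ge0// mulr_ge0.
apply: (@le_lt_trans _ _ (\int[dxdy]_(w in plane V) (((A + 4 * B)%:E +
    (2 * B)%:E * strip_sum (Re a) w) + (2 * B)%:E * strip_sum (Re b) w)))%E.
  apply: ge0_le_integral => //.
  - by move=> w Vw; rewrite lee_fin h0.
  - exact/measurable_EFinP.
  - by apply: emeasurable_funD => //; apply: emeasurable_funD.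
  - move=> [x y] Vw.
    have nea : pt (x, y) != a by apply/eqP => e; apply: na; rewrite -e.
    have neb : pt (x, y) != b by apply/eqP => e; apply: nb; rewrite -e.
    have la := strip_sum_lower nea; have lb := strip_sum_lower neb.
    apply: (@le_trans _ _ (A%:E + B%:E * (2%:E + 2%:E * strip_sum (Re a) (x, y)) +
       B%:E * (2%:E + 2%:E * strip_sum (Re b) (x, y))))%E.
      apply: le_trans (_ : (_ <= A%:E + B%:E * (nc (pt (x, y) - a) `^ (- 2^-1))%:E +
          B%:E * (nc (pt (x, y) - b) `^ (- 2^-1))%:E)%E) _.
        by rewrite -!EFinM -!EFinD lee_fin; exact: hle.
      by apply: leeD; [apply: leeD => //|]; apply: lee_wpmul2l; rewrite ?lee_fin.
    rewrite !ge0_muleDr ?mule_ge0// !muleA -!EFinM (mulrC B 2).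
    have -> : ((A + 4 * B)%:E = A%:E + (2 * B)%:E + (2 * B)%:E)%E.
      by rewrite -!EFinD; congr EFin; ring.
    rewrite !addeA le_eqVlt; apply/orP; left; apply/eqP.
    by congr (_ + _)%E; rewrite addeAC.
have nc1 (w : T2) : plane V w -> (0 <= (A + 4 * B)%:E)%E by rewrite lee_fin.
have n3 w : plane V w -> (0 <= (A + 4 * B)%:E + (2 * B)%:E * strip_sum (Re a) w)%E.
  by move=> Vw; rewrite adde_ge0 ?n2 ?(nc1 w).
have m3 : measurable_fun (plane V)
    (fun w => (A + 4 * B)%:E + (2 * B)%:E * strip_sum (Re a) w)%E.
  exact: emeasurable_funD.
rewrite (ge0_integralD dxdy mV n3 m3 (n2 _) (m2 _)).
rewrite (ge0_integralD dxdy mV nc1 mc (n2 _) (m2 _)).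
have nS x w : plane V w -> (0 <= strip_sum x w)%E by move=> _.
rewrite !(ge0_integralZl_EFin dxdy mV (nS _) (mS _) B2) integral_cst//.
rewrite !lte_add_pinfty// ?lte_mul_pinfty// ?lee_fin//.
- exact: dxdy_plane_fin.
- exact: integral_strip_sum.
- exact: integral_strip_sum.
Qed.

End plane_measure.

(** * Integrals of p-th powers for all p > 0 *)

Section Lp.
Context {R : realType}.
Implicit Types (V : set (Cplx R)) (f g : Cplx R -> Cplx R) (z : Cplx R) (p : R).
Local Notation T2 := (measurableTypeR R * measurableTypeR R)%type.

Definition cont_in V f := forall z, V z -> {for z, continuous f}.

Lemma integral_powE V p f :
  integral_pow V p f = (\int[dxdy]_(w in plane V) (nc (f (pt w)) `^ p)%:E)%E.
Proof. by []. Qed.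

Lemma measurable_nc_pow V p f : open V -> cont_in V f ->
  measurable_fun (plane V) (fun w => nc (f (pt w)) `^ p).
Proof.
move=> oV cf.
have mh : measurable_fun (plane V) (fun w => nc (f (pt w))).
  apply: (measurable_fun_plane (h := fun z => nc (f z))) => // z Vz.
  apply: (@continuous_comp _ _ _ f nc); first exact: cf.
  exact: nc_continuous.
exact: (measurableT_comp (measurable_powR p) mh).
Qed.

Lemma measurable_nc_powe V p f : open V -> cont_in V f ->
  measurable_fun (plane V) (fun w => (nc (f (pt w)) `^ p)%:E : \bar R).
Proof. by move=> oV cf; apply/measurable_EFinP; exact: measurable_nc_pow. Qed.

Lemma powR_nc_ge0 p f z : (0 <= (nc (f z) `^ p)%:E :> \bar R)%E.
Proof. by rewrite lee_fin powR_ge0. Qed.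

(** The sum is at most twice the larger term; this serves [p < 1] and [p >= 1] alike. *)
Lemma powR_sum_le (x y p : R) : 0 < p -> 0 <= x -> 0 <= y ->
  (x + y) `^ p <= 2 `^ p * (x `^ p + y `^ p).
Proof.
move=> p0 x0 y0; have p0' := ltW p0.
wlog xy : x y x0 y0 / x <= y.
  move=> W; have [xy|/ltW yx] := leP x y; first exact: W.
  by rewrite addrC [X in _ * X]addrC; exact: W.
apply: (@le_trans _ _ ((2 * y) `^ p)).
  by apply: ge0_ler_powR; rewrite ?nnegrE ?addr_ge0 ?mulr_ge0//; lra.
rewrite powRM// ler_wpM2l ?powR_ge0// lerDr; exact: powR_ge0.
Qed.

Lemma integral_pow_add V p f g : 0 < p -> open V -> cont_in V f -> cont_in V g ->
  (integral_pow V p f < +oo)%E -> (integral_pow V p g < +oo)%E ->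
  (integral_pow V p (fun z => (f z + g z : Cplx R)%R) < +oo)%E.
Proof.
move=> p0 oV cf cg If Ig; have mV := measurable_plane oV.
have mf := measurable_nc_powe p oV cf; have mg := measurable_nc_powe p oV cg.
have cfg : cont_in V (fun z => f z + g z : Cplx R).
  move=> z Vz; exact: (@continuousD _ _ _ f g z (cf z Vz) (cg z Vz)).
have f0 (w : T2) : plane V w -> (0 <= (nc (f (pt w)) `^ p)%:E)%E by move=> _; exact: powR_nc_ge0.
have g0 (w : T2) : plane V w -> (0 <= (nc (g (pt w)) `^ p)%:E)%E by move=> _; exact: powR_nc_ge0.
have fg0 (w : T2) : plane V w ->
  (0 <= (nc (f (pt w)) `^ p)%:E + (nc (g (pt w)) `^ p)%:E)%E.
  by move=> Vw; rewrite adde_ge0 ?(f0 w) ?(g0 w).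
have mfg : measurable_fun (plane V)
  (fun w => (nc (f (pt w)) `^ p)%:E + (nc (g (pt w)) `^ p)%:E : \bar R)%E.
  exact: emeasurable_funD.
apply: (@le_lt_trans _ _ (\int[dxdy]_(w in plane V) ((2 `^ p)%:E *
   ((nc (f (pt w)) `^ p)%:E + (nc (g (pt w)) `^ p)%:E)))%E).
  apply: ge0_le_integral => //.
  - by move=> w _; exact: (@powR_nc_ge0 _ (fun z => f z + g z)).
  - exact: (measurable_nc_powe p oV cfg).
  - exact: measurable_funeM.
  - move=> w _; rewrite -EFinD -EFinM lee_fin.
    apply: le_trans (powR_sum_le p0 (nc_ge0 _) (nc_ge0 _)).
    by apply: ge0_ler_powR; rewrite ?nnegrE ?addr_ge0 ?nc_ge0 ?ncD// ltW.
rewrite (ge0_integralZl_EFin dxdy mV fg0 mfg (powR_ge0 _ _)).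
rewrite (ge0_integralD dxdy mV f0 mf g0 mg).
apply: lte_mul_pinfty; [by rewrite lee_fin powR_ge0|by []|].
by apply: lte_add_pinfty; [exact: If|exact: Ig].
Qed.

(** Pointwise [x ^ q <= 1 + x ^ p], and a bounded [V] has finite area. Thus the exponents of a
    sequence increasing to [q] decide membership in [OL_cap]. *)
Lemma integral_pow_mono V (p q : R) f : 0 < q -> q <= p -> open V -> bounded_set V ->
  cont_in V f -> (integral_pow V p f < +oo)%E -> (integral_pow V q f < +oo)%E.
Proof.
move=> q0 qp oV bV cf Ip; have mV := measurable_plane oV.
have mp := measurable_nc_powe p oV cf.
have f0 (w : T2) : plane V w -> (0 <= (nc (f (pt w)) `^ p)%:E)%E by move=> _; exact: powR_nc_ge0.
have c0 (w : T2) : plane V w -> (0 <= 1%:E :> \bar R)%E by move=> _; rewrite lee_fin.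
have mc : measurable_fun (plane V) (fun=> 1%:E : \bar R) by exact: measurable_cst.
apply: (@le_lt_trans _ _ (\int[dxdy]_(w in plane V) (1%:E + (nc (f (pt w)) `^ p)%:E))%E).
  apply: ge0_le_integral => //.
  - by move=> w _; exact: powR_nc_ge0.
  - exact: (measurable_nc_powe _ oV cf).
  - exact: emeasurable_funD.
  - move=> w _; rewrite -EFinD lee_fin; have [h1|h1] := leP 1 (nc (f (pt w))).
      by rewrite (le_trans (ler_powR h1 qp))// lerDr.
    rewrite (@le_trans _ _ 1)//; last by rewrite lerDl powR_ge0.
    have E1 : (1 : R) `^ q = 1 by rewrite powR1.
    rewrite -E1; apply: ge0_ler_powR; rewrite ?nnegrE ?nc_ge0//; exact: ltW.
rewrite (ge0_integralD dxdy mV c0 mc f0 mp) integral_cst// mul1e.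
by rewrite lte_add_pinfty//; exact: dxdy_plane_fin.
Qed.

Lemma geo_half_sum n : \sum_(0 <= k < n) (2 ^- k.+1 : R) = 1 - 2 ^- n.
Proof.
elim: n => [|n ih]; first by rewrite big_nil expr0 invr1 subrr.
rewrite big_nat_recr //= ih exprS; field.
exact: expf_neq0.
Qed.

(* If [2^(k+1) |a_k| <= t] for all [k] then [|sum a_k| <= t]: this replaces the
   triangle inequality of [L^p] for every [p > 0] at once. *)
Lemma powR_series_le p (u : nat -> Cplx R) (l : Cplx R) : 0 < p ->
  (\sum_(0 <= k < n) u k : Cplx R) @[n --> \oo] --> l ->
  ((nc l `^ p)%:E <= \sum_(k <oo) ((2 ^+ k.+1 * nc (u k)) `^ p)%:E)%E.
Proof.
move=> p0 ul; set S := (\sum_(k <oo) _)%E.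
have t0 k : (0 <= ((2 ^+ k.+1 * nc (u k)) `^ p)%:E)%E by rewrite lee_fin powR_ge0.
have S0 : (0 <= S)%E by apply: nneseries_ge0 => n _ _; exact: t0.
have [Sfin|] := ltP S +oo%E; last by rewrite leye_eq => /eqP ->; rewrite leey.
have SE : S = (fine S)%:E by rewrite fineK// ge0_fin_numE.
set t := fine S `^ p^-1.
have fS0 : 0 <= fine S by rewrite fine_ge0.
have tp : t `^ p = fine S by rewrite /t -powRrM mulVf ?lt0r_neq0// powRr1.
have ut k : nc (u k) <= t * 2 ^- k.+1.
  rewrite ler_pdivlMr ?exprn_gt0// mulrC.
  have : (2 ^+ k.+1 * nc (u k)) `^ p <= fine S.
    rewrite -lee_fin -SE.
    have := @nneseries_lim_ge R (fun k => ((2 ^+ k.+1 * nc (u k)) `^ p)%:E) xpredT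
      0%N k.+1 (fun n _ _ => t0 n).
    apply: le_trans; rewrite big_nat_recr //= leeDr// sume_ge0// => i _; exact: t0.
  move=> h; have pi0 : 0 <= p^-1 by rewrite invr_ge0 ltW.
  have m0 : 0 <= 2 ^+ k.+1 * nc (u k) by rewrite mulr_ge0 ?exprn_ge0 ?nc_ge0.
  have := @ge0_ler_powR R p^-1 pi0 _ _ _ _ h.
  rewrite !nnegrE powR_ge0 fS0 => /(_ isT isT).
  by rewrite -powRrM mulfV ?lt0r_neq0// powRr1.
have nl : nc l <= t.
  apply/ler_addgt0Pr => e e0.
  have /(cvgCP _)/(_ _ e0) n1 := ul.
  have [n hn] := filter_ex n1.
  set s := \sum_(0 <= k < n) u k in hn.
  have : nc l <= nc s + nc (s - l).
    have -> : nc l = nc (s - (s - l)) by congr Normc.normc; ring.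
    by rewrite (le_trans (ncD _ _))// ncN.
  move=> /le_trans; apply; rewrite lerD//; last exact: ltW.
  rewrite (le_trans (nc_sum _ _ _))//.
  apply: (@le_trans _ _ (\sum_(0 <= k < n) (t * 2 ^- k.+1))).
    by apply: ler_sum => k _; exact: ut.
  have tge0 : 0 <= t by exact: powR_ge0.
  rewrite -mulr_sumr geo_half_sum; apply: ler_piMr => //.
rewrite SE lee_fin -tp; apply: ge0_ler_powR; rewrite ?nnegrE ?nc_ge0 ?powR_ge0//.
exact: ltW.
Qed.

Lemma integral_pow_series V p (F : nat -> Cplx R -> Cplx R) f (e : nat -> \bar R) :
  0 < p -> open V -> (forall k, cont_in V (F k)) -> cont_in V f ->
  (forall z, V z -> (\sum_(0 <= k < n) F k z : Cplx R) @[n --> \oo] --> f z) ->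
  (forall k, (((2 ^+ k.+1) `^ p)%:E * integral_pow V p (F k) <= e k)%E) ->
  (integral_pow V p f <= \sum_(k <oo) e k)%E.
Proof.
move=> p0 oV cF cf Ff he; have mV := measurable_plane oV.
pose G k (w : T2) : \bar R := (((2 ^+ k.+1) `^ p)%:E * (nc (F k (pt w)) `^ p)%:E)%E.
have G0 k w : (0 <= G k w)%E by rewrite mule_ge0// lee_fin powR_ge0.
have mF k := measurable_nc_powe p oV (cF k).
have mG k : measurable_fun (plane V) (G k) by exact: measurable_funeM.
apply: (@le_trans _ _ (\int[dxdy]_(w in plane V) (\sum_(k <oo) G k w))%E).
  apply: ge0_le_integral => //.
  - by move=> w _; exact: powR_nc_ge0.
  - exact: (measurable_nc_powe _ oV cf).
  - have := @ge0_emeasurable_sum _ T2 R (plane V) G xpredT.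
    by apply=> [k w _ _|k _]; [exact: G0|exact: mG].
  - move=> w Vw; apply: le_trans (powR_series_le p0 (Ff _ Vw)) _.
    apply: lee_nneseries => [k _ _|k _]; first by rewrite lee_fin powR_ge0.
    by rewrite /G -EFinM lee_fin powRM ?exprn_ge0 ?nc_ge0.
rewrite integral_nneseries//; apply: lee_nneseries => k _.
  by move=> _; apply: integral_ge0 => w _; exact: G0.
apply: le_trans (he k).
have F0 (w : T2) : plane V w -> (0 <= (nc (F k (pt w)) `^ p)%:E)%E by move=> _; exact: powR_nc_ge0.
by rewrite /G (ge0_integralZl_EFin dxdy mV F0 (mF k) (powR_ge0 _ _)).
Qed.

Lemma integral_powZ V p (c : Cplx R) f : 0 < p -> open V -> cont_in V f ->
  integral_pow V p (fun z => c * f z) = ((nc c `^ p)%:E * integral_pow V p f)%E.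
Proof.
move=> p0 oV cf; have mV := measurable_plane oV.
have F0 (w : T2) : plane V w -> (0 <= (nc (f (pt w)) `^ p)%:E)%E by move=> _; exact: powR_nc_ge0.
rewrite [RHS](_ : _ = (\int[dxdy]_(w in plane V) ((nc c `^ p)%:E * (nc (f (pt w)) `^ p)%:E))%E).
  apply: eq_integral => w _; rewrite -EFinM -powRM ?nc_ge0//.
  by congr (EFin (powR _ p)); exact: ncM.
by rewrite (ge0_integralZl_EFin dxdy mV F0 (measurable_nc_powe p oV cf) (powR_ge0 _ _)).
Qed.

End Lp.

(** * Functions with a singularity on the boundary *)

Section log_potential.
Context {R : realType}.
Implicit Types (x y s t : R) (u z a b : Cplx R).
Local Notation Re := (@complex.Re R).
Local Notation Im := (@complex.Im R).
Local Notation mu := (@lebesgue_measure R).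

(* [logpot u] is the branch of [log ((1 - u) / (- u))] on the complement of the
   segment [[0, 1]]. *)
Definition logpot u : Cplx R := cint 0 1 (fun t => (t%:C%C - u)^-1).

Definition off_segment u := ~ (Im u = 0 /\ 0 <= Re u <= 1).

Lemma off_segment_dist u : off_segment u -> exists2 d : R, 0 < d &
  forall t, 0 <= t <= 1 -> 2 * d <= nc (t%:C%C - u).
Proof.
move=> hu; have [iu|iu] := eqVneq (Im u) 0; last first.
  exists (`|Im u| / 2); first by rewrite divr_gt0// normr_gt0.
  move=> t _; rewrite mulrC divfK//; apply: le_trans (Im_le_nc _).
  by rewrite ImB /= sub0r normrN.
have [u0|u0] := ltP (Re u) 0.
  exists (- Re u / 2); first by rewrite divr_gt0// oppr_gt0.
  move=> t /andP[t0 _]; rewrite mulrC divfK//; apply: le_trans (Re_le_nc _).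
  by rewrite ReB /= (le_trans _ (ler_norm _))// lerDr.
have [u1|u1] := ltP 1 (Re u); last by exfalso; apply: hu; rewrite u0 u1.
exists ((Re u - 1) / 2); first by rewrite divr_gt0// subr_gt0.
move=> t /andP[_ t1]; rewrite mulrC divfK//; apply: le_trans (Re_le_nc _).
by rewrite ReB /= distrC (le_trans _ (ler_norm _))// lerD2l lerN2.
Qed.

(** [logpot] is the Cauchy transform of the constant 1 on the segment, so the expansion used for
    rectangles applies. *)
Lemma derivable_logpot u : off_segment u -> derivable logpot u 1.
Proof.
move=> /off_segment_dist[d d0 hd].
have c1 : cont_on unit_segment (fun=> 1 : Cplx R).
  by move=> z _; apply: derivable_continuousC; exact: derivable_cstC.
have n1 z : unit_segment z -> nc (1 : Cplx R) <= 1.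
  by move=> _; rewrite nc1.
have hS z : unit_segment z -> 2 * d <= nc (z - u).
  by move=> [t /itvccP t01 <-]; exact: hd.
have [D _ hD] := cauchy_transform_quadratic (@unit_segment_functional R) c1 n1 d0 hS.
apply: (quadratic_deriv d0 (D := D) (C := 2 * (1 / (4 * d ^+ 3)))) => h /hD.
have E v : cint 0 1 (fun t => 1 * (t%:C%C - v)^-1) = logpot v.
  by apply: eq_cint => t _; rewrite mul1r.
by rewrite !E.
Qed.

Lemma sq_dist_gt0 u t : off_segment u -> 0 <= t <= 1 ->
  0 < (t - Re u) ^+ 2 + (Im u) ^+ 2.
Proof.
move=> hu ht; rewrite lt_neqAle addr_ge0 ?sqr_ge0// andbT eq_sym.
rewrite paddr_eq0 ?sqr_ge0// !sqrf_eq0 subr_eq0; apply/negP => /andP[/eqP tu /eqP iu].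
by apply: hu; rewrite -tu.
Qed.

Lemma ln_sqrt x : 0 < x -> ln (Num.sqrt x) = ln x / 2.
Proof.
move=> x0; rewrite -[in RHS](sqr_sqrtr (ltW x0)) lnXn ?sqrtr_gt0//.
by rewrite mulr2n; field.
Qed.

Lemma cont_kernel u : off_segment u -> cont_itv 0 1 (fun t => (t%:C%C - u)^-1).
Proof.
move=> /off_segment_dist[d d0 hd] t /hd td.
have tu : t%:C%C != u.
  by rewrite -subr_eq0 -nc_gt0 (lt_le_trans _ td)// mulr_gt0.
apply: (@cont_comp _ (fun t => t%:C%C) (fun z => (z - u)^-1)).
  exact: horiz_continuous.
by apply: derivable_continuousC; exact: derivable_inv_sub.
Qed.

(** The integrand has the primitive [ln |t - u|], written as half the logarithm of the square to be
    differentiable by the usual rules. *)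
Lemma Re_logpot u : off_segment u ->
  Re (logpot u) = ln (nc (1 - u)) - ln (nc u).
Proof.
move=> hu; rewrite /logpot /cint /=.
pose q (t : R) := (t - Re u) ^+ 2 + (Im u) ^+ 2.
pose F (t : R) := ln (q t) / 2.
have dF (t : R) : 0 <= t <= 1 -> is_derive t (1 : R) F (Re ((t%:C%C - u)^-1)).
  move=> ht; have q0 : 0 < q t by exact: sq_dist_gt0.
  rewrite (inv_subE t 0 u) /= sub0r sqrrN -/(q t).
  have dq : is_derive t (1 : R) q ((t - Re u) *+ 2).
    apply: is_derive_eq; rewrite /GRing.scale /=; ring.
  have dl : is_derive (q t) (1 : R) (@ln R) (q t)^-1 by exact: is_derive1_ln.
  have dc : is_derive t (1 : R) (@ln R \o q) ((q t)^-1 * ((t - Re u) *+ 2)).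
    exact: is_derive1_comp.
  have -> : F = 2^-1 \*: (@ln R \o q) by apply/funext => s; rewrite /F mulrC.
  apply: is_derive_eq; rewrite /GRing.scale /= mulr2n; field.
  exact: lt0r_neq0.
have cR (t : R) : 0 <= t <= 1 -> {for t, continuous (fun t : R => Re ((t%:C%C - u)^-1))}.
  move=> ht; apply: (@continuous_comp _ _ _ (fun t : R => (t%:C%C - u)^-1 : Cplx R) Re).
    exact: cont_kernel.
  exact: Re_continuous.
rewrite (rint_FTC ltr01 cR dF) /F /q.
have E z : 0 < Re z ^+ 2 + Im z ^+ 2 ->
    ln (nc z) = ln (Re z ^+ 2 + Im z ^+ 2) / 2.
  by move=> z0; rewrite -ln_sqrt//; case: z z0.
rewrite E; last first.
  by rewrite ReB ImB /= sub0r sqrrN; apply: sq_dist_gt0; rewrite // ler01 lexx.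
rewrite E; last first.
  have : 0 < (0 - Re u) ^+ 2 + Im u ^+ 2 by apply: sq_dist_gt0; rewrite // ler01 lexx.
  by rewrite sub0r sqrrN.
by rewrite ReB ImB /= !sub0r !sqrrN.
Qed.

(** For [u] off the real axis the integral is a difference of two arctangents; for real [u] the
    integrand is real. *)
Lemma Im_logpot_le u : off_segment u -> `|Im (logpot u)| <= pi.
Proof.
move=> hu; rewrite /logpot /cint /=.
have [u0|u0] := eqVneq (Im u) 0.
  rewrite (_ : Rintegral _ _ _ = \int[mu]_(t in `[0, 1]) (0 : R)).
    by rewrite Rintegral_cst//= mul0r normr0 pi_ge0.
  by apply: eq_Rintegral => t _; rewrite (inv_subE t 0 u) /= u0 subr0 mul0r.
pose F (t : R) := atan ((t - Re u) / Im u).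
have dF (t : R) : 0 <= t <= 1 -> is_derive t (1 : R) F (Im ((t%:C%C - u)^-1)).
  move=> ht; rewrite (inv_subE t 0 u) /= sub0r sqrrN subr0.
  pose g (t : R) := (t - Re u) / Im u.
  have dg : is_derive t (1 : R) g (Im u)^-1.
    have -> : g = (Im u)^-1 \*: (fun t => t - Re u).
      by apply/funext => s; rewrite /g mulrC.
    by apply: is_derive_eq; rewrite /GRing.scale /= subr0 mulr1.
  have dc : is_derive t (1 : R) (@atan R \o g) ((1 + g t ^+ 2)^-1 * (Im u)^-1).
    by apply: is_derive1_comp; exact: is_derive1_atan.
  have -> : Im u / ((t - Re u) ^+ 2 + Im u ^+ 2) = (1 + g t ^+ 2)^-1 * (Im u)^-1.
    have n1 : (t - Re u) ^+ 2 + Im u ^+ 2 != 0 by apply/lt0r_neq0/sq_dist_gt0.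
    have n2 : Im u ^+ 2 + (t - Re u) ^+ 2 != 0 by rewrite addrC.
    by rewrite /g; field; rewrite u0 ?n1 ?n2.
  exact: dc.
have cR (t : R) : 0 <= t <= 1 -> {for t, continuous (fun t : R => Im ((t%:C%C - u)^-1))}.
  move=> ht; apply: (@continuous_comp _ _ _ (fun t : R => (t%:C%C - u)^-1 : Cplx R) Im).
    exact: cont_kernel.
  exact: Im_continuous.
rewrite (rint_FTC ltr01 cR dF) /F (le_trans (ler_normB _ _))//.
have A (x : R) : `|atan x| <= pi / 2.
  by rewrite ler_norml (ltW (atan_gtNpi2 _)) (ltW (atan_ltpi2 _)).
by rewrite [leRHS]splitr lerD.
Qed.

Lemma derivable_comp_affine (f : Cplx R -> Cplx R) (c d z : Cplx R) :
  derivable f (c * z + d) 1 -> derivable (fun w => f (c * w + d)) z 1.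
Proof.
move=> /derivableCP[D hD]; apply/derivableCP; exists (c * D) => e e0.
have c0 : 0 < nc c + 1 by rewrite ltr_wpDl ?nc_ge0.
have [r r0 hr] := hD _ (divr_gt0 e0 c0).
exists (r / (nc c + 1)); first exact: divr_gt0.
move=> h hlt.
have ch : nc (c * h) <= (nc c + 1) * nc h by rewrite ncM ler_wpM2r ?nc_ge0// lerDl.
have chr : nc (c * h) < r.
  by rewrite (le_lt_trans ch)// mulrC -ltr_pdivlMr.
have -> : c * (z + h) + d = c * z + d + c * h by ring.
have -> : h * (c * D) = c * h * D by ring.
rewrite (le_trans (hr _ chr))// -mulrA ler_pM2l// mulrC ler_pdivrMr//.
by rewrite [leRHS]mulrC.
Qed.

End log_potential.

(** * Functions unbounded at a prescribed boundary point *)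

Section singular_functions.
Context {R : realType}.
Implicit Types (O V Y : set (Cplx R)) (f g : Cplx R -> Cplx R) (z a b : Cplx R) (p : R).
Local Notation Re := (@complex.Re R).
Local Notation Im := (@complex.Im R).

Definition zero_outside O f : Cplx R -> Cplx R := fun z => if `[< O z >] then f z else 0.

Lemma zero_outside_in O f z : O z -> zero_outside O f z = f z.
Proof. by move=> Oz; rewrite /zero_outside; case: asboolP. Qed.

Lemma zero_outside_out O f z : ~ O z -> zero_outside O f z = 0.
Proof. by move=> Oz; rewrite /zero_outside; case: asboolP. Qed.

Lemma holomorphic_zero_outside O f : open O -> holomorphic O f ->
  holomorphic O (zero_outside O f).
Proof.
move=> oO; apply: holomorphic_eq => // z; rewrite inE => Oz.
by rewrite zero_outside_in.
Qed.

Lemma holomorphic_cont O V f : V `<=` O -> holomorphic O f -> cont_in V f.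
Proof. by move=> VO hf z /VO/hf; exact: derivable_continuousC. Qed.

Lemma eq_integral_pow V p f g : (forall z, V z -> f z = g z) ->
  integral_pow V p f = integral_pow V p g.
Proof.
move=> fg; rewrite !integral_powE; apply: eq_integral => w; rewrite inE => Vw.
by rewrite fg.
Qed.

Lemma integral_pow_bounded V p f (M : R) : 0 < p -> open V -> bounded_set V ->
  cont_in V f -> (forall z, V z -> nc (f z) <= M) -> (integral_pow V p f < +oo)%E.
Proof.
move=> p0 oV bV cf fM; have mV := measurable_plane oV.
rewrite integral_powE.
apply: (@le_lt_trans _ _ (\int[dxdy]_(w in plane V) (cst ((Num.max M 0) `^ p)%:E) w)%E).
  apply: ge0_le_integral => //.
  - by move=> w _; exact: powR_nc_ge0.
  - exact: (measurable_nc_powe _ oV cf).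
  - move=> w Vw; rewrite lee_fin; apply: ge0_ler_powR; rewrite ?nnegrE ?nc_ge0 ?(ltW p0)//.
      by rewrite le_max lexx orbT.
    by rewrite le_max fM.
rewrite integral_cst//; apply: lte_mul_pinfty; rewrite ?lee_fin ?powR_ge0//.
exact: dxdy_plane_fin.
Qed.

Lemma singular_off_closure O V Y a : open V -> bounded_set V -> V `<=` O ->
  ~ O a -> ~ closure V a -> closure Y a -> Y `<=` O ->
  exists g, [/\ holomorphic O g, unbounded_on g Y &
    forall p, 0 < p -> (integral_pow V p g < +oo)%E].
Proof.
move=> oV bV VO nOa nVa cYa YO.
pose g z : Cplx R := (z - a)^-1.
have neq z : O z -> z != a by move=> Oz; apply/eqP => e; apply: nOa; rewrite -e.
have hg : holomorphic O g by move=> z Oz; apply: derivable_inv_sub; exact: neq.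
exists g; split=> //.
  move=> M; pose e := (Num.max M 0 + 1)^-1.
  have m0 : 0 < Num.max M 0 + 1 by rewrite ltr_wpDl// le_max lexx orbT.
  have e0 : 0 < e by rewrite invr_gt0.
  have [z Yz za] := (closureCP _ _).1 cYa e e0; exists z => //.
  have za0 : 0 < nc (z - a) by rewrite nc_gt0 subr_eq0 neq//; exact: YO.
  rewrite ncV; apply: (@lt_trans _ _ (Num.max M 0 + 1)).
    by rewrite (@le_lt_trans _ _ (Num.max M 0))// ?le_max ?lexx// ltrDl.
  by rewrite -[ltLHS]invrK ltf_pV2// posrE.
move=> p p0; have [d d0 hd] : exists2 d : R, 0 < d & forall z, V z -> d <= nc (z - a).
  apply: contrapT => H; apply: nVa; apply/closureCP => e e0; apply: contrapT => H'.
  apply: H; exists e => // z Vz; rewrite leNgt; apply/negP => ze; apply: H'.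
  by exists z.
apply: (@integral_pow_bounded V p g d^-1 p0 oV bV (holomorphic_cont VO hg)).
by move=> z /hd dz; rewrite ncV lef_pV2 ?posrE// (lt_le_trans d0).
Qed.

(** Apply [ln x < x] to [t] or to [t ^ (- s)]. The free exponent [s] is later adapted to [p]. *)
Lemma abs_ln_le (s t : R) : 0 < s -> 0 < t -> `|ln t| <= s^-1 * t `^ (- s) + t.
Proof.
move=> s0 t0; have ts0 : 0 < t `^ (- s) by exact: powR_gt0.
have si : 0 < s^-1 by rewrite invr_gt0.
have [t1|t1] := leP 1 t.
  rewrite ger0_norm ?ln_ge0// (le_trans (ltW (ln_sublinear t0)))// lerDr.
  by rewrite mulr_ge0// ltW.
rewrite ler0_norm ?ln_le0 ?(ltW t1)//.
have -> : - ln t = s^-1 * ln (t `^ (- s)) by rewrite ln_powR mulrA mulrN mulVf ?lt0r_neq0// mulN1r.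
rewrite (@le_trans _ _ (s^-1 * t `^ (- s)))//; last by rewrite lerDl ltW.
by rewrite ler_pM2l// ltW// ln_sublinear.
Qed.

Lemma powR_sum3_le (x y w p : R) : 0 < p -> 0 <= x -> 0 <= y -> 0 <= w ->
  (x + y + w) `^ p <= (2 `^ p * 2 `^ p) * (x `^ p + y `^ p + w `^ p).
Proof.
move=> p0 x0 y0 w0; have p2 : 1 <= (2 : R) `^ p.
  by rewrite -[leLHS](powRr0 2) ler_powR ?ler1n// ltW.
rewrite (le_trans (powR_sum_le p0 (addr_ge0 x0 y0) w0))// -mulrA.
rewrite ler_wpM2l ?powR_ge0// mulrDr lerD//; first exact: powR_sum_le.
by rewrite ler_peMl ?powR_ge0.
Qed.

Lemma segmentP a b z : segment a b z <->
  exists t : R, 0 <= t <= 1 /\ z = (1 - t)%:C%C * a + t%:C%C * b.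
Proof.
split=> [[t /itvccP t01 <-]|[t [t01 ->]]]; first by exists t.
by exists t => //=; rewrite in_itv.
Qed.

(** The similarity sending [a] to 0 and [b] to 1 carries the segment to [[0, 1]]. *)
Lemma off_segment_quotient a b z : b != a -> ~ segment a b z ->
  off_segment ((b - a)^-1 * z - (b - a)^-1 * a).
Proof.
move=> ba nz [u0 u1]; apply: nz; apply/segmentP.
set u := (b - a)^-1 * z - (b - a)^-1 * a in u0 u1.
have uE : u = (Re u)%:C%C by rewrite [LHS]complexE u0 mulr0 addr0.
exists (Re u); split=> //.
have ba0 : b - a != 0 by rewrite subr_eq0.
have E1 : (1 - Re u)%:C%C = 1 - (Re u)%:C%C :> Cplx R by exact: rmorphB.
rewrite E1 -uE /u -mulrBr.
have -> : (1 - (b - a)^-1 * (z - a)) * a + (b - a)^-1 * (z - a) * b =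
  a + (z - a) * ((b - a)^-1 * (b - a)) by ring.
by rewrite mulVf// mulr1 addrC subrK.
Qed.

(* The logarithm of [(z - b) / (z - a)] is in every [L^p]. *)
Lemma singular_on_closure O V Y a b : open V -> bounded_set V -> V `<=` O ->
  b != a -> segment a b `<=` ~` O -> closure Y a -> Y `<=` O ->
  exists g, [/\ holomorphic O g, unbounded_on g Y &
    forall p, 0 < p -> (integral_pow V p g < +oo)%E].
Proof.
move=> oV bV VO ba sO cYa YO.
have ba0 : b - a != 0 by rewrite subr_eq0.
pose c := nc (b - a); have c0 : 0 < c by rewrite nc_gt0.
pose u z : Cplx R := (b - a)^-1 * z + - ((b - a)^-1 * a).
have offu z : O z -> off_segment (u z).
  by move=> Oz; apply: off_segment_quotient => // /sO.
pose g z := logpot (u z).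
have hg : holomorphic O g.
  move=> z Oz; apply: (@derivable_comp_affine _ logpot ((b - a)^-1) (- ((b - a)^-1 * a)) z).
  by apply: derivable_logpot; exact: offu.
have ncu z : nc (u z) = nc (z - a) / c.
  by rewrite /u -mulrBr ncM ncV mulrC.
have nc1u z : nc (1 - u z) = nc (z - b) / c.
  have -> : 1 - u z = (b - a)^-1 * (b - z).
    by rewrite /u -{1}(mulVf ba0); ring.
  by rewrite ncM ncV mulrC ncB.
have aO : ~ O a.
  apply: sO; apply/segmentP; exists 0; rewrite lexx ler01; split=> //.
  by rewrite subr0 mul1r mul0r addr0.
have bO : ~ O b.
  apply: sO; apply/segmentP; exists 1; rewrite lexx ler01; split=> //.
  by rewrite subrr mul1r mul0r add0r.
have za z : O z -> 0 < nc (z - a).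
  by move=> Oz; rewrite nc_gt0 subr_eq0; apply/eqP => e; apply: aO; rewrite -e.
have zb z : O z -> 0 < nc (z - b).
  by move=> Oz; rewrite nc_gt0 subr_eq0; apply/eqP => e; apply: bO; rewrite -e.
exists g; split=> //.
  (* The first bound gives [|1 - u| >= 1 / 2], so that its logarithm is at least -1; the second
     makes [- ln |u|] exceed [M + 1]. *)
  move=> M; pose e := Num.min (2^-1) (expR (- (M + 1))).
  have e0 : 0 < e by rewrite lt_min invr_gt0 ltr0n expR_gt0.
  have [z Yz zae] := (closureCP _ _).1 cYa (e * c) (mulr_gt0 e0 c0).
  exists z => //; have Oz := YO z Yz.
  have ue : nc (u z) < e by rewrite ncu ltr_pdivrMr.
  have u0 : 0 < nc (u z) by rewrite ncu divr_gt0// za.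
  move: ue; rewrite lt_min => /andP[u2 uM].
  have l1 : ln (nc (u z)) < - (M + 1) by rewrite -ltr_expR lnK ?posrE.
  have h1u : 2^-1 <= nc (1 - u z).
    by have := ncB_ge 1 (u z); rewrite nc1; lra.
  have l2 : -1 <= ln (nc (1 - u z)).
    rewrite (@le_trans _ _ (ln (2^-1)))//; last first.
      by rewrite ler_ln ?posrE// ?invr_gt0// (lt_le_trans _ h1u)// invr_gt0.
    have ln2 : ln (1 + 1 : R) <= 1 by apply: le_ln1Dx; lra.
    by rewrite lnV ?posrE// lerN2.
  apply: lt_le_trans (Re_le_nc _); apply: lt_le_trans (ler_norm _).
  by rewrite /g (Re_logpot (offu z Oz)); lra.
(* With this [s] the p-th power of [|u| ^ (- s)] is [|u| ^ (- 1 / 2)], whatever [p] is. *)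
move=> p p0; pose s := (2 * p)^-1.
have s0 : 0 < s by rewrite invr_gt0 mulr_gt0.
have [L L0 VL] := plane_bounded bV.
have zL z : V z -> nc z <= 2 * L.
  move=> Vz; have := VL (Re z, Im z); rewrite /plane /= => h.
  have /h[/=] : V (pt (Re z, Im z)) by rewrite /pt /=; case: (z) Vz.
  rewrite !in_itv /= -!ler_norml => h1 h2; apply: (le_trans (nc_le_ReIm z)).
  by rewrite mulr_natl mulr2n lerD.
pose U := (2 * L + nc a + nc b) / c.
have U0 : 0 <= U by rewrite divr_ge0 ?addr_ge0 ?nc_ge0 ?mulr_ge0// ltW.
have uU z : V z -> nc (u z) <= U.
  move=> /zL h; rewrite ncu ler_pdivrMr// divfK ?lt0r_neq0//.
  rewrite (le_trans (ncD _ _))// ncN.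
  by have := nc_ge0 b; lra.
have u1U z : V z -> nc (1 - u z) <= U.
  move=> /zL h; rewrite nc1u ler_pdivrMr// divfK ?lt0r_neq0//.
  rewrite (le_trans (ncD _ _))// ncN.
  by have := nc_ge0 a; lra.
(* [pi] bounds the imaginary part, and each logarithm adds the linear term of [abs_ln_le], at most
   [U]. *)
pose K : R := pi + 2 * U.
have K0 : 0 <= K by apply: addr_ge0; [exact: pi_ge0|exact: mulr_ge0].
have gle z : V z -> nc (g z) <=
    K + s^-1 * nc (u z) `^ (- s) + s^-1 * nc (1 - u z) `^ (- s).
  move=> Vz; have Oz := VO z Vz.
  have u0 : 0 < nc (u z) by rewrite ncu divr_gt0// za.
  have u10 : 0 < nc (1 - u z) by rewrite nc1u divr_gt0// zb.
  have := abs_ln_le s0 u0; have := abs_ln_le s0 u10.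
  have := uU z Vz; have := u1U z Vz; have := Im_logpot_le (offu z Oz).
  have := nc_le_ReIm (g z); rewrite /g (Re_logpot (offu z Oz)) /K.
  have := ler_normB (ln (nc (1 - u z))) (ln (nc (u z))).
  lra.
have powE (x y : R) : 0 <= x -> (s^-1 * (x / c) `^ (- s)) `^ p =
    (s^-1 `^ p * (c^-1) `^ (- 2^-1)) * x `^ (- 2^-1).
  move=> x0; have si : 0 <= s^-1 by rewrite invr_ge0 ltW.
  have ci : 0 <= c^-1 by rewrite invr_ge0 ltW.
  rewrite (powRM p si (powR_ge0 _ _)) -powRrM.
  have -> : - s * p = - 2^-1.
    by rewrite /s invfM mulNr mulrAC -mulrA (mulrC p) mulVf ?lt0r_neq0// mulr1.
  by rewrite (powRM _ x0 ci); ring.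
pose B := (2 `^ p * 2 `^ p) * (s^-1 `^ p * (c^-1) `^ (- 2^-1)).
pose A := (2 `^ p * 2 `^ p) * K `^ p.
apply: (@finite_integral_weak_singularities _ V (fun z => nc (g z) `^ p) a b A B) => //.
- by move=> /VO.
- by move=> /VO.
- by rewrite !mulr_ge0 ?powR_ge0.
- by rewrite !mulr_ge0 ?powR_ge0.
- exact: (measurable_nc_pow p oV (holomorphic_cont VO hg)).
- by move=> z _; exact: powR_ge0.
move=> z Vz.
have x0 : 0 <= s^-1 * nc (u z) `^ (- s) by rewrite mulr_ge0 ?powR_ge0// invr_ge0 ltW.
have y0 : 0 <= s^-1 * nc (1 - u z) `^ (- s) by rewrite mulr_ge0 ?powR_ge0// invr_ge0 ltW.
apply: (@le_trans _ _ ((K + s^-1 * nc (u z) `^ (- s) + s^-1 * nc (1 - u z) `^ (- s)) `^ p)).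
  apply: (ge0_ler_powR (ltW p0)); rewrite ?nnegrE ?nc_ge0//; last exact: gle.
  by apply: addr_ge0 => //; exact: addr_ge0.
apply: (le_trans (powR_sum3_le p0 K0 x0 y0)).
rewrite ncu nc1u (powE _ 0 (nc_ge0 _)) (powE _ 0 (nc_ge0 _)) /A /B.
by rewrite le_eqVlt; apply/orP; left; apply/eqP; ring.
Qed.

(** The only place where the segments in the complement are used: they are needed just when [a] is
    in the closure of [V]. *)
Lemma exists_singular O V Y a : open O -> open V -> bounded_set V -> V `<=` O ->
  (forall a, (closure V `&` boundary O) a ->
     exists b, [/\ (~` O) b, b <> a & segment a b `<=` ~` O]) ->
  ~ O a -> closure Y a -> Y `<=` O ->
  exists g, [/\ holomorphic O g, (forall z, ~ O z -> g z = 0), unbounded_on g Y &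
    forall p, 0 < p -> (integral_pow V p g < +oo)%E].
Proof.
move=> oO oV bV VO hV nOa cYa YO.
suff [g [hg ug Ig]] : exists g, [/\ holomorphic O g, unbounded_on g Y &
    forall p, 0 < p -> (integral_pow V p g < +oo)%E].
  exists (zero_outside O g); split.
  - exact: holomorphic_zero_outside.
  - by move=> z; exact: zero_outside_out.
  - by move=> M; have [z Yz Mz] := ug M; exists z => //; rewrite zero_outside_in//; exact: YO.
  - move=> p p0; rewrite (@eq_integral_pow _ _ _ g) ?Ig// => z Vz.
    by rewrite zero_outside_in//; exact: VO.
have [cVa|ncVa] := pselect (closure V a); last exact: (@singular_off_closure O V Y a).
have bOa : boundary O a.
  apply/boundary_open => //; split=> //; apply/closureCP => e e0.
  by have [z Yz za] := (closureCP _ _).1 cYa e e0; exists z => //; exact: YO.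
have [b [_ ba sab]] := hV a (conj cVa bOa).
by apply: (@singular_on_closure O V Y a b) => //; exact/eqP.
Qed.

End singular_functions.

(** * The metrics *)

Section metrics.
Context {R : realType}.
Implicit Types (d : nat -> R) (O V : set (Cplx R)) (f g : Cplx R -> Cplx R) (p : R).

Definition wterm d m : R := 2 ^- m * (d m / (1 + d m)).

Lemma wterm_ge0 d m : 0 <= d m -> 0 <= wterm d m.
Proof.
by move=> d0; rewrite mulr_ge0 ?divr_ge0 ?addr_ge0// invr_ge0 exprn_ge0.
Qed.

Lemma wterm_le1 d m : 0 <= d m -> wterm d m <= 2 ^- m.
Proof.
move=> d0; have d1 : 0 < 1 + d m by rewrite ltr_wpDr.
by rewrite ler_piMr ?invr_ge0 ?exprn_ge0// ler_pdivrMr// mul1r lerDr.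
Qed.

Lemma wterm_led d m : 0 <= d m -> wterm d m <= 2 ^- m * d m.
Proof.
move=> d0; have d1 : 0 < 1 + d m by rewrite ltr_wpDr.
by rewrite ler_wpM2l ?invr_ge0 ?exprn_ge0// ler_pdivrMr// ler_peMr// lerDl.
Qed.

(** The first [N] terms are charged to [e], the others to their weights. The geometric sums are kept
    exact for the induction on [n]. *)
Lemma wsum_partial_le d N (e : R) n : (forall m, 0 <= d m) -> 0 <= e ->
  (forall m, (1 <= m <= N)%N -> d m <= e) ->
  \sum_(1 <= m < n.+1) wterm d m <=
    e * (1 - 2 ^- n) + (if (n <= N)%N then 0 else 2 ^- N - 2 ^- n).
Proof.
move=> d0 e0 de; elim: n => [|n ih].
  by rewrite big_geq// expr0 invr1 subrr mulr0 addr0.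
have h2 : (2 : R) ^- n = 2 * 2 ^- n.+1.
  by rewrite exprS invfM mulrA mulfV ?mul1r ?pnatr_eq0.
have q0 : 0 <= (2 : R) ^- n.+1 by rewrite invr_ge0 exprn_ge0.
rewrite big_nat_recr //=; move: ih; rewrite h2.
case: (leqP n.+1 N) => nN.
  rewrite (ltnW nN) !addr0 => ih.
  have := wterm_led (d0 n.+1).
  have : 2 ^- n.+1 * d n.+1 <= 2 ^- n.+1 * e by rewrite ler_wpM2l// de.
  by move: (2 ^- n.+1) ih q0 => q; lra.
have := wterm_le1 (d0 n.+1).
have eq0 : 0 <= e * 2 ^- n.+1 by rewrite mulr_ge0.
case: ifP => nN' ih.
  have nE : n = N by apply/eqP; rewrite eqn_leq nN' -ltnS nN.
  rewrite -nE h2; move: ih eq0; move: (2 ^- n.+1) q0 => q; lra.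
by move: ih eq0; move: (2 ^- n.+1) q0 => q; lra.
Qed.

Lemma wsum_partial_bound d N (e : R) n : (forall m, 0 <= d m) -> 0 <= e ->
  (forall m, (1 <= m <= N)%N -> d m <= e) ->
  \sum_(1 <= m < n) wterm d m <= e + 2 ^- N.
Proof.
move=> d0 e0 de; have q0 k : 0 <= (2 : R) ^- k by rewrite invr_ge0 exprn_ge0.
case: n => [|n]; first by rewrite big_geq// addr_ge0.
rewrite (le_trans (wsum_partial_le n d0 e0 de))// lerD//.
  by rewrite ler_piMr// gerBl.
by case: ifP => // _; rewrite gerBl.
Qed.

Lemma wsum_cvg d : (forall m, 0 <= d m) ->
  cvgn (fun N => \sum_(1 <= m < N) wterm d m).
Proof.
move=> d0; apply: nondecreasing_is_cvgn.
  apply/nondecreasing_seqP => -[|n]; first by rewrite !big_geq.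
  by rewrite [leRHS]big_nat_recr //= lerDl wterm_ge0.
exists (0 + 2 ^- 0) => _ [n _ <-]; apply: wsum_partial_bound => // m.
by case: m.
Qed.

Lemma weighted_sum_ge d m : (forall m, 0 <= d m) -> (1 <= m)%N ->
  wterm d m <= weighted_sum d.
Proof.
move=> d0 m1; have nd : nondecreasing_seq (fun N => \sum_(1 <= m < N) wterm d m).
  apply/nondecreasing_seqP => -[|n]; first by rewrite !big_geq.
  by rewrite [leRHS]big_nat_recr //= lerDl wterm_ge0.
apply: le_trans (nondecreasing_cvgn_le nd (wsum_cvg d0) m.+1).
by rewrite big_nat_recr //= lerDr sumr_ge0// => i _; exact: wterm_ge0.
Qed.

Lemma weighted_sum_ge0 d : (forall m, 0 <= d m) -> 0 <= weighted_sum d.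
Proof.
move=> d0; apply: le_trans (@weighted_sum_ge d 1 d0 _) => //; exact: wterm_ge0.
Qed.

Lemma weighted_sum_le d N (e : R) : (forall m, 0 <= d m) -> 0 <= e ->
  (forall m, (1 <= m <= N)%N -> d m <= e) -> weighted_sum d <= e + 2 ^- N.
Proof.
move=> d0 e0 de; apply: limr_le; first exact: wsum_cvg.
by apply: nearW => n; exact: wsum_partial_bound.
Qed.

Lemma weighted_sum_lt d m (e : R) : (forall m, 0 <= d m) -> (1 <= m)%N -> 0 < e ->
  weighted_sum d < 2 ^- m * (e / (1 + e)) -> d m < e.
Proof.
move=> d0 m1 e0 /(le_lt_trans (weighted_sum_ge d0 m1)).
have dm := d0 m.
rewrite /wterm ltr_pM2l ?invr_gt0 ?exprn_gt0//.
rewrite ltr_pdivrMr ?ltr_wpDr// mulrAC ltr_pdivlMr ?ltr_wpDr ?(ltW e0)//.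
by rewrite !mulrDr !mulr1 (mulrC e) ltrD2r.
Qed.

Lemma dist_sup_ge0 (L : set (Cplx R)) f g : 0 <= dist_sup L f g.
Proof.
rewrite /dist_sup; set S := [set _ | _ in _].
(* A set without supremum has [sup] equal to 0. *)
have [hS|nS] := pselect (has_sup S); last by rewrite sup_out.
have [x Sx] := hS.1; have x0 : 0 <= x by case: Sx => z _ <-; exact: nc_ge0.
by apply: le_trans x0 _; apply: ub_le_sup => //; exact: hS.2.
Qed.

Lemma dist_sup_ub (L : set (Cplx R)) f g z (M : R) : (forall z, L z -> nc (f z - g z) <= M) ->
  L z -> nc (f z - g z) <= dist_sup L f g.
Proof.
by move=> LM Lz; apply: ub_le_sup; [exists M => _ [w Lw <-]; exact: LM|exists z].
Qed.

Lemma dist_sup_le (L : set (Cplx R)) f g (e : R) : 0 <= e ->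
  (forall z, L z -> nc (f z - g z) <= e) -> dist_sup L f g <= e.
Proof.
move=> e0 Le; rewrite /dist_sup; set S := [set _ | _ in _].
have [[z Lz]|L0] := pselect (L !=set0).
  by apply: ge_sup; [exists (nc (f z - g z)), z|move=> _ [w Lw <-]; exact: Le].
rewrite (_ : S = set0) ?sup0//; apply/seteqP; split => // x [z Lz _].
by apply: L0; exists z.
Qed.

Lemma dist_Lp_ge0 V p f g : 0 <= dist_Lp V p f g.
Proof.
rewrite /dist_Lp; case: ifP => _; first exact: powR_ge0.
by rewrite fine_ge0// integral_ge0// => w _; exact: (@powR_nc_ge0 _ _ (fun z => f z - g z)).
Qed.

(** The minimum serves both cases of the distance: [e ^ p] when a p-th root is taken, [e] when
    [p < 1]. It also forces the integral to be finite, since [fine] sends an infinite one to 0. *)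
Lemma dist_Lp_le V p f g (e : R) : 0 < p -> 0 < e ->
  (integral_pow V p (fun z => (f z - g z : Cplx R)%R) <= (Num.min e (e `^ p))%:E)%E ->
  dist_Lp V p f g <= e.
Proof.
move=> p0 e0 I; have I0 : (0 <= integral_pow V p (fun z => (f z - g z : Cplx R)%R))%E.
  by rewrite integral_ge0// => w _; exact: (@powR_nc_ge0 _ _ (fun z => f z - g z)).
have Ifin : integral_pow V p (fun z => (f z - g z : Cplx R)%R) \is a fin_num.
  by rewrite ge0_fin_numE// (le_lt_trans I)// ltry.
have : fine (integral_pow V p (fun z => (f z - g z : Cplx R)%R)) <= Num.min e (e `^ p).
  by rewrite -lee_fin fineK.
rewrite le_min /dist_Lp => /andP[Ie Iep]; case: ifP => // _.
rewrite -[leRHS](powRr1 (ltW e0)) -(mulfV (lt0r_neq0 p0)) powRrM.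
apply: ge0_ler_powR => //; rewrite ?nnegrE ?powR_ge0 ?fine_ge0//.
by rewrite invr_ge0 ltW.
Qed.

Lemma dist_OL_ge0 (K : nat -> set (Cplx R)) V p f g : 0 <= dist_OL K V p f g.
Proof.
apply: weighted_sum_ge0 => m; case: ifP => _; [exact: dist_Lp_ge0|exact: dist_sup_ge0].
Qed.

Lemma dist_OL_pointwise (K : nat -> set (Cplx R)) V p m z (e : R) f g :
  (2 <= m)%N -> compact (K m) -> cont_in (K m) f -> cont_in (K m) g -> K m z ->
  0 < e -> dist_OL K V p f g < 2 ^- m * (e / (1 + e)) -> nc (f z - g z) < e.
Proof.
move=> m2 cK cf cg Kz e0 de.
have cfg w : K m w -> {for w, continuous (fun z => f z - g z : Cplx R)}.
  by move=> Kw; exact: (@cvgBC _ _ (nbhs w) (nbhs_filter w) f g _ _ (cf w Kw) (cg w Kw)).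
have [M hM] := compact_nc_bounded cK cfg.
apply: le_lt_trans (dist_sup_ub hM Kz) _.
have m1 : (1 <= m)%N by exact: ltnW.
have d0 n : 0 <= (if n == 1%N then dist_Lp V p f g else dist_sup (K n) f g).
  by case: ifP => _; [exact: dist_Lp_ge0|exact: dist_sup_ge0].
have := weighted_sum_lt d0 m1 e0 de.
by case: eqP m2 => [->|].
Qed.

Lemma dist_OL_small (K : nat -> set (Cplx R)) V p N (e : R) f g : 0 < p -> 0 < e ->
  (integral_pow V p (fun z => (f z - g z : Cplx R)%R) <= (Num.min e (e `^ p))%:E)%E ->
  (forall m z, (2 <= m <= N)%N -> K m z -> nc (f z - g z) <= e) ->
  dist_OL K V p f g <= e + 2 ^- N.
Proof.
move=> p0 e0 I Ke; apply: weighted_sum_le => [m||m /andP[m1 mN]]; last 1 first.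
- case: eqP => [_|/eqP m1']; first exact: dist_Lp_le.
  apply: dist_sup_le => [|z]; first exact: ltW.
  apply: Ke; rewrite mN andbT; by case: m m1 m1' {mN} => // -[].
- by case: ifP => _; [exact: dist_Lp_ge0|exact: dist_sup_ge0].
- exact: ltW.
Qed.

End metrics.

(** * Gliding hump *)

Section geometric_series.
Context {R : realType}.
Implicit Types (f g h : Cplx R -> Cplx R) (z : Cplx R).

(** A geometric bound from some rank on becomes one for all [k], the finitely many first terms being
    absorbed in the constant. *)
Lemma tail_bound (b : nat -> R) (e : R) N : 0 < e -> (forall k, 0 <= b k) ->
  (forall k, (N <= k)%N -> b k <= e * 2 ^- k.+1) ->
  exists C, forall k, b k <= C * 2 ^- k.+1.
Proof.
move=> e0 b0 be; exists (e + \sum_(0 <= k < N) b k * 2 ^+ k.+1) => k.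
have s0 j : 0 <= b j * 2 ^+ j.+1 by rewrite mulr_ge0// exprn_ge0.
have [Nk|kN] := leqP N k.
  rewrite (le_trans (be k Nk))// ler_wpM2r ?invr_ge0 ?exprn_ge0// lerDl.
  by rewrite sumr_ge0.
rewrite ler_pdivlMr ?exprn_gt0// (bigD1_seq k) ?iota_uniq ?mem_index_iota//=.
by rewrite addrCA lerDl addr_ge0 ?(ltW e0)// sumr_ge0.
Qed.

Lemma nc_partial_sum_diff (u : nat -> Cplx R) (C : R) m n : (m <= n)%N ->
  (forall k, nc (u k) <= C * 2 ^- k.+1) ->
  nc (\sum_(0 <= k < n) u k - \sum_(0 <= k < m) u k) <= C * (2 ^- m - 2 ^- n).
Proof.
move=> /subnK <- uC; elim: (n - m)%N => [|k ih].
  by rewrite add0n !subrr nc0 mulr0.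
rewrite addSn big_nat_recr //= addrAC (le_trans (ncD _ _))//.
rewrite (le_trans (lerD ih (uC _)))// -mulrDr.
have h2 : (2 : R) ^- (k + m) = 2 * 2 ^- (k + m).+1.
  by rewrite exprS invfM mulrA mulfV ?mul1r ?pnatr_eq0.
by rewrite h2 le_eqVlt; apply/orP; left; apply/eqP; ring.
Qed.

(** The limit is first found along an ultrafilter; the Cauchy estimate then makes it a limit of the
    whole sequence. *)
Lemma geometric_series_cvg (u : nat -> Cplx R) (C : R) :
  (forall k, nc (u k) <= C * 2 ^- k.+1) ->
  exists2 l : Cplx R, (\sum_(0 <= k < n) u k : Cplx R) @[n --> \oo] --> l & nc l <= C.
Proof.
move=> uC; have C0 : 0 <= C.
  have := le_trans (nc_ge0 _) (uC 0%N).
  by rewrite pmulr_lge0// invr_gt0 exprn_gt0.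
have sC n : nc (\sum_(0 <= k < n) u k) <= C.
  have := nc_partial_sum_diff (leq0n n) uC.
  rewrite [X in _ - X]big_geq// subr0 => h; rewrite (le_trans h)// ler_piMr//.
  by rewrite expr0 invr1 gerBl invr_ge0 exprn_ge0.
have [G [UG sG]] := ultraFilterLemma (@eventually_filter : ProperFilter \oo).
have [l hl] := ultra_bounded_cvg UG sC.
exists l; last first.
  apply/ler_addgt0Pr => e e0; have /(cvgCP _)/(_ _ e0) n1 := hl.
  have [n hn] := filter_ex n1.
  set s := \sum_(0 <= k < n) u k in hn.
  have -> : nc l = nc (s - (s - l)) by congr Normc.normc; ring.
  by rewrite (le_trans (ncD _ _))// ncN lerD//; [exact: sC|exact: ltW].
apply/cvgCP => e e0.
have [N hN] : exists N, C * 2 ^- N < e / 2.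
  have [m hm] : exists m : nat, C / (e / 2) < m%:R.
    exists (Num.bound (C / (e / 2))); apply: archi_boundP.
    by apply: divr_ge0 => //; rewrite divr_ge0// ltW.
  exists m; rewrite ltr_pdivrMr ?exprn_gt0// mulrC -ltr_pdivrMr ?divr_gt0//.
  by rewrite (lt_trans hm)// -natrX ltr_nat ltn_expl.
exists N => // n /= Nn.
have e2 : 0 < e / 2 by rewrite divr_gt0.
have /(cvgCP _)/(_ _ e2) n1 := hl.
have n2 : G [set m | (n <= m)%N] by apply: sG; exists n.
have [m [/= hm nm]] := filter_ex (filterI n1 n2).
set Sm := \sum_(0 <= k < m) u k in hm; set Sn := \sum_(0 <= k < n) u k.
have -> : Sn - l = (Sm - l) - (Sm - Sn) by ring.
rewrite (le_lt_trans (ncD _ _))// ncN (splitr e) ltrD//.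
apply: le_lt_trans hN; apply: le_trans (nc_partial_sum_diff nm uC) _.
rewrite ler_wpM2l// (@le_trans _ _ (2 ^- n))//.
  by rewrite gerBl invr_ge0 exprn_ge0.
by rewrite lef_pV2 ?posrE ?exprn_gt0// ler_weXn2l// ler1n.
Qed.

End geometric_series.

(** * Choice of the coefficients *)

Section gliding_hump.
Context {R : realType}.
Implicit Types (f g h : Cplx R -> Cplx R) (z : Cplx R) (Y : set (Cplx R)).

Lemma small_factor (c e tau : R) : 0 < e -> 0 < tau ->
  exists s, [/\ 0 < s, s <= tau & forall t, 0 <= t <= s -> t * c <= e].
Proof.
move=> e0 t0; exists (Num.min tau (e / (`|c| + 1))).
have c0 : 0 < `|c| + 1 by rewrite ltr_wpDl.
split; first by rewrite lt_min t0 divr_gt0.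
  by rewrite ge_min lexx.
move=> t /andP[t0']; rewrite le_min => /andP[_].
rewrite ler_pdivlMr// => h; apply: le_trans h; rewrite ler_wpM2l//.
by rewrite (le_trans (ler_norm _))// lerDl.
Qed.

Lemma small_factor_seq (g : Cplx R -> Cplx R) (s : seq (Cplx R)) (e tau : R) :
  0 < e -> 0 < tau -> exists r, [/\ 0 < r, r <= tau &
    forall t, 0 <= t <= r -> forall w, w \in s -> t * nc (g w) <= e].
Proof.
move=> e0 t0; elim: s => [|w s [r [r0 rt hr]]]; first by exists tau.
have [q [q0 qr hq]] := small_factor (nc (g w)) e0 r0.
exists q; split=> //; first exact: le_trans rt.
move=> t /andP[t0' tq] v; rewrite in_cons => /orP[/eqP ->|vs].
  by apply: hq; rewrite t0'.
by apply: hr => //; rewrite t0' (le_trans tq).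
Qed.

(** If [f + t * g] were bounded by [M] on [Y] for both [t = r] and [t = r / 2], the difference would
    bound [(r / 2) * g] by [2 * M]. Nothing is assumed of [f]. *)
Lemma hump_step f g Y (s : seq (Cplx R)) (M e tau : R) : 0 < e -> 0 < tau ->
  unbounded_on g Y -> exists t z, [/\ 0 <= t <= tau, Y z,
    M < nc (f z + t%:C%C * g z) & forall w, w \in s -> t * nc (g w) <= e].
Proof.
move=> e0 t0 ug; have [r [r0 rt hr]] := small_factor_seq g s e0 t0.
apply: contrapT => H.
have B t z : 0 <= t <= r -> Y z -> nc (f z + t%:C%C * g z) <= M.
  move=> tr Yz; rewrite leNgt; apply/negP => Mz; apply: H; exists t, z; split=> //.
    by case/andP: tr => -> tr; rewrite (le_trans tr).
  exact: hr.
have [z Yz] := ug (4 * M / r); rewrite ltr_pdivrMr// => hz.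
have B1 : nc (f z + r%:C%C * g z) <= M by apply: B => //; rewrite lexx ltW.
have B2 : nc (f z + (r / 2)%:C%C * g z) <= M.
  by apply: B => //; apply/andP; split; lra.
have M0 : 0 <= M := le_trans (nc_ge0 _) B1.
have : nc ((r / 2)%:C%C * g z) <= M + M.
  have -> : (r / 2)%:C%C * g z = (f z + r%:C%C * g z) - (f z + (r / 2)%:C%C * g z).
    have -> : r%:C%C = (r / 2)%:C%C + (r / 2)%:C%C :> Cplx R.
      by rewrite -(rmorphD (real_complex R)) -splitr.
    by ring.
  by rewrite (le_trans (ncD _ _))// ncN lerD.
rewrite ncM nc_realE ger0_norm; last lra.
by move: (nc (g z)) hz => q; lra.
Qed.

(* The recursion carries the partial sum and the list of the points chosen so far, at
   which all later terms are kept small. *)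
Lemma gliding_hump f (G : nat -> Cplx R -> Cplx R) (Y : nat -> set (Cplx R))
  (M tau : nat -> R) : (forall k, 0 < tau k) ->
  (forall k, unbounded_on (G k) (Y k)) ->
  exists t : nat -> R, (forall k, 0 <= t k <= tau k) /\
    forall h, (forall z, (f z + \sum_(0 <= k < n) (t k)%:C%C * G k z : Cplx R)
        @[n --> \oo] --> h z) ->
      forall k, exists2 z, Y k z & M k <= nc (h z).
Proof.
move=> t0 uG.
have e0 k : 0 < (2 : R) ^- k.+1 by rewrite invr_gt0 exprn_gt0.
pose state := ((Cplx R -> Cplx R) * seq (Cplx R))%type.
have step (x : nat * state) : exists tz : R * Cplx R,
  [/\ 0 <= tz.1 <= tau x.1, Y x.1 tz.2,
    M x.1 + 1 < nc (x.2.1 tz.2 + tz.1%:C%C * G x.1 tz.2) &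
    forall w, w \in x.2.2 -> tz.1 * nc (G x.1 w) <= 2 ^- x.1.+1].
  have [t [z [h1 h2 h3 h4]]] := hump_step x.2.1 x.2.2 (M x.1 + 1) (e0 x.1) (t0 x.1) (uG x.1).
  by exists (t, z).
have [T hT] := choice step.
pose S := fix S n : state := if n is m.+1 then
  let x := T (m, S m) in
  (fun z => (S m).1 z + x.1%:C%C * G m z, x.2 :: (S m).2) else (f, [::]).
pose t k := (T (k, S k)).1; pose zz k := (T (k, S k)).2.
have SE n z : (S n).1 z = f z + \sum_(0 <= k < n) (t k)%:C%C * G k z.
  elim: n => [|n ih]; first by rewrite big_geq// addr0.
  by rewrite big_nat_recr //= addrA -ih.
have zin k n : (k < n)%N -> zz k \in (S n).2.
  elim: n => // n ih; rewrite ltnS leq_eqVlt => /predU1P[->|/ih kn] /=.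
    by rewrite in_cons eqxx.
  by rewrite in_cons kn orbT.
exists t; split=> [k|h hh k]; first by have [] := hT (k, S k).
have [_ Yk Mk _] := hT (k, S k); exists (zz k) => //.
(* The surplus 1 won at step [k] pays for all later terms: step [n] costs at most [2 ^- (n + 1)] at
   the point [zz k], leaving [2 ^- (n + 1)] in reserve. *)
have low n : (k < n)%N -> M k + 2 ^- n < nc ((S n).1 (zz k)).
  elim: n => // n ih; rewrite ltnS leq_eqVlt => /predU1P[<-|kn].
    apply: le_lt_trans Mk; rewrite lerD2l invf_le1 ?exprn_gt0//.
    by rewrite exprn_ege1// ler1n.
  have [/andP[tn0 _] _ _ /(_ _ (zin _ _ kn)) small] := hT (n, S n).
  have h2 : (2 : R) ^- n = 2 * 2 ^- n.+1.
    by rewrite exprS invfM mulrA mulfV ?mul1r ?pnatr_eq0.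
  have := ih kn; rewrite h2 /=.
  have := ncB_ge ((S n).1 (zz k)) (- ((t n)%:C%C * G n (zz k))).
  rewrite ncN opprK ncM nc_realE ger0_norm// -/(t n).
  move: small => /=; rewrite -/(t n).
  move: (nc (_ + _)) (nc ((S n).1 _)) (t n * nc _) (2 ^- n.+1) => a b c d.
  lra.
apply/ler_addgt0Pr => e e1.
have /(cvgCP _)/(_ _ e1) n1 := hh (zz k).
have n2 : \oo [set n | (k < n)%N] by exists k.+1.
have [n [/= hn kn]] := filter_ex (filterI n1 n2).
rewrite -SE in hn; have := low n kn.
have p0 : 0 <= (2 : R) ^- n by rewrite invr_ge0 exprn_ge0.
have := ncB_ge ((S n).1 (zz k)) (h (zz k)).
move: (nc ((S n).1 _)) (nc (h _)) (nc (_ - _)) (2 ^- n) hn p0 => a b c d.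
lra.
Qed.

End gliding_hump.

(** * Small series of singular functions *)

Section perturbation.
Context {R : realType}.
Implicit Types (f g h : Cplx R -> Cplx R) (z w : Cplx R) (O V : set (Cplx R)).

Lemma exhaustive_mono O (K : nat -> set (Cplx R)) m n : exhaustive O K ->
  (2 <= m)%N -> (m <= n)%N -> K m `<=` K n.
Proof.
move=> [_ Ki _] m2 /subnK <-; elim: (n - m)%N => // k ih z /ih Kz.
rewrite addSn; apply: interior_subset; apply: Ki => //.
by rewrite (leq_trans m2)// leq_addl.
Qed.

Lemma exhaustive_sub O (K : nat -> set (Cplx R)) m : exhaustive O K ->
  (2 <= m)%N -> K m `<=` O.
Proof. by move=> [_ _ <-] m2 z Kz; exists m. Qed.

Lemma exhaustive_local O (K : nat -> set (Cplx R)) z : exhaustive O K -> O z ->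
  exists m (r : R), [/\ (2 <= m)%N, 0 < r & forall w, nc (w - z) < r -> K m w].
Proof.
move=> [_ Ki KO]; rewrite -KO => -[m /= m2 Kz].
have /nbhsC[r r0 hr] := Ki m m2 z Kz.
by exists m.+1, r; split=> //; exact: leqW.
Qed.

Lemma small_powR (p c e tau : R) : 0 < p -> 0 <= c -> 0 < e -> 0 < tau ->
  exists s, [/\ 0 < s, s <= tau & forall t, 0 <= t <= s -> t `^ p * c <= e].
Proof.
move=> p0 c0 e0 t0; have c1 : 0 < c + 1 by rewrite ltr_wpDl.
have ec : 0 < e / (c + 1) by rewrite divr_gt0.
exists (Num.min tau ((e / (c + 1)) `^ p^-1)).
split; first by rewrite lt_min t0 powR_gt0.
  by rewrite ge_min lexx.
move=> t /andP[tt]; rewrite le_min => /andP[_ ts].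
have : t `^ p <= e / (c + 1).
  have -> : e / (c + 1) = ((e / (c + 1)) `^ p^-1) `^ p.
    by rewrite -powRrM mulVf ?lt0r_neq0// powRr1// ltW.
  have n1 : t \in Num.nneg by rewrite nnegrE.
  have n2 : (e / (c + 1)) `^ p^-1 \in Num.nneg by rewrite nnegrE powR_ge0.
  exact: (ge0_ler_powR (ltW p0) n1 n2 ts).
rewrite ler_pdivlMr// => h; apply: le_trans h.
by rewrite ler_wpM2l ?powR_ge0// lerDl.
Qed.

Lemma cvg_uniqueC T (F : set_system T) {PF : ProperFilter F} (u : T -> Cplx R)
  (l l' : Cplx R) : u @ F --> l -> u @ F --> l' -> l = l'.
Proof.
move=> ul ul'; apply/eqP; rewrite -subr_eq0 -nc_eq0 eq_le nc_ge0 andbT.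
apply/ler_addgt0Pr => e e0; rewrite add0r; have e2 : 0 < e / 2 by rewrite divr_gt0.
have /(cvgCP _)/(_ _ e2) n1 := ul; have /(cvgCP _)/(_ _ e2) n2 := ul'.
have [n [h1 h2]] := filter_ex (filterI n1 n2).
have -> : l - l' = (u n - l') - (u n - l) by ring.
by rewrite (le_trans (ncD _ _))// ncN (splitr e) lerD// ltW.
Qed.

Lemma integral_pow_ge0 V p f : (0 <= integral_pow V p f)%E.
Proof. by apply: integral_ge0 => w _; exact: (@powR_nc_ge0 _ p f). Qed.

Lemma derivable_partial_sum (G : nat -> Cplx R -> Cplx R) n z :
  (forall k, derivable (G k) z 1) ->
  derivable (fun w => \sum_(0 <= k < n) G k w : Cplx R) z 1.
Proof.
move=> dG; elim: n => [|n ih].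
  rewrite (_ : (fun w => _) = fun=> 0); first exact: derivable_cstC.
  by apply/funext => w; rewrite big_geq.
rewrite (_ : (fun w => _) = fun w => (\sum_(0 <= k < n) G k w : Cplx R) + G n w).
  exact: (@derivable_addC _ (fun w => \sum_(0 <= k < n) G k w) (G n) z ih (dG n)).
by apply/funext => w; rewrite big_nat_recr.
Qed.

Lemma small_integral_pow V (p e tau : R) g : 0 < p -> 0 < e -> 0 < tau ->
  open V -> cont_in V g -> (integral_pow V p g < +oo)%E ->
  exists s, [/\ 0 < s, s <= tau & forall t : R, 0 <= t <= s ->
    (integral_pow V p (fun z => (t%:C%C * g z)%R) <= e%:E)%E].
Proof.
move=> p0 e0 t0 oV cg Ig.
have If : integral_pow V p g = (fine (integral_pow V p g))%:E.
  by rewrite fineK// ge0_fin_numE// integral_pow_ge0.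
have [|s [s0 st hs]] := small_powR (c := fine (integral_pow V p g)) p0 _ e0 t0.
  by rewrite fine_ge0// integral_pow_ge0.
exists s; split=> // t ts; rewrite integral_powZ// nc_realE ger0_norm; last by case/andP: ts.
by rewrite If -EFinM lee_fin; exact: hs.
Qed.

Lemma finite_small (Q : nat -> R -> Prop) N (tau : R) : 0 < tau ->
  (forall n tau, 0 < tau -> exists s, [/\ 0 < s, s <= tau & forall t, 0 <= t <= s -> Q n t]) ->
  exists s, [/\ 0 < s, s <= tau & forall n, (n < N)%N -> forall t, 0 <= t <= s -> Q n t].
Proof.
move=> t0 hQ; elim: N => [|N [s [s0 st hs]]]; first by exists tau.
have [r [r0 rs hr]] := hQ N s s0; exists r; split=> //; first exact: le_trans st.
move=> n; rewrite ltnS leq_eqVlt => /predU1P[->//|nN] t /andP[t1 t2].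
by apply: hs => //; rewrite t1 (le_trans t2).
Qed.

(** The bound [tau k] copes with one compact set and with the exponents [P n], [n <= N + k]. For
    [n <= N] every term is controlled, which gives the estimates by [e] and [eta n]; for larger [n]
    only finitely many terms escape, and these do not affect convergence or finiteness. *)
Lemma perturbation O V (K : nat -> set (Cplx R)) (G : nat -> Cplx R -> Cplx R)
    (P eta : nat -> R) N (e : R) :
  open O -> open V -> V `<=` O -> exhaustive O K ->
  (forall k, holomorphic O (G k)) -> (forall k z, ~ O z -> G k z = 0) ->
  (forall k p, 0 < p -> (integral_pow V p (G k) < +oo)%E) ->
  0 < e -> (forall n, 0 < P n) -> (forall n, 0 < eta n) ->
  exists tau : nat -> R, (forall k, 0 < tau k) /\
    forall t : nat -> R, (forall k, 0 <= t k <= tau k) ->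
    exists phi, [/\ holomorphic O phi, (forall z, ~ O z -> phi z = 0),
      (forall z, (\sum_(0 <= k < n) (t k)%:C%C * G k z : Cplx R) @[n --> \oo] --> phi z),
      (forall m z, (2 <= m <= N)%N -> K m z -> nc (phi z) <= e) &
      forall n, (integral_pow V (P n) phi < +oo)%E /\
        ((n <= N)%N -> (integral_pow V (P n) phi <= (eta n)%:E)%E)].
Proof.
move=> oO oV VO eK hG G0 IG e0 P0 eta0.
have cG k m : (2 <= m)%N -> cont_in (K m) (G k).
  move=> m2 z /(exhaustive_sub eK m2) Oz.
  by apply: derivable_continuousC; exact: hG.
have cV k : cont_in V (G k) := holomorphic_cont VO (hG k).
have cK m : (2 <= m)%N -> compact (K m) by case: eK => + _ _; apply.
have bK k m : (2 <= m)%N -> exists M, forall z, K m z -> nc (G k z) <= M.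
  by move=> m2; exact: compact_nc_bounded (cK m m2) (cG k m m2).
have q0 k : 0 < (2 : R) ^- k.+1 by rewrite invr_gt0 exprn_gt0.
have w0 k n : 0 < ((2 : R) ^+ k.+1) `^ P n by rewrite powR_gt0// exprn_gt0.
(* The index [(N + k).+2] is at least 2. The integral bound is the share [eta n / 2 ^ (k + 1)]
   divided by the weight that [integral_pow_series] puts on the k-th term. *)
have tauP k : exists s, 0 < s /\ forall t, 0 <= t <= s ->
    (forall z, K (N + k).+2 z -> t * nc (G k z) <= e * 2 ^- k.+1) /\
    (forall n, (n < (N + k).+1)%N -> (integral_pow V (P n) (fun z => t%:C%C * G k z)%R <=
       (eta n / (2 ^ k.+1)%:R / ((2 ^+ k.+1) `^ P n))%:E)%E).
  have [M hM] := bK k (N + k).+2 isT.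
  have e2 : 0 < e * 2 ^- k.+1 by rewrite mulr_gt0.
  have [r [r0 _ hr]] := small_factor M e2 ltr01.
  have [|s [s0 sr hs]] := @finite_small (fun n t =>
      (integral_pow V (P n) (fun z => t%:C%C * G k z)%R <=
       (eta n / (2 ^ k.+1)%:R / ((2 ^+ k.+1) `^ P n))%:E)%E) (N + k).+1 r r0.
    move=> n t t0; apply: small_integral_pow => //; last exact: IG.
    by rewrite !divr_gt0// ltr0n expn_gt0.
  exists s; split=> // t ts; split=> [z Kz|n nN]; last exact: hs.
  have /andP[t0 t1] := ts.
  apply: le_trans (hr t _); last by rewrite t0 (le_trans t1).
  by rewrite ler_wpM2l// hM.
have [tau htau] := choice tauP.
exists tau; split=> [k|t tt]; first by case: (htau k).
have tK k z : K (N + k).+2 z -> nc ((t k)%:C%C * G k z) <= e * 2 ^- k.+1.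
  move=> Kz; have [_ /(_ _ (tt k))[h _]] := htau k.
  by rewrite ncM nc_realE ger0_norm ?h//; case/andP: (tt k).
have tI k n : (n <= N + k)%N -> ((((2 ^+ k.+1) `^ P n)%:E *
     integral_pow V (P n) (fun z => (t k)%:C%C * G k z)%R) <=
       (eta n / (2 ^ k.+1)%:R)%:E)%E.
  move=> nN; have [_ /(_ _ (tt k))[_ /(_ n nN) h]] := htau k.
  apply: (@le_trans _ _ (((2 ^+ k.+1) `^ P n)%:E *
    (eta n / (2 ^ k.+1)%:R / ((2 ^+ k.+1) `^ P n))%:E)%E).
    by rewrite lee_wpmul2l// lee_fin ltW.
  by rewrite -EFinM lee_fin mulrC divfK// lt0r_neq0.
have tC m : (2 <= m)%N -> exists C, forall k z, K m z ->
    nc ((t k)%:C%C * G k z) <= C * 2 ^- k.+1.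
  move=> m2; have [S hS] := choice (fun k => bK k m m2).
  (* From [k = m] on, [K m] lies in the compact set that [tau k] controls; the earlier terms are
     merely bounded on it. *)
  pose b k := if (k < m)%N then `|t k| * `|S k| else e * 2 ^- k.+1.
  have [||C hC] := @tail_bound _ b e m e0.
  - by move=> k; rewrite /b; case: ifP => _; rewrite mulr_ge0// ltW.
  - by move=> k mk; rewrite /b ltnNge mk.
  exists C => k z Kz; apply: le_trans (hC k); rewrite /b; case: ltnP => [km|mk].
    by rewrite ncM nc_realE ler_wpM2l// (le_trans (hS k z Kz))// ler_norm.
  apply: tK; apply: (exhaustive_mono eK m2 _ Kz); do 2 apply: leqW.
  exact: leq_trans mk (leq_addl _ _).
have lim z : exists l : Cplx R, (\sum_(0 <= k < n) (t k)%:C%C * G k z : Cplx R) @[n --> \oo] --> l.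
  have [Oz|nOz] := pselect (O z).
    have [m [r [m2 r0 hr]]] := exhaustive_local eK Oz.
    have [C hC] := tC m m2.
    have Kz : K m z by apply: hr; rewrite subrr nc0.
    by have [l hl _] := geometric_series_cvg (fun k => hC k z Kz); exists l.
  exists 0; apply/cvgCP => d d0; apply: filterE => n.
  by rewrite big1 ?subrr ?nc0// => k _; rewrite G0// mulr0.
have [phi hphi] := choice lim.
have phiO z : ~ O z -> phi z = 0.
  move=> nOz; apply: (cvg_uniqueC (hphi z)); apply/cvgCP => d d0; apply: filterE => n.
  by rewrite big1 ?subrr ?nc0// => k _; rewrite G0// mulr0.
have dG k z : O z -> derivable (fun w => (t k)%:C%C * G k w : Cplx R) z 1.
  move=> Oz; have dc := @derivable_cstC R (t k)%:C%C z.
  exact: (@derivable_mulC R (fun=> (t k)%:C%C : Cplx R) (G k) z dc (hG k z Oz)).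
have hol : holomorphic O phi.
  have [U [UU sU]] := ultraFilterLemma (@eventually_filter : ProperFilter \oo).
  apply: (@cvg_holomorphic _ nat U UU
    (fun n z => \sum_(0 <= k < n) (t k)%:C%C * G k z) phi O oO).
    move=> z Oz; have [m [r [m2 r0 hr]]] := exhaustive_local eK Oz.
    have [C hC] := tC m m2; exists C, r; split=> // n w /hr Kw; split.
      by apply: derivable_partial_sum => k; apply: dG; exact: exhaustive_sub Kw.
    have C0 : 0 <= C.
      by have := le_trans (nc_ge0 _) (hC 0%N w Kw); rewrite pmulr_lge0.
    have := @nc_partial_sum_diff _ _ C 0 n (leq0n n) (fun k => hC k w Kw).
    rewrite [X in _ - X]big_geq// subr0 => h; rewrite (le_trans h)// ler_piMr//.
    by rewrite expr0 invr1 gerBl invr_ge0 exprn_ge0.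
  by move=> z _; apply: cvg_trans (hphi z); exact: cvg_app.
exists phi; split=> //.
  move=> m z /andP[m2 mN] Kz.
  have hz k : nc ((t k)%:C%C * G k z) <= e * 2 ^- k.+1.
    apply: tK; apply: (exhaustive_mono eK m2 _ Kz); do 2 apply: leqW.
    exact: leq_trans mN (leq_addr _ _).
  have [l hl le] := geometric_series_cvg hz.
  by rewrite (cvg_uniqueC (hphi z) hl).
move=> n.
have cF k : cont_in V (fun z => (t k)%:C%C * G k z : Cplx R).
  by move=> z /VO Oz; apply: derivable_continuousC; exact: dG.
have cphi : cont_in V phi := holomorphic_cont VO hol.
have I C : 0 <= C -> (forall k, ((((2 ^+ k.+1) `^ P n)%:E *
     integral_pow V (P n) (fun z => (t k)%:C%C * G k z)%R) <=
       (C / (2 ^ k.+1)%:R)%:E)%E) -> (integral_pow V (P n) phi <= C%:E)%E.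
  move=> C0 hC; apply: le_trans (epsilon_trick0 xpredT C0).
  exact: (integral_pow_series (P0 n) oV cF cphi (fun z _ => hphi z) hC).
split=> [|nN]; last first.
  apply: I => [|k]; first exact: ltW.
  by apply: tI; rewrite (leq_trans nN)// leq_addr.
pose b k := fine (((2 ^+ k.+1) `^ P n)%:E *
     integral_pow V (P n) (fun z => (t k)%:C%C * G k z)%R)%E.
have bE k : (((2 ^+ k.+1) `^ P n)%:E *
     integral_pow V (P n) (fun z => (t k)%:C%C * G k z)%R = (b k)%:E)%E.
  have fJ : integral_pow V (P n) (G k) \is a fin_num.
    by rewrite ge0_fin_numE; [exact: IG|exact: integral_pow_ge0].
  rewrite /b (integral_powZ (t k)%:C%C (P0 n) oV (cV k)) -(fineK fJ).
  by rewrite -!EFinM.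
have b0 k : 0 <= b k.
  rewrite -lee_fin -bE; apply: mule_ge0; last exact: integral_pow_ge0.
  by rewrite lee_fin ltW.
(* Only finiteness is claimed when [n] exceeds [N], so the terms [k < n] may enlarge the
   constant. *)
have [||C hC] := @tail_bound _ b (eta n) n (eta0 n).
- exact: b0.
- move=> k nk; have := tI k n (leq_trans nk (leq_addl _ _)).
  by rewrite bE lee_fin natrX.
have C0 : 0 <= C by have := le_trans (b0 0%N) (hC 0%N); rewrite pmulr_lge0.
apply: (@le_lt_trans _ _ C%:E); last exact: ltry.
by apply: I => // k; rewrite bE lee_fin natrX; exact: hC.
Qed.

End perturbation.

(** * G_delta and dense sets *)

Section generic_spaces.
Context {R : realType}.
Implicit Types (f g h : Cplx R -> Cplx R) (z w : Cplx R) (O V : set (Cplx R)).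
Implicit Types (X : set (Cplx R -> Cplx R)).

(* All that the argument uses of the metric [d] and of the space [X]. *)
Record perturbable O V X (d : (Cplx R -> Cplx R) -> (Cplx R -> Cplx R) -> R) : Prop :=
  Perturbable {
    eval_continuous : forall z (e : R), O z -> 0 < e -> exists2 r : R, 0 < r &
      forall f g, X f -> X g -> d f g < r -> nc (f z - g z) < e;
    small_series : forall f (r : R) (G : nat -> Cplx R -> Cplx R), X f -> 0 < r ->
      (forall k, holomorphic O (G k)) -> (forall k z, ~ O z -> G k z = 0) ->
      (forall k p, 0 < p -> (integral_pow V p (G k) < +oo)%E) ->
      exists tau : nat -> R, (forall k, 0 < tau k) /\
        forall t : nat -> R, (forall k, 0 <= t k <= tau k) ->
        exists h, [/\ X h, d f h < r &
          forall z, (f z + \sum_(0 <= k < n) (t k)%:C%C * G k z : Cplx R)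
            @[n --> \oo] --> h z] }.

(* The extensions are uniformly bounded, so an ultrafilter limit of them exists
   pointwise; it replaces the convergent subsequence of Montel's theorem. *)
Lemma extends_on_limit O i (M : R) (g : nat -> Cplx R -> Cplx R) f : open O ->
  (forall k, extends_on O i M (g k)) ->
  (forall z, O z -> g k z @[k --> \oo] --> f z) -> extends_on O i M f.
Proof.
move=> oO ext gf; have [F hF] := choice ext.
have [U [UU sU]] := ultraFilterLemma (@eventually_filter : ProperFilter \oo).
have lim z : exists l : Cplx R, qdisc i z -> F k z @[k --> U] --> l.
  have [Bz|nBz] := pselect (qdisc i z); last by exists 0.
  have Fb k : nc (F k z) <= M by have [_ b _] := hF k; exact: b.
  have [l hl] := ultra_bounded_cvg UU Fb.
  by exists l.
have [L hL] := choice lim; exists L; split.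
- apply: (@cvg_holomorphic _ nat U UU F L (qdisc i)); first exact: qdisc_open.
    move=> z Bz; have [e e0 eB] := (openCP _).1 (@qdisc_open _ i) z Bz.
    exists M, e; split=> // k w /eB Bw; have [hk bk _] := hF k.
    by split; [exact: hk|exact: bk].
  exact: hL.
- move=> z Bz; apply/ler_addgt0Pr => e e0.
  have /(cvgCP _)/(_ _ e0) n1 := hL z Bz; have [k hk] := filter_ex n1.
  have [_ bk _] := hF k.
  have -> : nc (L z) = nc (F k z - (F k z - L z)) by congr Normc.normc; ring.
  by rewrite (le_trans (ncD _ _))// ncN lerD//; [exact: bk|exact: ltW].
- move=> z Yz; have [Bz Oz] := connected_component_sub Yz.
  apply: (@cvg_uniqueC _ _ U _ (fun k => g k z)).
    by apply: cvg_trans (gf z Oz); exact: cvg_app.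
  have -> : (fun k => g k z) = (fun k => F k z).
    by apply/funext => k; have [_ _ h] := hF k; exact: h.
  exact: hL.
Qed.

(** Enumerates the pairs of a test component and a bound; each pair will give one open set. *)
Definition decode (n : nat) : option (index_type * nat) := unpickle n.

Lemma decode_onto x : exists n, decode n = Some x.
Proof. by exists (pickle x); exact: pickleK. Qed.

Section Gdelta_dense.
Variables (O V : set (Cplx R)) (X : set (Cplx R -> Cplx R)).
Variable d : (Cplx R -> Cplx R) -> (Cplx R -> Cplx R) -> R.
Hypotheses (oO : open O) (pX : perturbable O V X d).
Hypothesis sing : forall i, admissible O i -> exists g, [/\ holomorphic O g,
  (forall z, ~ O z -> g z = 0), unbounded_on g (qcomp O i) &
  forall p, 0 < p -> (integral_pow V p g < +oo)%E].
Local Notation S := (metric_subspace X d).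

Lemma subspace_mem (x : S) : X (sval x).
Proof. by case: x => f /= /set_mem. Qed.

Lemma Gdelta_totally_unbounded : Gdelta [set x : S | totally_unbounded O (sval x)].
Proof.
exists (fun n => [set x : S | if decode n is Some (i, M) then
  admissible O i -> exists2 z, qcomp O i z & M%:R < nc (sval x z) else True]).
  move=> n; suff : metric_open [set x : S | if decode n is Some (i, M) then
     admissible O i -> exists2 z, qcomp O i z & M%:R < nc (sval x z) else True] by [].
  case: (decode n) => [[i M]|]; last by move=> x _; exists 1.
  move=> x /= hx; have [Ai|nAi] := pselect (admissible O i); last by exists 1.
  have [z Yz Mz] := hx Ai; have [_ Oz] := connected_component_sub Yz.
  have e0 : 0 < nc (sval x z) - M%:R by rewrite subr_gt0.
  have [r r0 hr] := eval_continuous pX Oz e0; exists r => // y dy _.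
  exists z => //; have := hr _ _ (subspace_mem x) (subspace_mem y) dy.
  by have := ncB_ge (sval x z) (sval y z); lra.
apply/seteqP; split=> x /=.
  move=> /(totally_unboundedP _ oO) tu n _ /=; case: (decode n) => // -[i M] Ai.
  exact: tu.
move=> H; apply/(totally_unboundedP _ oO) => i Ai M.
have [n hn] := decode_onto (i, Num.bound M).
have := H n I; rewrite /= hn => /(_ Ai)[z Yz Mz].
exists z => //; apply: le_lt_trans Mz; have [M0|M0] := leP 0 M.
  exact/ltW/archi_boundP.
by rewrite (le_trans (ltW M0))// ler0n.
Qed.

Lemma Gdelta_non_extendable : Gdelta [set x : S | ~ extendable O (sval x)].
Proof.
exists (fun n => [set x : S | if decode n is Some (i, M) then
  admissible O i -> ~ extends_on O i M%:R (sval x) else True]).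
  move=> n; suff : metric_open [set x : S | if decode n is Some (i, M) then
     admissible O i -> ~ extends_on O i M%:R (sval x) else True] by [].
  case: (decode n) => [[i M]|]; last by move=> x _; exists 1.
  move=> x /= hx; have [Ai|nAi] := pselect (admissible O i); last by exists 1.
  (* Otherwise extendable functions accumulate at [x] in the metric; they converge to it pointwise,
     and the extension survives in the limit. *)
  apply: contrapT => H.
  have near_x (k : nat) : exists y : S,
      d (sval x) (sval y) < k.+1%:R^-1 /\ extends_on O i M%:R (sval y).
    apply: contrapT => H'; apply: H; exists k.+1%:R^-1; first by rewrite invr_gt0 ltr0n.
    by move=> y dy _ ey; apply: H'; exists y.
  have [y hy] := choice near_x.
  apply: (hx Ai); apply: (@extends_on_limit O i _ (fun k => sval (y k))) => //.
    by move=> k; case: (hy k).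
  move=> z Oz; apply/cvgCP => e e0.
  have [r r0 hr] := eval_continuous pX Oz e0.
  have r10 : 0 <= r^-1 by rewrite invr_ge0 ltW.
  exists (Num.bound r^-1) => // k /= Nk; rewrite ncB.
  apply: hr; [exact: subspace_mem|exact: subspace_mem|].
  have [dk _] := hy k; apply: lt_trans dk _.
  rewrite -[ltRHS]invrK ltf_pV2 ?posrE ?ltr0n ?invr_gt0//.
  by rewrite (lt_le_trans (archi_boundP r10))// ler_nat leqW.
apply/seteqP; split=> x /=.
  move=> ne n _ /=; case: (decode n) => // -[i M] Ai ext; apply: ne.
  by apply/(extendableP _ oO); exists i, M.
move=> H /(extendableP _ oO)[i [M [Ai ext]]].
have [n hn] := decode_onto (i, M).
by have := H n I; rewrite /= hn => /(_ Ai).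
Qed.

Lemma dense_totally_unbounded : dense [set x : S | totally_unbounded O (sval x)].
Proof.
move=> W [x Wx] oW.
have [r r0 hr] : exists2 r : R, 0 < r & forall y : S, d (sval x) (sval y) < r -> W y.
  by have : metric_open W by []; exact.
(* Without admissible tests, as for the whole plane, total unboundedness holds vacuously. *)
have [[i0 A0]|none] := pselect (exists i, admissible O i); last first.
  exists x; split=> //=; apply/(totally_unboundedP _ oO) => i Ai.
  by exfalso; apply: none; exists i.
have [gs hgs] : exists gs : index_type -> Cplx R -> Cplx R, forall i, admissible O i ->
    [/\ holomorphic O (gs i), (forall z, ~ O z -> gs i z = 0),
     unbounded_on (gs i) (qcomp O i) &
     forall p, 0 < p -> (integral_pow V p (gs i) < +oo)%E].
  have ex i : exists g, admissible O i -> [/\ holomorphic O g,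
     (forall z, ~ O z -> g z = 0), unbounded_on g (qcomp O i) &
     forall p, 0 < p -> (integral_pow V p g < +oo)%E].
    have [/sing[g hg]|nA] := pselect (admissible O i); first by exists g.
    by exists (fun=> 0).
  by have [gs hgs] := choice ex; exists gs.
(* Every admissible component recurs with every natural number as the height to reach, which yields
   unboundedness. Other codes are sent to a harmless default so that each step has a singular
   function. *)
pose task n : index_type * nat := if decode n is Some (i, M) then
  (if pselect (admissible O i) then (i, M) else (i0, 0%N)) else (i0, 0%N).
have taskA n : admissible O (task n).1.
  by rewrite /task; case: (decode n) => // -[i M]; case: pselect.
pose G n := gs (task n).1.
have hG k : holomorphic O (G k) by have [] := hgs _ (taskA k).
have G0 k : forall z, ~ O z -> G k z = 0 by have [] := hgs _ (taskA k).
have uG k : unbounded_on (G k) (qcomp O (task k).1) by have [] := hgs _ (taskA k).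
have IG k : forall p, 0 < p -> (integral_pow V p (G k) < +oo)%E.
  by have [] := hgs _ (taskA k).
have [tau [tau0 htau]] := small_series pX (subspace_mem x) r0 hG G0 IG.
have [t [tt ht]] := @gliding_hump _ (sval x) G (fun k => qcomp O (task k).1)
  (fun k => (task k).2%:R) tau tau0 uG.
have [h [Xh dh ch]] := htau t tt.
pose y : S := exist (fun f => f \in X) h (mem_set Xh).
exists y; split=> /=; first exact: hr.
apply/(totally_unboundedP _ oO) => i Ai M.
have [n hn] := decode_onto (i, Num.bound (Num.max M 0)).
have [z] := ht h ch n.
have -> : task n = (i, Num.bound (Num.max M 0)) by rewrite /task hn; case: pselect.
move=> /= Yz Mz; exists z => //; apply: lt_le_trans Mz.
apply: (@le_lt_trans _ _ (Num.max M 0)); first by rewrite le_max lexx.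
by apply: archi_boundP; rewrite le_max lexx orbT.
Qed.

Lemma totally_unbounded_non_extendable f : totally_unbounded O f -> ~ extendable O f.
Proof.
move=> /(totally_unboundedP _ oO) tu /(extendableP _ oO)[i [M [Ai ext]]].
exact: (extends_on_bounded ext Ai (tu i Ai)).
Qed.

Lemma perturbable_Gdelta_dense :
  Gdelta_dense_in X d [set f | totally_unbounded O f] /\
  Gdelta_dense_in X d [set f | ~ extendable O f].
Proof.
split; split.
- exact: Gdelta_totally_unbounded.
- exact: dense_totally_unbounded.
- exact: Gdelta_non_extendable.
- move=> W W0 oW; have [x [Wx tu]] := dense_totally_unbounded W0 oW.
  by exists x; split=> //; exact: totally_unbounded_non_extendable.
Qed.

End Gdelta_dense.
End generic_spaces.

(** * The spaces [OL] and [OL_cap] *)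

Section function_space_instances.
Context {R : realType}.
Implicit Types (f g h : Cplx R -> Cplx R) (z : Cplx R) (O V : set (Cplx R)).

Lemma pow2_small (r : R) : 0 < r -> exists N, 2 ^- N < r.
Proof.
move=> r0; have i0 : 0 <= r^-1 by rewrite invr_ge0 ltW.
exists (Num.bound r^-1); rewrite -[ltRHS]invrK ltf_pV2 ?posrE ?exprn_gt0 ?invr_gt0//.
by rewrite (lt_trans (archi_boundP i0))// -natrX ltr_nat ltn_expl.
Qed.

Lemma nc_sub_add f g z : nc (f z - (f z + g z)) = nc (g z).
Proof. by rewrite -[RHS]ncN; congr Normc.normc; ring. Qed.

Lemma integral_pow_sub_add V p f g :
  integral_pow V p (fun z => (f z - (f z + g z) : Cplx R)%R) = integral_pow V p g.
Proof. by apply: eq_integral => w _; rewrite (nc_sub_add f g (pt w)). Qed.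

Lemma cvg_addC (c l : Cplx R) (u : nat -> Cplx R) : u n @[n --> \oo] --> l ->
  (c + u n : Cplx R) @[n --> \oo] --> c + l.
Proof.
move=> /(cvgCP _) ul; apply/cvgCP => e /ul; apply: filterS => n.
by rewrite opprD addrACA subrr add0r.
Qed.

Lemma OL_add O V p f g : 0 < p -> open V -> V `<=` O -> OL O V p f ->
  holomorphic O g -> (forall z, ~ O z -> g z = 0) ->
  (integral_pow V p g < +oo)%E -> OL O V p (fun z => f z + g z).
Proof.
move=> p0 oV VO [hf f0 If] hg g0 Ig; split.
- move=> z Oz; exact: (derivableD (hf z Oz) (hg z Oz)).
- by move=> z nO; rewrite f0// g0// addr0.
- exact: (integral_pow_add p0 oV (holomorphic_cont VO hf) (holomorphic_cont VO hg) If Ig).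
Qed.

(** The point lies in some [K m] with [m >= 2], whose term in the metric does not involve the
    exponent; hence [r] precedes [p]. *)
Lemma dist_OL_eval O V (K : nat -> set (Cplx R)) z (e : R) : exhaustive O K -> O z ->
  0 < e -> exists2 r : R, 0 < r & forall p f g, holomorphic O f -> holomorphic O g ->
    dist_OL K V p f g < r -> nc (f z - g z) < e.
Proof.
move=> eK Oz e0; have [m [s [m2 s0 hs]]] := exhaustive_local eK Oz.
have Kz : K m z by apply: hs; rewrite subrr nc0.
have cK : compact (K m) by case: eK => + _ _; apply.
exists (2 ^- m * (e / (1 + e))).
  by rewrite mulr_gt0 ?invr_gt0 ?exprn_gt0// divr_gt0// addr_gt0.
move=> p f g hf hg; apply: dist_OL_pointwise => //;
  exact: (holomorphic_cont (exhaustive_sub eK m2)).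
Qed.

Lemma perturbable_OL O V (K : nat -> set (Cplx R)) p : open O -> open V -> V `<=` O ->
  exhaustive O K -> 0 < p -> perturbable O V (OL O V p) (dist_OL K V p).
Proof.
move=> oO oV VO eK p0; split=> [z e Oz e0|f r G Xf r0 hG G0 IG].
  have [r r0 hr] := dist_OL_eval V eK Oz e0; exists r => // f g [hf _ _] [hg _ _].
  exact: hr.
have [N hN] := pow2_small (divr_gt0 r0 (ltr0n _ 2)).
pose e := r / 4; have e0 : 0 < e by rewrite divr_gt0.
have er : e + 2 ^- N < r by rewrite /e; lra.
have eta0 (n : nat) : 0 < Num.min e (e `^ p) by rewrite lt_min e0 powR_gt0.
have [tau [tau0 htau]] :=
  perturbation N oO oV VO eK hG G0 IG e0 (fun _ : nat => p0) eta0.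
exists tau; split=> // t /htau[phi [hphi phi0 cphi Kphi Iphi]].
exists (fun z => f z + phi z); split.
- have [Ip _] := Iphi 0%N; exact: (OL_add p0 oV VO Xf hphi phi0 Ip).
- apply: (@le_lt_trans _ _ (e + 2 ^- N)); last exact: er.
  apply: dist_OL_small => //.
    by rewrite integral_pow_sub_add; have [_] := Iphi 0%N; apply.
  by move=> m z mN Kz; rewrite nc_sub_add; exact: Kphi Kz.
- by move=> z; exact: cvg_addC.
Qed.

Lemma perturbable_OL_cap O V (K : nat -> set (Cplx R)) (q : \bar R) (p_ : nat -> R) :
  open O -> open V -> bounded_set V -> V `<=` O -> exhaustive O K ->
  (forall n, (1 <= n)%N -> 0 < p_ n) -> (forall n, (1 <= n)%N -> p_ n < p_ n.+1) ->
  (p_ n)%:E @[n --> \oo] --> q ->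
  perturbable O V (OL_cap O V q) (dist_OL_cap K V p_).
Proof.
move=> oO oV bV VO eK p0 pinc pq.
(* Strict monotonicity puts each [p_ n] below [q], and convergence puts each [p < q] below some
   [p_ n]. *)
have limq : limn (fun n => (p_ n)%:E) = q by exact: cvg_lim.
have cvgp : cvgn (fun n => (p_ n)%:E) by apply/cvg_ex; exists q.
have mono m n : (1 <= m)%N -> (m <= n)%N -> p_ m <= p_ n.
  move=> m1 /subnK <-; elim: (n - m)%N => // k ih.
  by rewrite addSn (le_trans ih)// ltW// pinc// (leq_trans m1)// leq_addl.
have ltq n : (1 <= n)%N -> ((p_ n)%:E < q)%E.
  move=> n1; apply: (@lt_le_trans _ _ (p_ n.+1)%:E); first by rewrite lte_fin pinc.
  rewrite -limq; apply: lime_ge => //; exists n.+1 => // m /= nm.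
  by rewrite lee_fin; exact: mono.
have above p : (p%:E < q)%E -> exists2 n, (1 <= n)%N & p < p_ n.
  move=> pltq; apply: contrapT => H; move: pltq; rewrite ltNge => /negP; apply.
  rewrite -limq; apply: lime_le => //; exists 1%N => // n /= n1.
  by rewrite lee_fin leNgt; apply/negP => pn; apply: H; exists n.
have capOL f n : OL_cap O V q f -> (1 <= n)%N -> OL O V (p_ n) f.
  by move=> Xf n1; apply: Xf; split; [exact: p0|exact: ltq].
have d0 f g n : 0 <= dist_OL K V (p_ n) f g by exact: dist_OL_ge0.
split=> [z e Oz e0|f r G Xf r0 hG G0 IG].
  have [r r0 hr] := dist_OL_eval V eK Oz e0.
  (* The first exponent alone controls point values; the radius is its share of the outer sum. *)
  exists (2 ^- 1 * (r / (1 + r))).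
    by rewrite mulr_gt0 ?invr_gt0 ?exprn_gt0// divr_gt0// addr_gt0.
  move=> f g Xf Xg dfg; have [hf _ _] := capOL f 1%N Xf isT.
  have [hg _ _] := capOL g 1%N Xg isT; apply: (hr (p_ 1%N)) => //.
  exact: (@weighted_sum_lt _ _ 1%N r (d0 f g) isT r0 dfg).
have [N hN] := pow2_small (divr_gt0 r0 (ltr0n _ 4)).
pose e := r / 4; have e0 : 0 < e by rewrite divr_gt0.
(* One [2 ^- N] is the tail over the compact sets inside each [dist_OL], the other the tail over the
   exponents. *)
have er : (e + 2 ^- N) + 2 ^- N < r by rewrite /e; lra.
(* Exponents are numbered from 1, the family in [perturbation] from 0. *)
have P0 n : 0 < p_ n.+1 by exact: p0.
have eta0 n : 0 < Num.min e (e `^ p_ n.+1) by rewrite lt_min e0 powR_gt0.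
have [tau [tau0 htau]] := perturbation N oO oV VO eK hG G0 IG e0 P0 eta0.
exists tau; split=> // t /htau[phi [hphi phi0 cphi Kphi Iphi]].
exists (fun z => f z + phi z); split.
- move=> p [pp pltq]; have [[//|n] _ pn] := above p pltq.
  have [In _] := Iphi n.
  have Ip := integral_pow_mono pp (ltW pn) oV bV (holomorphic_cont VO hphi) In.
  exact: (OL_add pp oV VO (Xf p (conj pp pltq)) hphi phi0 Ip).
- apply: (@le_lt_trans _ _ ((e + 2 ^- N) + 2 ^- N)); last exact: er.
  apply: weighted_sum_le; first exact: d0.
    by rewrite addr_ge0// ltW// invr_gt0 exprn_gt0.
  move=> [//|n] /andP[_ nN]; apply: dist_OL_small => //.
    by rewrite integral_pow_sub_add; have [_] := Iphi n; apply; exact: ltnW.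
  by move=> m z mN Kz; rewrite nc_sub_add; exact: Kphi Kz.
- by move=> z; exact: cvg_addC.
Qed.

End function_space_instances.

Theorem theorem5p1 (R : realType) (Omega V : set (Cplx R))
  (K : nat -> set (Cplx R))
  (domOmega : is_domain Omega)
  (openV : open V) (bndV : bounded_set V) (subV : V `<=` Omega)
  (hV : forall alpha, (closure V `&` boundary Omega) alpha ->
     exists beta, [/\ (~` Omega) beta, beta <> alpha &
                      segment alpha beta `<=` ~` Omega])
  (hK : exhaustive Omega K) :
  (forall p : R, 0 < p ->
     Gdelta_dense_in (OL Omega V p) (dist_OL K V p)
       [set f | totally_unbounded Omega f] /\
     Gdelta_dense_in (OL Omega V p) (dist_OL K V p)
       [set f | ~ extendable Omega f]) /\
  (forall (q : \bar R) (p_ : nat -> R), (0 < q)%E ->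
     (forall n, (1 <= n)%N -> 0 < p_ n) ->
     (forall n, (1 <= n)%N -> p_ n < p_ n.+1) ->
     (p_ n)%:E @[n --> \oo] --> q ->
     Gdelta_dense_in (OL_cap Omega V q) (dist_OL_cap K V p_)
       [set f | totally_unbounded Omega f] /\
     Gdelta_dense_in (OL_cap Omega V q) (dist_OL_cap K V p_)
       [set f | ~ extendable Omega f]).
Proof.
have [_ oO _] := domOmega.
have sing i : admissible Omega i -> exists g, [/\ holomorphic Omega g,
    (forall z, ~ Omega z -> g z = 0), unbounded_on g (qcomp Omega i) &
    forall p, 0 < p -> (integral_pow V p g < +oo)%E].
  move=> [Bi nB].
  have [a [cla _ nOa]] :=
    component_adherent (@qdisc_connected _ i) (@qdisc_open _ i) oO nB Bi.
  apply: (exists_singular oO openV bndV subV hV nOa cla).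
  by move=> z /connected_component_sub[].
split=> [p p0|q p_ q0 p0 pinc pq].
  exact: (perturbable_Gdelta_dense oO (perturbable_OL oO openV subV hK p0) sing).
exact: (perturbable_Gdelta_dense oO
  (perturbable_OL_cap oO openV bndV subV hK p0 pinc pq) sing).
Qed.
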